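(* Let $P$ be an annotated process and let $n \in \mathbb{N}\cup\{\infty\}$ be its global parallel complexity. If $\varphi;\Phi;\Gamma \vdash P \triangleleft [I,J]$ and every type in $\Gamma$ is reliable under $\varphi;\Phi$, then $\varphi;\Phi \vDash J \ge n$. Moreover, if $\Gamma$ contains no integer variables (no variable of type $\mathsf{Nat}[\cdot,\cdot]$), then $\varphi;\Phi \vDash I \le n$.
   Context: INDICES. Index variables $i,j,k$ range over a countable set. Indices: $I ::= \tilde I \mid \infty$, $\tilde I ::= i \mid f(\tilde I,\dots,\tilde I)$, where $f$ ranges over function symbols (containing natural constants, $+$, $\times$, and truncated subtraction $n - m = 0$ if $m\ge n$), each interpreted as a function $\mathbb{N}^k\to\mathbb{N}$. A valuation $\rho$ of index variables into $\mathbb{N}$ extends to indices with values in $\mathbb{N}\cup\{\infty\}$ ($\infty$ interpreted as $\infty$). Conventions: $\infty+J=J+\infty=\infty$, $\max(\infty,J)=\infty$, $\min(\infty,J)=J$, $\infty-1=\infty$. A constraint is $I \bowtie J$ with $\bowtie\in\{\le,<,=,\neq\}$; $\Phi$ is a finite set of constraints on a finite set $\varphi$ of index variables; $\varphi;\Phi\vDash C$ means every valuation of $\varphi$ satisfying all of $\Phi$ satisfies $C$. For intervals, $\varphi;\Phi\vDash [I,J]\subseteq[I',J']$ means $I'\le I$ and $J\le J'$ are entailed. USAGES. $U,V ::= 0 \mid (U\mid V) \mid \mathsf{in}^{A_o}_{J_c}.U \mid \mathsf{out}^{A_o}_{J_c}.U \mid\ !U \mid U+V$, where the obligation $A_o=[I,J]$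 is an interval (with $\varphi;\Phi\vDash I\le J$) and the capacity $J_c$ is either a single index $J$ (read as the interval $[-\infty,J]$) or an interval $[I,J]$. Write $\alpha^{A_o}_{J_c}$ for either $\mathsf{in}$ or $\mathsf{out}$; $\mathrm{Lf}([I,J])=I$, $\mathrm{Rt}([I,J])=J$. Usage congruence $\equiv$ is the least congruence with $U\mid 0\equiv U$, commutativity and associativity of $\mid$, $!0\equiv 0$, $!U\equiv\, !U\mid U$, $!(U\mid V)\equiv\, !U\mid !V$, $!!U\equiv\,!U$. Operations: $A_o\oplus J=[0,\mathrm{Lf}(A_o)+J]$; $A_o\oplus[I,J]=[\mathrm{Rt}(A_o)+I,\mathrm{Lf}(A_o)+J]$; $[I,J]\sqcup[I',J']=[\max(I,I'),\max(J,J')]$; $[I,J]+[I',J']=[I+I',J+J']$; $[I,J]+J'=[I,J+J']$ for a single index $J'$ (and symmetrically). Delay $\uparrow^{A}U$ (for $A$ an interval or a capacity): $\uparrow^A 0=0$, $\uparrow^A(U\mid V)=\uparrow^AU\mid\uparrow^AV$, $\uparrow^A(U+V)=\uparrow^AU+\uparrow^AV$, $\uparrow^A(!U)=\,!(\uparrow^AU)$, $\uparrow^A\alpha^{B_o}_{J_c}.U=\alpha^{A+B_o}_{J_c}.U$. Usage reduction $\varphi;\Phi\vdash U\longrightarrow U'$ ($U'$ a usage or $\mathsf{Error}$): (i) if $\varphi;\Phi\vDash B_o\subseteq A_o\oplus I_c$ and $\varphi;\Phi\vDash A_o\subseteq B_o\oplus J_c$ then $\mathsf{in}^{A_o}_{I_c}.U\mid\mathsf{out}^{B_o}_{J_c}.V\longrightarrow\uparrow^{A_o\sqcup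 B_o}(U\mid V)$; (ii) if not both entailments hold, $\mathsf{in}^{A_o}_{I_c}.U\mid\mathsf{out}^{B_o}_{J_c}.V\longrightarrow\mathsf{Error}$; (iii) $U+V\longrightarrow U$ and $U+V\longrightarrow V$; (iv) if $U\longrightarrow U'\neq\mathsf{Error}$ then $U\mid V\longrightarrow U'\mid V$; if $U\longrightarrow\mathsf{Error}$ then $U\mid V\longrightarrow\mathsf{Error}$; (v) closure under $\equiv$ on both sides. $U$ is reliable under $\varphi;\Phi$ if no sequence of reductions from $U$ reaches $\mathsf{Error}$. Subusage $\varphi;\Phi\vdash U\sqsubseteq V$ is the least relation closed under: $U\sqsubseteq 0$; $U_1+U_2\sqsubseteq U_i$ ($i=1,2$); $U\sqsubseteq U'$ implies $U+V\sqsubseteq U'+V$, $V+U\sqsubseteq V+U'$, $U\mid V\sqsubseteq U'\mid V$, $!U\sqsubseteq\,!U'$, $\alpha^{A_o}_{J_c}.U\sqsubseteq\alpha^{A_o}_{J_c}.U'$; closure under $\equiv$ on both sides and transitivity; if $\varphi;\Phi\vDash B_o\subseteq A_o$ and $I_c\le J_c$ (interval inclusion, a single index $J$ read as $[-\infty,J]$) then $\alpha^{A_o}_{I_c}.U\sqsubseteq\alpha^{B_o}_{J_c}.U$; and $(\alpha^{A_o}_{J_c}.U)\mid(\uparrow^{A_o+J_c}V)\sqsubseteq\alpha^{A_o}_{J_c}.(U\mid V)$. PROCESSES. Variables $v$: integer variables $x,y,z$ and channel names $a,b,c$. Expressions $e ::= v\mid 0\mid s(e)$. Processes $P ::= 0\mid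 P\mid Q\mid\ !a(\tilde v).P\mid a(\tilde v).P\mid \bar a\langle\tilde e\rangle.P\mid(\nu a)P\mid \mathsf{tick}.P\mid \mathsf{match}\ e\ \{0\mapsto P;\ s(x)\mapsto Q\}$, considered up to $\alpha$-renaming; annotated processes additionally allow $m:P$ with $m\in\mathbb{N}$. Congruence $\equiv$: least congruence with $P\mid 0\equiv P$, commutativity/associativity of $\mid$, $(\nu a)(\nu b)P\equiv(\nu b)(\nu a)P$, $(\nu a)(P\mid Q)\equiv(\nu a)P\mid Q$ ($a$ not free in $Q$), $0:P\equiv P$, $m:(P\mid Q)\equiv (m:P)\mid(m:Q)$, $m:(\nu a)P\equiv(\nu a)(m:P)$, $m:(n:P)\equiv(m+n):P$. Reduction $\Rightarrow$: $(n:a(\tilde v).P)\mid(m:\bar a\langle\tilde e\rangle.Q)\Rightarrow \max(m,n):(P[\tilde v:=\tilde e]\mid Q)$; $(n:!a(\tilde v).P)\mid(m:\bar a\langle\tilde e\rangle.Q)\Rightarrow(n:!a(\tilde v).P)\mid(\max(m,n):(P[\tilde v:=\tilde e]\mid Q))$; $\mathsf{tick}.P\Rightarrow 1:P$; $\mathsf{match}\ 0\ \{\dots\}\Rightarrow P$; $\mathsf{match}\ s(e)\ \{\dots\}\Rightarrow Q[x:=e]$; closed under $\mid R$, $(\nu a)$, $n:(\cdot)$ and $\equiv$. Local complexity: $C(n:P)=n+C(P)$, $C(P\mid Q)=\max(C(P),C(Q))$, $C((\nu a)P)=C(P)$, $C(G)=0$ for $G$ of the form input, replicated input, output, tick or match.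 The global parallel complexity of $P$ is $\sup\{C(Q)\mid P\Rightarrow^* Q\}$. TYPES. $T ::= \mathsf{Nat}[I,J]\mid \mathsf{ch}(\tilde T)/U\mid \forall\tilde i.\mathsf{serv}^K(\tilde T)/U$ with $K$ an interval. Contexts $\Gamma=v_1:T_1,\dots,v_n:T_n$ ($\Gamma,v:T$ means $v\notin\Gamma$). $\uparrow^A T$ delays the usage of channel/server types and is the identity on $\mathsf{Nat}$. A type is reliable if it is $\mathsf{Nat}[I,J]$ or a channel/server type with reliable usage. $T\mid T'$: $\mathsf{Nat}[I,J]\mid\mathsf{Nat}[I,J]=\mathsf{Nat}[I,J]$, $\mathsf{ch}(\tilde T)/U\mid\mathsf{ch}(\tilde T)/V=\mathsf{ch}(\tilde T)/(U\mid V)$, and similarly for servers with identical $\tilde i,K,\tilde T$; undefined otherwise. $!\mathsf{Nat}[I,J]=\mathsf{Nat}[I,J]$, $!(\mathsf{ch}(\tilde T)/U)=\mathsf{ch}(\tilde T)/!U$, similarly for servers. These operations extend pointwise to contexts. Subtyping: $\mathsf{Nat}[I,J]\le\mathsf{Nat}[I',J']$ if $\varphi;\Phi\vDash I'\le I$ and $J\le J'$; $\mathsf{ch}(\tilde T)/U\le\mathsf{ch}(\tilde T')/V$ if $\tilde T\le\tilde T'$, $\tilde T'\le\tilde T$ and $U\sqsubseteq V$; $\forall\tilde i.\mathsf{serv}^K(\tilde T)/U\le\forall\tilde i.\mathsf{serv}^{K'}(\tilde T')/V$ if under $\varphi,\tilde i;\Phi$ we have $\tilde T\le\tilde T'$,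 $\tilde T'\le \tilde T$, $K=K'$, and $U\sqsubseteq V$ under $\varphi;\Phi$; pointwise on contexts. Define $J;[K_1,K_2]=[0,J+K_2]$, $[\infty,\infty];[K_1,K_2]=[0,0]$, $[\tilde I,J];[K_1,K_2]=[0,J+K_2]$ for $\tilde I\neq\infty$. TYPING (all judgments under $\varphi;\Phi$). Expressions: $v:T\in\Gamma\Rightarrow\Gamma\vdash v:T$; $\Gamma\vdash 0:\mathsf{Nat}[0,0]$; $\Gamma\vdash e:\mathsf{Nat}[I,J]\Rightarrow\Gamma\vdash s(e):\mathsf{Nat}[I+1,J+1]$; $\Delta\vdash e:T'$, $\Gamma\le\Delta$, $T'\le T\Rightarrow\Gamma\vdash e:T$. Processes $\varphi;\Phi;\Gamma\vdash P\triangleleft K$: (zero) $\Gamma\vdash 0\triangleleft[0,0]$; (par) from $\Gamma\vdash P\triangleleft K_1$, $\Delta\vdash Q\triangleleft K_2$ infer $\Gamma\mid\Delta\vdash P\mid Q\triangleleft K_1\sqcup K_2$; (tick) from $\Gamma\vdash P\triangleleft K$ infer $\uparrow^{[1,1]}\Gamma\vdash\mathsf{tick}.P\triangleleft K+[1,1]$; (annot) from $\Gamma\vdash P\triangleleft K$ infer $\uparrow^{[m,m]}\Gamma\vdash m:P\triangleleft K+[m,m]$; (ich) from $\Gamma,a:\mathsf{ch}(\tilde T)/U,\tilde v:\tilde T\vdash P\triangleleft K$ infer $\uparrow^{J_c}\Gamma,a:\mathsf{ch}(\tilde T)/\mathsf{in}^{[0,0]}_{J_c}.U\vdash a(\tilde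 v).P\triangleleft J_c;K$; (iserv) from $\varphi,\tilde i;\Phi;\Gamma,a:\forall\tilde i.\mathsf{serv}^K(\tilde T)/U,\tilde v:\tilde T\vdash P\triangleleft K$ infer $\varphi;\Phi;\uparrow^{J_c}(!\Gamma),a:\forall\tilde i.\mathsf{serv}^K(\tilde T)/!\mathsf{in}^{[0,0]}_{J_c}.U\vdash\ !a(\tilde v).P\triangleleft[0,0]$; (och) from $\Gamma',a:\mathsf{ch}(\tilde T)/V\vdash\tilde e:\tilde T$ and $\Gamma,a:\mathsf{ch}(\tilde T)/U\vdash P\triangleleft K$ infer $\uparrow^{J_c}(\Gamma\mid\Gamma'),a:\mathsf{ch}(\tilde T)/\mathsf{out}^{[0,0]}_{J_c}.(V\mid U)\vdash\bar a\langle\tilde e\rangle.P\triangleleft J_c;K$; (oserv) from $\Gamma',a:\forall\tilde i.\mathsf{serv}^K(\tilde T)/V\vdash\tilde e:\tilde T[\tilde i:=\tilde I]$ (finite indices $\tilde I$) and $\Gamma,a:\forall\tilde i.\mathsf{serv}^K(\tilde T)/U\vdash P\triangleleft K'$ infer $\uparrow^{J_c}(\Gamma\mid\Gamma'),a:\forall\tilde i.\mathsf{serv}^K(\tilde T)/\mathsf{out}^{[0,0]}_{J_c}.(V\mid U)\vdash\bar a\langle\tilde e\rangle.P\triangleleft J_c;(K'\sqcup K[\tilde i:=\tilde I])$; (case) from $\Gamma\vdash e:\mathsf{Nat}[I,J]$, $\varphi;(\Phi,I\le0);\Gamma\vdash P\triangleleft K$ and $\varphi;(\Phi,J\ge1);\Gamma,x:\mathsf{Nat}[I-1,J-1]\vdash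 Q\triangleleft K$ infer $\Gamma\vdash\mathsf{match}\ e\ \{0\mapsto P;s(x)\mapsto Q\}\triangleleft K$; (nu) from $\Gamma,a:T\vdash P\triangleleft K$ with $T$ reliable infer $\Gamma\vdash(\nu a)P\triangleleft K$; (subtype) from $\Delta\vdash P\triangleleft K$, $\Gamma\le\Delta$, $\varphi;\Phi\vDash K\subseteq K'$ infer $\Gamma\vdash P\triangleleft K'$.
   Formalization: In rule (nu) the type T of the bound name must be a channel or server type, not Nat; in (och) and (oserv) a tuple is typed by splitting its context as a parallel composition over its components. With Nat-typed names or a shared context for the tuple, the stated bounds fail. *)

(* Defs.v *)
From Stdlib Require List Relation_Operators.
From mathcomp Require Import all_boot.

Set Implicit Arguments.
Unset Strict Implicit.
Unset Printing Implicit Defensive.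

(* Pi-calculus with ticks, and types with usages for parallel complexity.
   All binders (names and integer variables in processes, index variables in
   types) are de Bruijn indices, so that alpha-renaming is equality. *)

(** * Indices *)

(* Natural numbers extended with infinity; None is infinity. *)
Definition enat := option nat.

Definition ele (x y : enat) : bool :=
  match x, y with
  | _, None => true
  | None, Some _ => false
  | Some m, Some n => m <= n
  end.

(* Function symbols other than the constants, +, * and truncated subtraction,
   which are built into the grammar of indices. *)
Record fsig : Type := Fsig {
  fsym : Type;
  arity : fsym -> nat;
  finterp : forall f : fsym, {ffun 'I_(arity f) -> nat} -> nat
}.

Inductive tidx (S : fsig) : Type :=
| IVar (i : nat)
| IConst (n : nat)
| IAdd (t u : tidx S)
| IMul (t u : tidx S)
| ISub (t u : tidx S)
| IFun (f : fsym S) (args : 'I_(arity f) -> tidx S).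
Arguments IVar {S} i.
Arguments IConst {S} n.

Inductive idx (S : fsig) : Type := Fin (t : tidx S) | Inf.
Arguments Inf {S}.

(* A valuation of the index variables 0, ..., phi - 1 is given by a total
   function; its values beyond phi are never used on well-scoped indices. *)
Definition valuation := nat -> nat.

Fixpoint teval S (r : valuation) (t : tidx S) : nat :=
  match t with
  | IVar i => r i
  | IConst n => n
  | IAdd t u => teval r t + teval r u
  | IMul t u => teval r t * teval r u
  | ISub t u => teval r t - teval r u
  | IFun f args => finterp [ffun i => teval r (args i)]
  end.

Definition ieval S (r : valuation) (I : idx S) : enat :=
  if I is Fin t then Some (teval r t) else None.

Definition icst S (n : nat) : idx S := Fin (IConst n).
Arguments icst {S} n.

Definition idx_of_enat S (n : enat) : idx S :=
  if n is Some k then icst k else Inf.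
Arguments idx_of_enat {S} n.

Definition iadd S (I J : idx S) : idx S :=
  match I, J with Fin t, Fin u => Fin (IAdd t u) | _, _ => Inf end.

(* max(t,u) is t + (u - t), with truncated subtraction. *)
Definition imax S (I J : idx S) : idx S :=
  match I, J with Fin t, Fin u => Fin (IAdd t (ISub u t)) | _, _ => Inf end.

Definition ipred S (I : idx S) : idx S :=
  if I is Fin t then Fin (ISub t (IConst 1)) else Inf.

Fixpoint tscoped S (phi : nat) (t : tidx S) : Prop :=
  match t with
  | IVar i => i < phi
  | IConst _ => True
  | IAdd t u | IMul t u | ISub t u => tscoped phi t /\ tscoped phi u
  | IFun f args => forall i, tscoped phi (args i)
  end.

Definition iscoped S (phi : nat) (I : idx S) : Prop :=
  if I is Fin t then tscoped phi t else True.

(* Index variables are only ever replaced by finite indices. *)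
Fixpoint tsubst S (s : nat -> tidx S) (t : tidx S) : tidx S :=
  match t with
  | IVar i => s i
  | IConst n => IConst n
  | IAdd t u => IAdd (tsubst s t) (tsubst s u)
  | IMul t u => IMul (tsubst s t) (tsubst s u)
  | ISub t u => ISub (tsubst s t) (tsubst s u)
  | IFun f args => IFun (fun i => tsubst s (args i))
  end.

Definition isubst S (s : nat -> tidx S) (I : idx S) : idx S :=
  if I is Fin t then Fin (tsubst s t) else Inf.

(* Weakening by k fresh index variables, numbered 0, ..., k - 1. *)
Definition ishift S (k : nat) : nat -> tidx S := fun i => IVar (k + i).
Arguments ishift {S} k i.

(* Going under a binder of k index variables. *)
Definition iup S (k : nat) (s : nat -> tidx S) : nat -> tidx S :=
  fun i => if i < k then IVar i else tsubst (ishift k) (s (i - k)).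

(* Instantiation of the outermost binder of size Is index variables. *)
Definition iinst S (Is : seq (tidx S)) : nat -> tidx S :=
  fun i => nth (IVar (i - size Is)) Is i.

(** * Constraints and intervals *)

Inductive cmp := Cle | Clt | Ceq | Cne.

Record constr (S : fsig) := Constr { clhs : idx S; crel : cmp; crhs : idx S }.

Definition csat S (r : valuation) (c : constr S) : bool :=
  let x := ieval r (clhs c) in let y := ieval r (crhs c) in
  match crel c with
  | Cle => ele x y
  | Clt => ~~ ele y x
  | Ceq => x == y
  | Cne => x != y
  end.

Definition csubst S (s : nat -> tidx S) (c : constr S) : constr S :=
  Constr (isubst s (clhs c)) (crel c) (isubst s (crhs c)).

Definition wf_constr S (phi : nat) (c : constr S) : Prop :=
  iscoped phi (clhs c) /\ iscoped phi (crhs c).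

Definition entails S (Phi : seq (constr S)) (c : constr S) : Prop :=
  forall r : valuation, all (csat r) Phi -> csat r c.

Definition itv (S : fsig) : Type := (idx S * idx S)%type.

Definition pt S (n : nat) : itv S := (icst n, icst n).
Arguments pt {S} n.

Definition itv_sub S (Phi : seq (constr S)) (A B : itv S) : Prop :=
  entails Phi (Constr B.1 Cle A.1) /\ entails Phi (Constr A.2 Cle B.2).

Definition itv_eq S (Phi : seq (constr S)) (A B : itv S) : Prop :=
  entails Phi (Constr A.1 Ceq B.1) /\ entails Phi (Constr A.2 Ceq B.2).

Definition itv_add S (A B : itv S) : itv S := (iadd A.1 B.1, iadd A.2 B.2).

Definition itv_max S (A B : itv S) : itv S := (imax A.1 B.1, imax A.2 B.2).

Definition itv_subst S (s : nat -> tidx S) (A : itv S) : itv S :=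
  (isubst s A.1, isubst s A.2).

Definition wf_itv S (phi : nat) (Phi : seq (constr S)) (A : itv S) : Prop :=
  [/\ iscoped phi A.1, iscoped phi A.2 & entails Phi (Constr A.1 Cle A.2)].

(* CapLe J stands for [-oo, J]. *)
Inductive cap (S : fsig) : Type := CapLe (J : idx S) | CapItv (A : itv S).

Definition cap_sub S (Phi : seq (constr S)) (c d : cap S) : Prop :=
  match c, d with
  | CapLe J, CapLe J' => entails Phi (Constr J Cle J')
  | CapItv A, CapLe J => entails Phi (Constr A.2 Cle J)
  | CapItv A, CapItv B => itv_sub Phi A B
  | CapLe _, CapItv _ => (* no index is below -oo *)
      forall r : valuation, ~~ all (csat r) Phi
  end.

Definition cap_subst S (s : nat -> tidx S) (c : cap S) : cap S :=
  match c with
  | CapLe J => CapLe (isubst s J)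
  | CapItv A => CapItv (itv_subst s A)
  end.

Definition wf_cap S (phi : nat) (Phi : seq (constr S)) (c : cap S) : Prop :=
  match c with
  | CapLe J => iscoped phi J
  | CapItv A => wf_itv phi Phi A
  end.

(* A (+) c *)
Definition oplus S (A : itv S) (c : cap S) : itv S :=
  match c with
  | CapLe J => (icst 0, iadd A.1 J)
  | CapItv B => (iadd A.2 B.1, iadd A.1 B.2)
  end.

Definition cap_add S (c : cap S) (B : itv S) : itv S :=
  match c with
  | CapLe J => (B.1, iadd J B.2)
  | CapItv A => itv_add A B
  end.

Definition itv_addc S (A : itv S) (c : cap S) : itv S :=
  match c with
  | CapLe J => (A.1, iadd A.2 J)
  | CapItv B => itv_add A B
  end.

(* c ; K, undefined when c is [oo, J] with J other than oo (such a c is not an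
   interval). *)
Definition cap_seq S (c : cap S) (K : itv S) : option (itv S) :=
  match c with
  | CapLe J => Some (icst 0, iadd J K.2)
  | CapItv (Inf, Inf) => Some (pt 0)
  | CapItv (Inf, Fin _) => None
  | CapItv (Fin _, J) => Some (icst 0, iadd J K.2)
  end.

(** * Usages *)

Inductive dir := DIn | DOut.

Inductive usage (S : fsig) : Type :=
| U0
| UPar (U V : usage S)
| UAct (d : dir) (A : itv S) (c : cap S) (U : usage S)
| UBang (U : usage S)
| UPlus (U V : usage S).
Arguments U0 {S}.

Fixpoint usubst S (s : nat -> tidx S) (U : usage S) : usage S :=
  match U with
  | U0 => U0
  | UPar U V => UPar (usubst s U) (usubst s V)
  | UAct d A c U => UAct d (itv_subst s A) (cap_subst s c) (usubst s U)
  | UBang U => UBang (usubst s U)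
  | UPlus U V => UPlus (usubst s U) (usubst s V)
  end.

Fixpoint wf_usage S (phi : nat) (Phi : seq (constr S)) (U : usage S) : Prop :=
  match U with
  | U0 => True
  | UPar U V | UPlus U V => wf_usage phi Phi U /\ wf_usage phi Phi V
  | UAct _ A c U => [/\ wf_itv phi Phi A, wf_cap phi Phi c & wf_usage phi Phi U]
  | UBang U => wf_usage phi Phi U
  end.

(* Delay by a capacity; delay by an interval A is the case CapItv A. *)
Fixpoint udelay S (c : cap S) (U : usage S) : usage S :=
  match U with
  | U0 => U0
  | UPar U V => UPar (udelay c U) (udelay c V)
  | UAct d B e U => UAct d (cap_add c B) e U
  | UBang U => UBang (udelay c U)
  | UPlus U V => UPlus (udelay c U) (udelay c V)
  end.

Inductive ucong (S : fsig) : usage S -> usage S -> Prop :=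
| ucong_refl U : ucong U U
| ucong_sym U V : ucong U V -> ucong V U
| ucong_trans U V W : ucong U V -> ucong V W -> ucong U W
| ucong_par U U' V V' : ucong U U' -> ucong V V' ->
    ucong (UPar U V) (UPar U' V')
| ucong_act d A c U U' : ucong U U' -> ucong (UAct d A c U) (UAct d A c U')
| ucong_bang U U' : ucong U U' -> ucong (UBang U) (UBang U')
| ucong_plus U U' V V' : ucong U U' -> ucong V V' ->
    ucong (UPlus U V) (UPlus U' V')
| ucong_par0 U : ucong (UPar U U0) U
| ucong_parC U V : ucong (UPar U V) (UPar V U)
| ucong_parA U V W : ucong (UPar U (UPar V W)) (UPar (UPar U V) W)
| ucong_bang0 : ucong (UBang U0) U0
| ucong_bangS U : ucong (UBang U) (UPar (UBang U) U)
| ucong_bangP U V : ucong (UBang (UPar U V)) (UPar (UBang U) (UBang V))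
| ucong_bangB U : ucong (UBang (UBang U)) (UBang U).

Definition comm_ok S (Phi : seq (constr S)) (A : itv S) (I : cap S)
    (B : itv S) (J : cap S) : Prop :=
  itv_sub Phi B (oplus A I) /\ itv_sub Phi A (oplus B J).

(* The result None is Error. *)
Inductive ured (S : fsig) (Phi : seq (constr S)) :
    usage S -> option (usage S) -> Prop :=
| ured_comm A I U B J V : comm_ok Phi A I B J ->
    ured Phi (UPar (UAct DIn A I U) (UAct DOut B J V))
             (Some (udelay (CapItv (itv_max A B)) (UPar U V)))
| ured_err A I U B J V : ~ comm_ok Phi A I B J ->
    ured Phi (UPar (UAct DIn A I U) (UAct DOut B J V)) None
| ured_plusl U V : ured Phi (UPlus U V) (Some U)
| ured_plusr U V : ured Phi (UPlus U V) (Some V)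
| ured_par U U' V : ured Phi U (Some U') ->
    ured Phi (UPar U V) (Some (UPar U' V))
| ured_par_err U V : ured Phi U None -> ured Phi (UPar U V) None
| ured_cong U U1 V1 V : ucong U U1 -> ured Phi U1 (Some V1) -> ucong V1 V ->
    ured Phi U (Some V)
| ured_cong_err U U1 : ucong U U1 -> ured Phi U1 None -> ured Phi U None.

Definition ureliable S (Phi : seq (constr S)) (U : usage S) : Prop :=
  forall V, Relation_Operators.clos_refl_trans (usage S) (fun U1 U2 => ured Phi U1 (Some U2)) U V ->
    ~ ured Phi V None.

(* A relation between well-formed usages; the side condition of subu_trans
   ensures that the intermediate usage is one (all other rules preserve
   well-formedness from conclusion to premises). *)
Inductive subu (S : fsig) (phi : nat) (Phi : seq (constr S)) :
    usage S -> usage S -> Prop :=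
| subu_zero U : subu phi Phi U U0
| subu_plusl U V : subu phi Phi (UPlus U V) U
| subu_plusr U V : subu phi Phi (UPlus U V) V
| subu_cplusl U U' V : subu phi Phi U U' ->
    subu phi Phi (UPlus U V) (UPlus U' V)
| subu_cplusr U U' V : subu phi Phi U U' ->
    subu phi Phi (UPlus V U) (UPlus V U')
| subu_cpar U U' V : subu phi Phi U U' -> subu phi Phi (UPar U V) (UPar U' V)
| subu_cbang U U' : subu phi Phi U U' -> subu phi Phi (UBang U) (UBang U')
| subu_cact d A c U U' : subu phi Phi U U' ->
    subu phi Phi (UAct d A c U) (UAct d A c U')
| subu_cong U U1 V1 V : ucong U U1 -> subu phi Phi U1 V1 -> ucong V1 V ->
    subu phi Phi U V
| subu_trans U V W : subu phi Phi U V -> wf_usage phi Phi V ->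
    subu phi Phi V W -> subu phi Phi U W
| subu_act d A B I J U : itv_sub Phi B A -> cap_sub Phi I J ->
    subu phi Phi (UAct d A I U) (UAct d B J U)
| subu_delay d A J U V :
    subu phi Phi (UPar (UAct d A J U) (udelay (CapItv (itv_addc A J)) V))
                 (UAct d A J (UPar U V)).

(** * Processes *)

(* Integer variables and channel names share one de Bruijn numbering. *)
Inductive expr := EVar (v : nat) | EZero | ESucc (e : expr).

(* PServ a k P is !a(v_0, ..., v_(k-1)).P and PIn a k P its unreplicated
   version; in P, index j < k is v_j.  In PMatch e P Q, index 0 of Q is the
   predecessor of e. *)
Inductive proc :=
| PZero
| PPar (P Q : proc)
| PServ (a k : nat) (P : proc)
| PIn (a k : nat) (P : proc)
| POut (a : nat) (es : seq expr) (P : proc)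
| PNu (P : proc)
| PTick (P : proc)
| PMatch (e : expr) (P Q : proc)
| PAnnot (m : nat) (P : proc).

Fixpoint esubst (s : nat -> expr) (e : expr) : expr :=
  match e with
  | EVar v => s v
  | EZero => EZero
  | ESucc e => ESucc (esubst s e)
  end.

Definition eren (f : nat -> nat) : expr -> expr := esubst (fun v => EVar (f v)).

Definition upren (k : nat) (f : nat -> nat) : nat -> nat :=
  fun i => if i < k then i else k + f (i - k).

Fixpoint pren (f : nat -> nat) (P : proc) : proc :=
  match P with
  | PZero => PZero
  | PPar P Q => PPar (pren f P) (pren f Q)
  | PServ a k P => PServ (f a) k (pren (upren k f) P)
  | PIn a k P => PIn (f a) k (pren (upren k f) P)
  | POut a es P => POut (f a) (map (eren f) es) (pren f P)
  | PNu P => PNu (pren (upren 1 f) P)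
  | PTick P => PTick (pren f P)
  | PMatch e P Q => PMatch (eren f e) (pren f P) (pren (upren 1 f) Q)
  | PAnnot m P => PAnnot m (pren f P)
  end.

Definition upsub (k : nat) (s : nat -> expr) : nat -> expr :=
  fun i => if i < k then EVar i else eren (addn k) (s (i - k)).

Definition name_of (e : expr) : option nat := if e is EVar a then Some a else None.

Definition omap2 (A B C : Type) (f : A -> B -> C) (x : option A) (y : option B) :
    option C :=
  obind (fun a => omap (f a) y) x.

(* Undefined when a name in subject position would be replaced by an
   expression that is not a name. *)
Fixpoint psubst (s : nat -> expr) (P : proc) : option proc :=
  match P with
  | PZero => Some PZero
  | PPar P Q => omap2 PPar (psubst s P) (psubst s Q)
  | PServ a k P =>
      omap2 (fun b P' => PServ b k P') (name_of (s a)) (psubst (upsub k s) P)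
  | PIn a k P =>
      omap2 (fun b P' => PIn b k P') (name_of (s a)) (psubst (upsub k s) P)
  | POut a es P =>
      omap2 (fun b P' => POut b (map (esubst s) es) P')
            (name_of (s a)) (psubst s P)
  | PNu P => omap PNu (psubst (upsub 1 s) P)
  | PTick P => omap PTick (psubst s P)
  | PMatch e P Q => omap2 (PMatch (esubst s e)) (psubst s P) (psubst (upsub 1 s) Q)
  | PAnnot m P => omap (PAnnot m) (psubst s P)
  end.

(* P[v_0, ..., v_(k-1) := es], for size es = k. *)
Definition pinst (es : seq expr) (P : proc) : option proc :=
  psubst (fun i => nth (EVar (i - size es)) es i) P.

Definition swap01 (i : nat) : nat :=
  match i with 0 => 1 | 1 => 0 | _ => i end.

Inductive pcong : proc -> proc -> Prop :=
| pcong_refl P : pcong P P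
| pcong_sym P Q : pcong P Q -> pcong Q P
| pcong_trans P Q R : pcong P Q -> pcong Q R -> pcong P R
| pcong_par P P' Q Q' : pcong P P' -> pcong Q Q' -> pcong (PPar P Q) (PPar P' Q')
| pcong_serv a k P P' : pcong P P' -> pcong (PServ a k P) (PServ a k P')
| pcong_in a k P P' : pcong P P' -> pcong (PIn a k P) (PIn a k P')
| pcong_out a es P P' : pcong P P' -> pcong (POut a es P) (POut a es P')
| pcong_nu P P' : pcong P P' -> pcong (PNu P) (PNu P')
| pcong_tick P P' : pcong P P' -> pcong (PTick P) (PTick P')
| pcong_match e P P' Q Q' : pcong P P' -> pcong Q Q' ->
    pcong (PMatch e P Q) (PMatch e P' Q')
| pcong_annot m P P' : pcong P P' -> pcong (PAnnot m P) (PAnnot m P')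
| pcong_par0 P : pcong (PPar P PZero) P
| pcong_parC P Q : pcong (PPar P Q) (PPar Q P)
| pcong_parA P Q R : pcong (PPar P (PPar Q R)) (PPar (PPar P Q) R)
| pcong_nuC P : pcong (PNu (PNu P)) (PNu (PNu (pren swap01 P)))
| pcong_nuP P Q : pcong (PNu (PPar P (pren (addn 1) Q))) (PPar (PNu P) Q)
| pcong_annot0 P : pcong (PAnnot 0 P) P
| pcong_annotP m P Q :
    pcong (PAnnot m (PPar P Q)) (PPar (PAnnot m P) (PAnnot m Q))
| pcong_annotN m P : pcong (PAnnot m (PNu P)) (PNu (PAnnot m P))
| pcong_annotA m n P : pcong (PAnnot m (PAnnot n P)) (PAnnot (m + n) P).

Inductive pstep : proc -> proc -> Prop :=
| pstep_comm n m a k P es Q P' : size es = k -> pinst es P = Some P' ->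
    pstep (PPar (PAnnot n (PIn a k P)) (PAnnot m (POut a es Q)))
         (PAnnot (maxn m n) (PPar P' Q))
| pstep_call n m a k P es Q P' : size es = k -> pinst es P = Some P' ->
    pstep (PPar (PAnnot n (PServ a k P)) (PAnnot m (POut a es Q)))
         (PPar (PAnnot n (PServ a k P)) (PAnnot (maxn m n) (PPar P' Q)))
| pstep_tick P : pstep (PTick P) (PAnnot 1 P)
| pstep_match0 P Q : pstep (PMatch EZero P Q) P
| pstep_matchS e P Q Q' : pinst [:: e] Q = Some Q' ->
    pstep (PMatch (ESucc e) P Q) Q'
| pstep_par P P' R : pstep P P' -> pstep (PPar P R) (PPar P' R)
| pstep_nu P P' : pstep P P' -> pstep (PNu P) (PNu P')
| pstep_annot m P P' : pstep P P' -> pstep (PAnnot m P) (PAnnot m P')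
| pstep_cong P P1 Q1 Q : pcong P P1 -> pstep P1 Q1 -> pcong Q1 Q -> pstep P Q.

Fixpoint local_complexity (P : proc) : nat :=
  match P with
  | PAnnot m P => m + local_complexity P
  | PPar P Q => maxn (local_complexity P) (local_complexity Q)
  | PNu P => local_complexity P
  | _ => 0
  end.

Definition reachable : proc -> proc -> Prop :=
  Relation_Operators.clos_refl_trans proc pstep.

Definition complexity_bound (P : proc) (n : enat) : Prop :=
  forall Q, reachable P Q -> ele (Some (local_complexity Q)) n.

(* n is the supremum of the local complexities of the reducts of P. *)
Definition global_complexity (P : proc) (n : enat) : Prop :=
  complexity_bound P n /\ forall m, complexity_bound P m -> ele n m.

(** * Types *)

(* TServ k K Ts U binds k index variables in K and Ts, but not in U. *)
Inductive ty (S : fsig) : Type :=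
| TNat (I J : idx S)
| TCh (Ts : seq (ty S)) (U : usage S)
| TServ (k : nat) (K : itv S) (Ts : seq (ty S)) (U : usage S).

Definition is_chan S (T : ty S) : bool := if T is TNat _ _ then false else true.

Fixpoint ty_subst S (s : nat -> tidx S) (T : ty S) : ty S :=
  match T with
  | TNat X Y => TNat (isubst s X) (isubst s Y)
  | TCh Ts U => TCh (map (ty_subst s) Ts) (usubst s U)
  | TServ k K Ts U =>
      TServ k (itv_subst (iup k s) K) (map (ty_subst (iup k s)) Ts) (usubst s U)
  end.

Inductive wf_ty (S : fsig) : nat -> seq (constr S) -> ty S -> Prop :=
| wf_nat phi Phi I J : iscoped phi I -> iscoped phi J ->
    wf_ty phi Phi (TNat I J)
| wf_ch phi Phi Ts U : (forall T, List.In T Ts -> wf_ty phi Phi T) ->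
    wf_usage phi Phi U -> wf_ty phi Phi (TCh Ts U)
| wf_serv phi Phi k K Ts U :
    (forall T, List.In T Ts -> wf_ty (k + phi) (map (csubst (ishift k)) Phi) T) ->
    wf_itv (k + phi) (map (csubst (ishift k)) Phi) K ->
    wf_usage phi Phi U -> wf_ty phi Phi (TServ k K Ts U).

Definition ty_reliable S (Phi : seq (constr S)) (T : ty S) : Prop :=
  match T with
  | TNat _ _ => True
  | TCh _ U | TServ _ _ _ U => ureliable Phi U
  end.

Definition ty_delay S (c : cap S) (T : ty S) : ty S :=
  match T with
  | TNat X Y => TNat X Y
  | TCh Ts U => TCh Ts (udelay c U)
  | TServ k K Ts U => TServ k K Ts (udelay c U)
  end.

Definition ty_bang S (T : ty S) : ty S :=
  match T with
  | TNat X Y => TNat X Y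
  | TCh Ts U => TCh Ts (UBang U)
  | TServ k K Ts U => TServ k K Ts (UBang U)
  end.

(* ty_par T T' T'' holds when T | T' is defined and equal to T''. *)
Inductive ty_par (S : fsig) : ty S -> ty S -> ty S -> Prop :=
| ty_par_nat I J : ty_par (TNat I J) (TNat I J) (TNat I J)
| ty_par_ch Ts U V : ty_par (TCh Ts U) (TCh Ts V) (TCh Ts (UPar U V))
| ty_par_serv k K Ts U V :
    ty_par (TServ k K Ts U) (TServ k K Ts V) (TServ k K Ts (UPar U V)).

(* subtys is subty componentwise. *)
Inductive subty (S : fsig) : nat -> seq (constr S) -> ty S -> ty S -> Prop :=
| subty_nat phi Phi I J I' J' :
    entails Phi (Constr I' Cle I) -> entails Phi (Constr J Cle J') ->
    subty phi Phi (TNat I J) (TNat I' J')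
| subty_ch phi Phi Ts Ts' U V :
    subtys phi Phi Ts Ts' -> subtys phi Phi Ts' Ts -> subu phi Phi U V ->
    subty phi Phi (TCh Ts U) (TCh Ts' V)
| subty_serv phi Phi k K K' Ts Ts' U V :
    subtys (k + phi) (map (csubst (ishift k)) Phi) Ts Ts' ->
    subtys (k + phi) (map (csubst (ishift k)) Phi) Ts' Ts ->
    itv_eq (map (csubst (ishift k)) Phi) K K' ->
    subu phi Phi U V ->
    subty phi Phi (TServ k K Ts U) (TServ k K' Ts' V)
with subtys (S : fsig) :
    nat -> seq (constr S) -> seq (ty S) -> seq (ty S) -> Prop :=
| subtys_nil phi Phi : subtys phi Phi [::] [::]
| subtys_cons phi Phi T T' Ts Ts' :
    subty phi Phi T T' -> subtys phi Phi Ts Ts' ->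
    subtys phi Phi (T :: Ts) (T' :: Ts').

(** * Typing *)

(* The i-th entry is the type of variable i. *)
Definition ctx (S : fsig) : Type := seq (ty S).

(* The context "G, a : T", for a <= size G: a is not in G, whose variables
   from a onwards are renumbered. *)
Definition ins S (a : nat) (T : ty S) (G : ctx S) : ctx S :=
  take a G ++ T :: drop a G.

Definition wf_ctx S (phi : nat) (Phi : seq (constr S)) (G : ctx S) : Prop :=
  forall T, List.In T G -> wf_ty phi Phi T.

Definition ctx_reliable S (Phi : seq (constr S)) (G : ctx S) : Prop :=
  forall T, List.In T G -> ty_reliable Phi T.

Inductive ctx_par (S : fsig) : ctx S -> ctx S -> ctx S -> Prop :=
| ctx_par_nil : ctx_par [::] [::] [::]
| ctx_par_cons T T' T'' G G' G'' : ty_par T T' T'' -> ctx_par G G' G'' ->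
    ctx_par (T :: G) (T' :: G') (T'' :: G'').

(* In the typing rules, the well-formedness premises are placed so that, for
   well-formed Phi, all components of a derivable judgement are well scoped
   and all obligations, interval capacities and complexities [I, J] occurring
   in it satisfy I <= J under Phi. *)

Inductive etyping (S : fsig) (phi : nat) (Phi : seq (constr S)) :
    ctx S -> expr -> ty S -> Prop :=
| et_var G v T : wf_ctx phi Phi G -> onth G v = Some T ->
    etyping phi Phi G (EVar v) T
| et_zero G : wf_ctx phi Phi G ->
    etyping phi Phi G EZero (TNat (icst 0) (icst 0))
| et_succ G e I J : etyping phi Phi G e (TNat I J) ->
    etyping phi Phi G (ESucc e) (TNat (iadd I (icst 1)) (iadd J (icst 1)))
| et_sub G D e T T' : etyping phi Phi D e T' ->
    subtys phi Phi G D -> subty phi Phi T' T ->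
    wf_ctx phi Phi G -> wf_ty phi Phi T ->
    etyping phi Phi G e T.

(* Usages are resources: as for parallel processes, the context of a tuple is
   the parallel composition of the contexts of its components. *)
Inductive etypings (S : fsig) (phi : nat) (Phi : seq (constr S)) :
    ctx S -> seq expr -> seq (ty S) -> Prop :=
| ets_nil G : wf_ctx phi Phi G -> etypings phi Phi G [::] [::]
| ets_one G e T : etyping phi Phi G e T -> etypings phi Phi G [:: e] [:: T]
| ets_cons G D H e T es Ts :
    etyping phi Phi G e T -> etypings phi Phi D es Ts -> ctx_par G D H ->
    etypings phi Phi H (e :: es) (T :: Ts).

Inductive typing (S : fsig) :
    nat -> seq (constr S) -> ctx S -> proc -> itv S -> Prop :=
| t_zero phi Phi G : wf_ctx phi Phi G -> typing phi Phi G PZero (pt 0)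
| t_par phi Phi G D H P Q K1 K2 :
    typing phi Phi G P K1 -> typing phi Phi D Q K2 -> ctx_par G D H ->
    typing phi Phi H (PPar P Q) (itv_max K1 K2)
| t_tick phi Phi G P K :
    typing phi Phi G P K ->
    typing phi Phi (map (ty_delay (CapItv (pt 1))) G) (PTick P) (itv_add K (pt 1))
| t_annot phi Phi G m P K :
    typing phi Phi G P K ->
    typing phi Phi (map (ty_delay (CapItv (pt m))) G) (PAnnot m P)
      (itv_add K (pt m))
| t_ich phi Phi G a Ts U c P K K' :
    a <= size G -> wf_cap phi Phi c ->
    typing phi Phi (Ts ++ ins a (TCh Ts U) G) P K ->
    cap_seq c K = Some K' ->
    typing phi Phi (ins a (TCh Ts (UAct DIn (pt 0) c U)) (map (ty_delay c) G))
      (PIn a (size Ts) P) K'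
| t_iserv phi Phi G a k K Ts U c P :
    a <= size G -> wf_cap phi Phi c ->
    typing (k + phi) (map (csubst (ishift k)) Phi)
      (Ts ++ map (ty_subst (ishift k)) (ins a (TServ k K Ts U) G)) P K ->
    typing phi Phi
      (ins a (TServ k K Ts (UBang (UAct DIn (pt 0) c U)))
             (map (ty_delay c) (map (@ty_bang S) G)))
      (PServ a (size Ts) P) (pt 0)
| t_och phi Phi G G' H a Ts U V c es P K K' :
    a <= size H -> wf_cap phi Phi c ->
    etypings phi Phi (ins a (TCh Ts V) G') es Ts ->
    typing phi Phi (ins a (TCh Ts U) G) P K ->
    ctx_par G G' H ->
    cap_seq c K = Some K' ->
    typing phi Phi
      (ins a (TCh Ts (UAct DOut (pt 0) c (UPar V U))) (map (ty_delay c) H))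
      (POut a es P) K'
| t_oserv phi Phi G G' H a k K Ts U V c (Is : seq (tidx S)) es P K' K'' :
    a <= size H -> wf_cap phi Phi c ->
    size Is = k -> (forall t, List.In t Is -> tscoped phi t) ->
    etypings phi Phi (ins a (TServ k K Ts V) G') es
      (map (ty_subst (iinst Is)) Ts) ->
    typing phi Phi (ins a (TServ k K Ts U) G) P K' ->
    ctx_par G G' H ->
    cap_seq c (itv_max K' (itv_subst (iinst Is) K)) = Some K'' ->
    typing phi Phi
      (ins a (TServ k K Ts (UAct DOut (pt 0) c (UPar V U))) (map (ty_delay c) H))
      (POut a es P) K''
| t_case phi Phi G e I J P Q K :
    wf_itv phi Phi K ->
    etyping phi Phi G e (TNat I J) ->
    typing phi (Constr I Cle (icst 0) :: Phi) G P K ->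
    typing phi (Constr (icst 1) Cle J :: Phi)
      (TNat (ipred I) (ipred J) :: G) Q K ->
    typing phi Phi G (PMatch e P Q) K
(* The bound name is a channel, so it has no integer type. *)
| t_nu phi Phi G T P K :
    is_chan T -> ty_reliable Phi T ->
    typing phi Phi (T :: G) P K ->
    typing phi Phi G (PNu P) K
| t_sub phi Phi G D P K K' :
    typing phi Phi D P K -> subtys phi Phi G D -> itv_sub Phi K K' ->
    wf_ctx phi Phi G -> wf_itv phi Phi K' ->
    typing phi Phi G P K'.

(* Main.v *)
Require Import Defs.
From mathcomp Require Import all_boot zify.
From Stdlib Require Import FunctionalExtensionality Classical Operators_Properties.

Set Implicit Arguments.
Unset Strict Implicit.
Unset Printing Implicit Defensive.

(** Both bounds are inequalities under every valuation r of Phi, so r is fixed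
    and the type system is interpreted at r: indices become elements of
    N + {oo}, usages carry actual intervals, and a server type becomes a family
    indexed by the values of its bound index variables. Reliability descends to
    r because a communication that succeeds under Phi succeeds under r and one
    that does not is an error. For the interpreted system, subusage is a
    one-to-one simulation of communications, which yields subject reduction: each
    step of a process lets each usage make at most one reduction and preserves
    the complexity interval; the local complexity is bounded by its upper end.
    For the lower bound, a process without free integer variables is reduced by
    ticks and matches only; this terminates, and no other construct contributes
    to the lower end of the interval. *)

(** * Extended naturals and intervals *)

(** Usage reduction is closed under congruence, and subusage under transitivity as well, so
    derivations cannot be inverted directly. The interpreted relation [sub] therefore absorbs the
    congruence, and communications are described by the syntax-directed [ext], which has no closure
    rule. The delicate rule is the one that moves a parallel component under a prefix at the price
    of the delay A + J: the larger usage then releases on communication a component that the smaller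
    one has offered beside the prefix all along. The simulation carries such components as an
    explicit leftover ([covers]), and the rule is sound because a communication that the capacity
    admits happens within A + J. Fixing r also turns the constraints of a match into conditions that
    hold or fail outright, and server instantiation into application of a family, so no indices are
    substituted into derivations. The price is that branches dead at r become untyped; the one fact
    needed about them, that a variable bound by a match is never the subject of a communication, is
    read off the original derivation. *)

Definition eadd (x y : enat) : enat :=
  if (x, y) is (Some m, Some n) then Some (m + n) else None.

Definition emax (x y : enat) : enat :=
  if (x, y) is (Some m, Some n) then Some (maxn m n) else None.

Definition epred (x : enat) : enat := omap predn x.

(** Nonemptiness is part of the data because [vmax_addc] compares opposite ends of one interval;
    being Boolean, it does not affect equality ([vitv_eq]). *)
Record vitv := VItv { lo : enat; hi : enat; lo_hi : ele lo hi }.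

Inductive vcap := VLe (J : enat) | VIn (A : vitv).

Lemma vitv_eq A B : lo A = lo B -> hi A = hi B -> A = B.
Proof.
case: A B => [a b p] [a' b' q] /= ea eb; subst a' b'.
by rewrite (eq_irrelevance p q).
Qed.

Ltac elia :=
  intros;
  repeat match goal with A : vitv |- _ => destruct A end;
  repeat match goal with c : vcap |- _ => destruct c end;
  repeat match goal with A : vitv |- _ => destruct A end;
  repeat match goal with x : enat |- _ => destruct x
                       | x : option nat |- _ => destruct x end;
  unfold ele, eadd, emax, epred in *; simpl in *;
  try congruence; try done;
  try (congr Some); try lia.

Definition vsub (A B : vitv) : bool := ele (lo B) (lo A) && ele (hi A) (hi B).

(** [VLe J] stands for [-oo, J], which no interval with a lower end in N + {oo} contains. *)
Definition csub (c d : vcap) : bool :=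
  match c, d with
  | VLe J, VLe J' => ele J J'
  | VIn A, VLe J => ele (hi A) J
  | VIn A, VIn B => vsub A B
  | VLe _, VIn _ => false
  end.

Lemma ele_refl x : ele x x. Proof. elia. Qed.

Lemma ele_trans x y z : ele x y -> ele y z -> ele x z.
Proof. elia. Qed.

Lemma ele_add a b c d : ele a c -> ele b d -> ele (eadd a b) (eadd c d).
Proof. elia. Qed.

Lemma ele_max a b c d : ele a c -> ele b d -> ele (emax a b) (emax c d).
Proof. elia. Qed.

Lemma ele_addl a b c : ele a b -> ele a (eadd c b).
Proof. elia. Qed.

Definition vpt (n : nat) : vitv := @VItv (Some n) (Some n) (leqnn n).

Definition vadd (A B : vitv) : vitv := VItv (ele_add (lo_hi A) (lo_hi B)).

Definition vmax (A B : vitv) : vitv := VItv (ele_max (lo_hi A) (lo_hi B)).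

Definition cadd (c : vcap) (B : vitv) : vitv :=
  match c with
  | VLe J => VItv (ele_addl J (lo_hi B))
  | VIn A => vadd A B
  end.

Definition addc (A : vitv) (c : vcap) : vitv :=
  match c with
  | VLe J => cadd (VLe J) A
  | VIn B => vadd A B
  end.

(** The inclusion of B in [oplus A c], written out because the latter may be empty and then is no
    [vitv]. *)
Definition okhalf (A : vitv) (c : vcap) (B : vitv) : bool :=
  match c with
  | VLe J => ele (hi B) (eadd (lo A) J)
  | VIn C => ele (eadd (hi A) (lo C)) (lo B) && ele (hi B) (eadd (lo A) (hi C))
  end.

Definition okc (A : vitv) (c : vcap) (B : vitv) (d : vcap) : bool :=
  okhalf A c B && okhalf B d A.

Lemma vsub_refl A : vsub A A.
Proof. rewrite /vsub; elia. Qed.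

Lemma vsub_trans A B C : vsub A B -> vsub B C -> vsub A C.
Proof. rewrite /vsub; elia. Qed.

Lemma csub_refl c : csub c c.
Proof. rewrite /csub /vsub; elia. Qed.

Lemma csub_trans c d e : csub c d -> csub d e -> csub c e.
Proof. rewrite /csub /vsub; elia. Qed.

(** [oplus A c] shrinks when A grows, since its upper end is measured from the lower end of A and
    its lower end, if not 0, from the upper end of A. Hence success for a smaller usage carries over
    to a larger one. *)
Lemma okhalf_mono A A' c c' B B' :
  vsub A A' -> csub c' c -> vsub B B' -> okhalf A' c' B' -> okhalf A c B.
Proof.
move=> /andP[a1 a2] sc /andP[b1 b2]; case: c c' sc => [J|C] [J'|C'] //= sc.
- by move=> h; apply: ele_trans b2 (ele_trans h (ele_add a1 sc)).
- by case/andP=> _ h; apply: ele_trans b2 (ele_trans h (ele_add a1 sc)).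
case/andP: sc => c1 c2 /andP[h1 h2]; apply/andP; split.
  exact: ele_trans (ele_add a2 c1) (ele_trans h1 b1).
exact: ele_trans b2 (ele_trans h2 (ele_add a1 c2)).
Qed.

Lemma vadd_mono A A' B B' : vsub A A' -> vsub B B' -> vsub (vadd A B) (vadd A' B').
Proof. rewrite /vsub; elia. Qed.

Lemma cadd_mono c A A' : vsub A A' -> vsub (cadd c A) (cadd c A').
Proof. rewrite /vsub; elia. Qed.

Lemma vmax_mono A A' B B' : vsub A A' -> vsub B B' -> vsub (vmax A B) (vmax A' B').
Proof. rewrite /vsub; elia. Qed.

Lemma vmaxC A B : vmax A B = vmax B A.
Proof. apply: vitv_eq; elia. Qed.

(** Soundness of [sub_delay]: the capacity keeps the partner D within A + c, so the actual waiting
    time max(A, D) lies inside the delay that the rule charges. *)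
Lemma vmax_addc A c D : okhalf A c D -> vsub (vmax A D) (addc A c).
Proof. rewrite /vsub /okhalf; elia. Qed.

Lemma cadd_addc c A d B : cadd c (vadd (addc A d) B) = vadd (addc (cadd c A) d) B.
Proof. apply: vitv_eq; elia. Qed.

Lemma caddA m n B : cadd (VIn (vpt m)) (cadd (VIn (vpt n)) B) = cadd (VIn (vpt (m + n))) B.
Proof. apply: vitv_eq; elia. Qed.

Lemma cadd0 B : cadd (VIn (vpt 0)) B = B.
Proof. apply: vitv_eq; elia. Qed.

(** * Usages under a fixed valuation *)

Inductive vusage :=
| V0
| VPar (U V : vusage)
| VAct (d : dir) (A : vitv) (c : vcap) (U : vusage)
| VBang (U : vusage)
| VPlus (U V : vusage).

(** Every delay acts on the outermost obligations alone, so nested delays compose as functions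
    ([umap_comp]). *)
Fixpoint umap (f : vitv -> vitv) (U : vusage) : vusage :=
  match U with
  | V0 => V0
  | VPar U V => VPar (umap f U) (umap f V)
  | VAct d A c U => VAct d (f A) c U
  | VBang U => VBang (umap f U)
  | VPlus U V => VPlus (umap f U) (umap f V)
  end.

Notation vdelay c := (umap (cadd c)).
Notation vwait A := (umap (vadd A)).

(** Subusage and congruence in one relation, so that a single induction treats both. Each congruence
    law is listed in one direction; [ucong_sub] recovers the other from the remaining rules. *)
Inductive sub : vusage -> vusage -> Prop :=
| sub_refl U : sub U U
| sub_trans U V W : sub U V -> sub V W -> sub U W
| sub_zero U : sub U V0
| sub_plusl U V : sub (VPlus U V) U
| sub_plusr U V : sub (VPlus U V) V
| sub_par U U' V V' : sub U U' -> sub V V' -> sub (VPar U V) (VPar U' V')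
| sub_plus U U' V V' : sub U U' -> sub V V' -> sub (VPlus U V) (VPlus U' V')
| sub_bang U U' : sub U U' -> sub (VBang U) (VBang U')
| sub_act d A B c e U U' : vsub B A -> csub c e -> sub U U' ->
    sub (VAct d A c U) (VAct d B e U')
| sub_proj U V : sub (VPar U V) U
| sub_par0 U : sub U (VPar U V0)
| sub_parC U V : sub (VPar U V) (VPar V U)
| sub_parA U V W : sub (VPar U (VPar V W)) (VPar (VPar U V) W)
| sub_bang0 : sub V0 (VBang V0)
| sub_bangS U : sub (VBang U) (VPar (VBang U) U)
| sub_bangP U V : sub (VPar (VBang U) (VBang V)) (VBang (VPar U V))
| sub_bangB U : sub (VBang U) (VBang (VBang U))
| sub_delay d A c U V :
    sub (VPar (VAct d A c U) (vwait (addc A c) V)) (VAct d A c (VPar U V)).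

Lemma umap_comp f g U : umap f (umap g U) = umap (f \o g) U.
Proof. by elim: U => //= [U -> V ->|U ->|U -> V ->]. Qed.

Lemma eq_umap f g U : f =1 g -> umap f U = umap g U.
Proof. by move=> e; elim: U => //= [U -> V ->|d A c U _|U ->|U -> V ->]; rewrite ?e. Qed.

Lemma umap_id f U : f =1 id -> umap f U = U.
Proof. by move=> e; elim: U => //= [U -> V ->|d A c U _|U ->|U -> V ->]; rewrite ?e. Qed.

Lemma sub_umap f g U : (forall A, vsub (g A) (f A)) -> sub (umap f U) (umap g U).
Proof.
move=> s; elim: U => /= [|U sU V sV|d A c U _|U sU|U sU V sV]; try by constructor.
by apply: sub_act; rewrite ?csub_refl //; apply: sub_refl.
Qed.

Lemma sub_vdelay c U V : sub U V -> sub (vdelay c U) (vdelay c V).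
Proof.
elim=> {U V} /= [U|U V W _ IH1 _ IH2|U|U V|U V|U U' V V' _ IH1 _ IH2
  |U U' V V' _ IH1 _ IH2|U U' _ IH|d A B e e' U U' sBA se sU _|U V|U|U V|U V W
  ||U|U V|U|d A e U V]; try by [constructor].
- exact: sub_trans IH1 IH2.
- by apply: sub_act => //; apply: cadd_mono.
- rewrite umap_comp (@eq_umap _ (vadd (addc (cadd c A) e))); first exact: sub_delay.
  by move=> B /=; apply: cadd_addc.
Qed.

(** ** Parallel compositions of families *)

Definition upar (T : Type) (f : T -> vusage) (l : seq T) : vusage :=
  foldr (fun i U => VPar (f i) U) V0 l.

Lemma sub_projr U V : sub (VPar U V) V.
Proof. exact: sub_trans (sub_parC _ _) (sub_proj _ _). Qed.

Lemma sub_par0l U : sub U (VPar V0 U).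
Proof. exact: sub_trans (sub_par0 _) (sub_parC _ _). Qed.

Lemma sub_parAr U V W : sub (VPar (VPar U V) W) (VPar U (VPar V W)).
Proof.
apply: sub_trans (sub_parC _ _) _; apply: sub_trans (sub_parA _ _ _) _.
apply: sub_trans (sub_parC _ _) _; apply: sub_trans (sub_parA _ _ _) _.
exact: sub_parC.
Qed.

Lemma sub_parCA U V W : sub (VPar U (VPar V W)) (VPar V (VPar U W)).
Proof.
apply: sub_trans (sub_parA _ _ _) _.
by apply: sub_trans (sub_parAr _ _ _); apply: sub_par (sub_parC _ _) (sub_refl _).
Qed.

Lemma upar_cat T (f : T -> vusage) l l' :
  sub (upar f (l ++ l')) (VPar (upar f l) (upar f l')).
Proof.
elim: l => [|i l IH] /=; first exact: sub_par0l.
exact: sub_trans (sub_par (sub_refl _) IH) (sub_parA _ _ _).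
Qed.

Lemma cat_upar T (f : T -> vusage) l l' :
  sub (VPar (upar f l) (upar f l')) (upar f (l ++ l')).
Proof.
elim: l => [|i l IH] /=; first exact: sub_projr.
exact: sub_trans (sub_parAr _ _ _) (sub_par (sub_refl _) IH).
Qed.

Lemma upar_rem (T : eqType) (f : T -> vusage) i l : i \in l ->
  sub (upar f l) (VPar (f i) (upar f (rem i l))).
Proof.
elim: l => [//|j l IH] /=; rewrite inE eq_sym; case: eqVneq => [->|_] /= il.
  exact: sub_refl.
exact: sub_trans (sub_par (sub_refl _) (IH il)) (sub_parCA _ _ _).
Qed.

(** Multiset inclusion, in a form that computes so that [usub] can prove it by [isT]. The sides are
    exchanged in [upar_msub] because subusage may drop components. *)
Fixpoint msub (T : eqType) (l l' : seq T) : bool :=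
  if l is i :: l then (i \in l') && msub l (rem i l') else true.

Lemma upar_msub (T : eqType) (f : T -> vusage) l l' :
  msub l l' -> sub (upar f l') (upar f l).
Proof.
elim: l l' => [|i l IH] l' /=; first by move=> _; apply: sub_zero.
case/andP=> il /IH s.
exact: sub_trans (upar_rem _ il) (sub_par (sub_refl _) s).
Qed.

Lemma upar_uniq (T : eqType) (f : T -> vusage) l l' :
  uniq l -> {subset l <= l'} -> sub (upar f l') (upar f l).
Proof.
move=> ul s; apply: upar_msub; elim: l l' ul s => //= i l IH l' /andP[il ul] s.
rewrite s ?inE ?eqxx //=; apply: IH => // j jl.
apply: rem_mem; first by apply: contraNneq il => <-.
by apply: s; rewrite inE jl orbT.
Qed.

(** ** Subusage between parallel compositions *)

(** Syntax for proofs by reflection: comparing leaves replaces explicit uses of commutativity and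
    associativity. *)
Inductive ptree := PLeaf (i : nat) | PNode (t u : ptree) | PEmpty.

Fixpoint ptree_eval (e : seq vusage) (t : ptree) : vusage :=
  match t with
  | PLeaf i => nth V0 e i
  | PNode t u => VPar (ptree_eval e t) (ptree_eval e u)
  | PEmpty => V0
  end.

Fixpoint leaves (t : ptree) : seq nat :=
  match t with
  | PLeaf i => [:: i]
  | PNode t u => leaves t ++ leaves u
  | PEmpty => [::]
  end.

Lemma sub_leaves e t : sub (ptree_eval e t) (upar (nth V0 e) (leaves t)).
Proof.
elim: t => [i|t IHt u IHu|] /=; [exact: sub_par0| |exact: sub_refl].
exact: sub_trans (sub_par IHt IHu) (cat_upar _ _ _).
Qed.

Lemma leaves_sub e t : sub (upar (nth V0 e) (leaves t)) (ptree_eval e t).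
Proof.
elim: t => [i|t IHt u IHu|] /=; [exact: sub_proj| |exact: sub_refl].
exact: sub_trans (upar_cat _ _ _) (sub_par IHt IHu).
Qed.

Lemma ptree_sub e t u :
  msub (leaves u) (leaves t) -> sub (ptree_eval e t) (ptree_eval e u).
Proof.
move=> s; apply: sub_trans (sub_leaves e t) _.
exact: sub_trans (upar_msub _ s) (leaves_sub e u).
Qed.

Ltac pos_in x e :=
  match e with
  | x :: _ => constr:(0)
  | _ :: ?e' => let n := pos_in x e' in constr:(n.+1)
  end.

Ltac atoms e U :=
  match U with
  | V0 => e
  | VPar ?V ?W => let e1 := atoms e V in atoms e1 W
  | _ => match e with
         | context [U :: _] => e
         | _ => constr:(U :: e)
         end
  end.

Ltac reify e U :=
  match U with
  | V0 => constr:(PEmpty)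
  | VPar ?V ?W => let t := reify e V in let u := reify e W in constr:(PNode t u)
  | _ => let n := pos_in U e in constr:(PLeaf n)
  end.

(* Proves sub U V when the parallel components of V occur among those of U. *)
Ltac usub :=
  match goal with
  | |- sub ?U ?V =>
    let e0 := atoms (@nil vusage) U in
    let e := atoms e0 V in
    let t := reify e U in let u := reify e V in
    exact (@ptree_sub e t u isT)
  end.

(** * Reduction and reliability *)

(* [ext U d A c U1 W] splits off an action: U chooses and unfolds to
   [d^A_c.U1 | W]. Choices are resolved here, so that a communication of the
   larger usage is matched by exactly one communication of the smaller. *)
Inductive ext : vusage -> dir -> vitv -> vcap -> vusage -> vusage -> Prop :=
| ext_act d A c U : ext (VAct d A c U) d A c U V0
| ext_parl U V d A c U1 W : ext U d A c U1 W -> ext (VPar U V) d A c U1 (VPar W V)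
| ext_parr U V d A c U1 W : ext V d A c U1 W -> ext (VPar U V) d A c U1 (VPar U W)
| ext_bang U d A c U1 W : ext U d A c U1 W ->
    ext (VBang U) d A c U1 (VPar (VBang U) W)
| ext_plusl U V d A c U1 W : ext U d A c U1 W -> ext (VPlus U V) d A c U1 W
| ext_plusr U V d A c U1 W : ext V d A c U1 W -> ext (VPlus U V) d A c U1 W.

Lemma ext_parE U V d A c U1 W : ext (VPar U V) d A c U1 W ->
  (exists2 X, W = VPar X V & ext U d A c U1 X) \/
  (exists2 X, W = VPar U X & ext V d A c U1 X).
Proof. by move=> x; inversion x; subst; [left|right]; eexists. Qed.

Lemma ext_bangE U d A c U1 W : ext (VBang U) d A c U1 W ->
  exists2 X, W = VPar (VBang U) X & ext U d A c U1 X.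
Proof. by move=> x; inversion x; subst; eexists. Qed.

Lemma ext_plusE U V d A c U1 W : ext (VPlus U V) d A c U1 W ->
  ext U d A c U1 W \/ ext V d A c U1 W.
Proof. by move=> x; inversion x; subst; [left|right]. Qed.

(** How U matches the extraction of an action with continuation V1 and remainder W from a larger
    usage. U may have less under its prefix than V1; what is missing is the leftover L, which sits
    in the remainder X and joins the continuation once the partner D is known. Its delay need only
    be right for partners that the capacity admits, hence the premise [okhalf B e D]. *)
Definition covers (U : vusage) d A c V1 W : Prop :=
  exists B e U1 X L,
    [/\ ext U d B e U1 X, vsub A B, csub e c, sub X (VPar L W) &
      forall D, okhalf B e D ->
        sub (VPar (vwait (vmax B D) U1) L) (vwait (vmax A D) V1)].

Lemma covers_ext U d A c V1 X W :
  ext U d A c V1 X -> sub X W -> covers U d A c V1 W.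
Proof.
move=> x s; exists A, c, V1, X, V0.
rewrite vsub_refl csub_refl; split=> // [|D _]; last exact: sub_proj.
exact: sub_trans s (sub_par0l _).
Qed.

Lemma covers_left U V d A c V1 W W' :
  covers U d A c V1 W -> sub (VPar W V) W' -> covers (VPar U V) d A c V1 W'.
Proof.
move=> [B [e [U1 [X [L [x sA sc sX h]]]]]] s.
exists B, e, U1, (VPar X V), L; split=> //; first exact: ext_parl.
apply: sub_trans (sub_par sX (sub_refl V)) _.
exact: sub_trans (sub_parAr _ _ _) (sub_par (sub_refl _) s).
Qed.

(** Only [sub_delay] creates a leftover. Transitivity adds leftovers up, and the other rules pass
    one on or have none. *)
Lemma ext_sub U V : sub U V ->
  forall d A c V1 W, ext V d A c V1 W -> covers U d A c V1 W.
Proof.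
elim=> {U V} [U|U V W _ IH1 _ IH2|U|U V|U V|U U' V V' sU IHU sV IHV
  |U U' V V' _ IHU _ IHV|U U' sU IH|d A B e e' U U' sBA se sU _|U V|U|U V|U V W
  ||U|U V|U|d A e U V] d0 A0 c0 V1 W0 x.
- exact: covers_ext x (sub_refl _).
- have [A2 [c2 [U2 [X2 [L2 [x2 sA2 sc2 sX2 h2]]]]]] := IH2 _ _ _ _ _ x.
  have [A3 [c3 [U3 [X3 [L3 [x3 sA3 sc3 sX3 h3]]]]]] := IH1 _ _ _ _ _ x2.
  exists A3, c3, U3, X3, (VPar L3 L2); split=> //.
  + exact: vsub_trans sA2 sA3.
  + exact: csub_trans sc3 sc2.
  + apply: sub_trans sX3 _; apply: sub_trans (sub_par (sub_refl _) sX2) _; usub.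
  + move=> D ok; apply: sub_trans (h2 D (okhalf_mono sA3 sc3 (vsub_refl _) ok)).
    apply: sub_trans (sub_par (h3 D ok) (sub_refl L2)); usub.
- by inversion x.
- exact: covers_ext (ext_plusl _ x) (sub_refl _).
- exact: covers_ext (ext_plusr _ x) (sub_refl _).
- have [[X -> y]|[X -> y]] := ext_parE x.
    exact: covers_left (IHU _ _ _ _ _ y) (sub_par (sub_refl _) sV).
  have [A2 [c2 [U2 [X2 [L2 [x2 sA2 sc2 sX2 h2]]]]]] := IHV _ _ _ _ _ y.
  exists A2, c2, U2, (VPar U X2), L2; split=> //; first exact: ext_parr.
  apply: sub_trans (sub_par sU sX2) _; usub.
- have [y|y] := ext_plusE x.
    have [A2 [c2 [U2 [X2 [L2 [x2 sA2 sc2 sX2 h2]]]]]] := IHU _ _ _ _ _ y.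
    by exists A2, c2, U2, X2, L2; split=> //; apply: ext_plusl.
  have [A2 [c2 [U2 [X2 [L2 [x2 sA2 sc2 sX2 h2]]]]]] := IHV _ _ _ _ _ y.
  by exists A2, c2, U2, X2, L2; split=> //; apply: ext_plusr.
- have [X -> y] := ext_bangE x.
  have [A2 [c2 [U2 [X2 [L2 [x2 sA2 sc2 sX2 h2]]]]]] := IH _ _ _ _ _ y.
  exists A2, c2, U2, (VPar (VBang U) X2), L2; split=> //; first exact: ext_bang.
  apply: sub_trans (sub_par (sub_bang sU) sX2) _; usub.
- inversion x; subst.
  exists A, e, U, V0, V0; split=> //; [exact: ext_act|usub|].
  move=> D ok; apply: sub_trans (sub_proj _ _) _.
  apply: sub_trans (sub_vdelay (VIn (vmax A D)) sU) _ => /=.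
  apply: sub_umap => B'; apply: vadd_mono (vsub_refl _).
  exact: vmax_mono (vsub_refl _).
- exact: covers_ext (ext_parl _ x) (sub_proj _ _).
- have [[X -> y]|[X _ y]] := ext_parE x; last by inversion y.
  apply: covers_ext y _; usub.
- have [[X -> y]|[X -> y]] := ext_parE x.
    apply: covers_ext (ext_parr _ y) _; usub.
  apply: covers_ext (ext_parl _ y) _; usub.
- have [[X -> y]|[X -> y]] := ext_parE x; last first.
    apply: covers_ext (ext_parr _ (ext_parr _ y)) _; usub.
  have [[Y -> z]|[Y -> z]] := ext_parE y.
    apply: covers_ext (ext_parl _ z) _; usub.
  apply: covers_ext (ext_parr _ (ext_parl _ z)) _; usub.
- by have [X _ y] := ext_bangE x; inversion y.
- have [[X -> y]|[X -> y]] := ext_parE x; last first.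
    exact: covers_ext (ext_bang y) (sub_refl _).
  (* The action comes from the replicated half of !U | U, so a further copy of U has to be unfolded
     from the remainder. *)
  have [Y -> z] := ext_bangE y; apply: covers_ext (ext_bang z) _.
  apply: sub_trans (sub_par (sub_bangS _) (sub_refl _)) _; usub.
- have [X -> y] := ext_bangE x; have [[Y -> z]|[Y -> z]] := ext_parE y.
    apply: covers_ext (ext_parl _ (ext_bang z)) _.
    apply: sub_trans _ (sub_par (sub_bangP _ _) (sub_refl _)).
    apply: sub_trans (sub_par (sub_refl _) (sub_bangS _)) _; usub.
  apply: covers_ext (ext_parr _ (ext_bang z)) _.
  apply: sub_trans _ (sub_par (sub_bangP _ _) (sub_refl _)).
  apply: sub_trans (sub_par (sub_bangS _) (sub_refl _)) _; usub.
- have [X -> y] := ext_bangE x; have [Y -> z] := ext_bangE y.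
  apply: covers_ext (ext_bang z) _.
  apply: sub_trans (sub_par (sub_bangB _) (sub_refl _)) _.
  apply: sub_trans (sub_par (sub_bangS _) (sub_refl _)) _.
  exact: sub_parAr.
- inversion x; subst.
  (* The leftover is the component that the rule has moved under the prefix, still with its
     prescribed delay. *)
  exists A0, c0, U, (VPar V0 (vwait (addc A0 c0) V)), (vwait (addc A0 c0) V).
  rewrite vsub_refl csub_refl; split=> //; [exact: ext_parl (ext_act _ _ _ _)|usub|].
  move=> D ok /=; apply: sub_par (sub_refl _) (sub_umap _ _) => B.
  by apply: vadd_mono (vsub_refl _); apply: vmax_addc.
Qed.

(** Successful and failing communications share one constructor, with [okc] as index, so that
    [comm_of_sub] transfers steps and errors together. For the index [false] the resulting usage has
    no meaning. *)
Inductive comm_of (U : vusage) : bool -> vusage -> Prop :=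
| CommOf A c U1 B e V1 W X :
    ext U DIn A c U1 W -> ext W DOut B e V1 X ->
    comm_of U (okc A c B e) (VPar (vwait (vmax A B) (VPar U1 V1)) X).

Notation red U V := (comm_of U true V).
Definition err (U : vusage) : Prop := exists V, comm_of U false V.

Inductive reds : vusage -> vusage -> Prop :=
| reds_refl U : reds U U
| reds_step U V W : red U V -> reds V W -> reds U W.

Definition reliable (U : vusage) : Prop := forall V, reds U V -> ~ err V.

(** The smaller usage succeeds less often. So an error of V gives an error of U, and a step of V is
    matched by U unless U errs. *)
Lemma comm_of_sub U V b V' : sub U V -> comm_of V b V' ->
  exists c U', [/\ comm_of U c U', c ==> b & c -> sub U' V'].
Proof.
move=> s v; case: v s => A1 c1 V1 B1 e1 W1 Y Z y z s.
have [A2 [c2 [U2 [X2 [L2 [x2 sA2 sc2 sX2 h2]]]]]] := ext_sub s y.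
(* The output is sought in the remainder of the input, which is only known to be below L2 | Y.
   Extracting on the right keeps L2 available for the continuation of the input. *)
have [B3 [e3 [U3 [X3 [L3 [x3 sB3 se3 sX3 h3]]]]]] := ext_sub sX2 (ext_parr L2 z).
exists (okc A2 c2 B3 e3), (VPar (vwait (vmax A2 B3) (VPar U2 U3)) X3).
split; first exact: CommOf x2 x3.
  apply/implyP => /andP[o2 o3]; apply/andP; split.
    exact: okhalf_mono sA2 sc2 sB3 o2.
  exact: okhalf_mono sB3 se3 sA2 o3.
case/andP=> o2 o3 /=.
have s2 : sub (VPar (vwait (vmax A2 B3) U2) L2) (vwait (vmax A1 B1) V1).
  apply: sub_trans (h2 _ o2) (sub_umap _ _) => B.
  by apply: vadd_mono (vsub_refl _); apply: vmax_mono => //; apply: vsub_refl.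
have s3 : sub (VPar (vwait (vmax A2 B3) U3) L3) (vwait (vmax A1 B1) W1).
  rewrite !(vmaxC _ B3) (vmaxC A1).
  apply: sub_trans (h3 _ o3) (sub_umap _ _) => B.
  by apply: vadd_mono (vsub_refl _); apply: vmax_mono => //; apply: vsub_refl.
apply: sub_trans (sub_par (sub_refl _) sX3) _.
apply: sub_trans _ (sub_par (sub_par s2 s3) (sub_refl Z)); usub.
Qed.

Lemma reliable_err U : reliable U -> ~ err U.
Proof. by apply; apply: reds_refl. Qed.

Lemma reliable_red U V : reliable U -> red U V -> reliable V.
Proof. by move=> r x W y; apply: r (reds_step x y). Qed.

Lemma red_sub U V V' : reliable U -> sub U V -> red V V' ->
  exists2 U', red U U' & sub U' V'.
Proof.
move=> r s x; have [[] [U' [u _ s']]] := comm_of_sub s x.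
  by exists U' => //; apply: s'.
by case: (reliable_err r); exists U'.
Qed.

Lemma reliable_sub U V : sub U V -> reliable U -> reliable V.
Proof.
move=> s r W x; elim: x U s r => {V W} [V|V V' W x _ IH] U s r.
  case=> V' v; have [[] [U' [u //= _ _]]] := comm_of_sub s v.
  by case: (reliable_err r); exists U'.
have [U' u s'] := red_sub r s x.
exact: IH s' (reliable_red r u).
Qed.

(** ** Delays by a constant *)

Lemma ext_vdelay m U d A c U1 W : ext U d A c U1 W ->
  ext (vdelay (VIn (vpt m)) U) d (cadd (VIn (vpt m)) A) c U1 (vdelay (VIn (vpt m)) W).
Proof.
elim=> * /=; [exact: ext_act|exact: ext_parl|exact: ext_parr|exact: ext_bang
  |exact: ext_plusl|exact: ext_plusr].
Qed.

Lemma vdelay_ext m U d A c U1 W : ext (vdelay (VIn (vpt m)) U) d A c U1 W ->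
  exists A0 W0, [/\ A = cadd (VIn (vpt m)) A0, W = vdelay (VIn (vpt m)) W0 &
    ext U d A0 c U1 W0].
Proof.
elim: U d A c U1 W => /= [|U IHU V IHV|d A c U IH|U IH|U IHU V IHV] d' A' c' U1 W x.
- by inversion x.
- have [[X -> y]|[X -> y]] := ext_parE x.
    have [B [W' [-> -> z]]] := IHU _ _ _ _ _ y.
    by exists B, (VPar W' V); split=> //; apply: ext_parl.
  have [B [W' [-> -> z]]] := IHV _ _ _ _ _ y.
  by exists B, (VPar U W'); split=> //; apply: ext_parr.
- by inversion x; subst; exists A, V0; split=> //; apply: ext_act.
- have [X -> y] := ext_bangE x; have [B [W' [-> -> z]]] := IH _ _ _ _ _ y.
  by exists B, (VPar (VBang U) W'); split=> //; apply: ext_bang.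
- have [y|y] := ext_plusE x.
    have [B [W' [-> -> z]]] := IHU _ _ _ _ _ y.
    by exists B, W'; split=> //; apply: ext_plusl.
  have [B [W' [-> -> z]]] := IHV _ _ _ _ _ y.
  by exists B, W'; split=> //; apply: ext_plusr.
Qed.

(** A delay by a number translates all ends of the obligations equally, whereas a proper interval
    would widen them and might break the conditions. Annotations only cause delays by numbers. *)
Lemma okc_vdelay m A c B e :
  okc (cadd (VIn (vpt m)) A) c (cadd (VIn (vpt m)) B) e = okc A c B e.
Proof. by rewrite /okc; congr (_ && _); rewrite /okhalf; elia. Qed.

Lemma vmax_vdelay m A B U :
  vwait (vmax (cadd (VIn (vpt m)) A) (cadd (VIn (vpt m)) B)) U
  = vdelay (VIn (vpt m)) (vwait (vmax A B) U).
Proof. rewrite umap_comp; apply: eq_umap => C /=; apply: vitv_eq; elia. Qed.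

Lemma comm_of_vdelay m U b V : comm_of U b V ->
  comm_of (vdelay (VIn (vpt m)) U) b (vdelay (VIn (vpt m)) V).
Proof.
case=> A c U1 B e V1 W X x y.
rewrite -(okc_vdelay m) [umap _ (VPar _ X)]/= -!vmax_vdelay.
exact: CommOf (ext_vdelay m x) (ext_vdelay m y).
Qed.

Lemma vdelay_comm_of m U b V : comm_of (vdelay (VIn (vpt m)) U) b V ->
  exists2 V', V = vdelay (VIn (vpt m)) V' & comm_of U b V'.
Proof.
case=> A c U1 B e V1 W X x y.
have [A0 [W0 [? ? x0]]] := vdelay_ext x; subst.
have [B0 [X0 [? ? y0]]] := vdelay_ext y; subst.
exists (VPar (vwait (vmax A0 B0) (VPar U1 V1)) X0); first by rewrite vmax_vdelay.
by rewrite okc_vdelay; apply: CommOf x0 y0.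
Qed.

Lemma reliable_vdelay m U : reliable U -> reliable (vdelay (VIn (vpt m)) U).
Proof.
move=> r V x; move: {1 2}(vdelay _ U) x (erefl (vdelay (VIn (vpt m)) U)) => U' x.
elim: x U r => {U' V} [V|V V' W x _ IH] U r e; subst.
  by case=> W /vdelay_comm_of[W' _ w]; case: (reliable_err r); exists W'.
have [V0 e x0] := vdelay_comm_of x.
exact: IH (reliable_red r x0) e.
Qed.

Lemma vdelay_rel m U : reliable (vdelay (VIn (vpt m)) U) -> reliable U.
Proof.
move=> r V x; elim: x r => {U V} [V|U V W x _ IH] r.
  by case=> W w; case: (reliable_err r); exists (vdelay (VIn (vpt m)) W);
    apply: comm_of_vdelay.
by apply: IH (reliable_red r _); apply: comm_of_vdelay.
Qed.

(** ** At most one reduction, up to subusage *)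

Definition redz (U V : vusage) : Prop := exists2 W, U = W \/ red U W & sub W V.

Lemma redz_sub U V : sub U V -> redz U V.
Proof. by exists U; first by left. Qed.

Lemma reliable_redz U V : reliable U -> redz U V -> reliable V.
Proof.
move=> r [W [<-|x] s]; first exact: reliable_sub s r.
exact: reliable_sub s (reliable_red r x).
Qed.

Lemma sub_redz U V W : reliable U -> sub U V -> redz V W -> redz U W.
Proof.
move=> r s [X [<-|x] t]; first exact: redz_sub (sub_trans s t).
have [U' u s'] := red_sub r s x.
by exists U'; [right|apply: sub_trans s' t].
Qed.

Lemma comm_of_par U V b W : comm_of U b W ->
  exists2 X, comm_of (VPar U V) b X & sub X (VPar W V).
Proof.
case=> A c U1 B e V1 W' X x y.
exists (VPar (vwait (vmax A B) (VPar U1 V1)) (VPar X V)); last exact: sub_parA.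
exact: CommOf (ext_parl V x) (ext_parl V y).
Qed.

Lemma redz_par U U' V : redz U U' -> redz (VPar U V) (VPar U' V).
Proof.
case=> W [<-|x] s; first exact: redz_sub (sub_par s (sub_refl _)).
have [X y t] := comm_of_par V x.
by exists X; [right|apply: sub_trans t (sub_par s (sub_refl _))].
Qed.

Lemma redz_vdelay m U V :
  redz U V -> redz (vdelay (VIn (vpt m)) U) (vdelay (VIn (vpt m)) V).
Proof.
case=> W [<-|x] s; first exact: redz_sub (sub_vdelay _ s).
exists (vdelay (VIn (vpt m)) W); last exact: sub_vdelay.
by right; apply: comm_of_vdelay.
Qed.

(** * Typing under a fixed valuation *)

(* A type is a shape together with a usage. Server types are the case
   [HCh], where K, Sh and Us depend on the values of the bound index variables;
   channels are servers in which they are constant. *)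
Inductive shape :=
| HNat (I J : enat)
| HCh (K : (nat -> nat) -> enat * enat) (Sh : (nat -> nat) -> nat -> shape)
    (Us : (nat -> nat) -> nat -> vusage).

Definition is_ch (s : shape) : bool := if s is HCh _ _ _ then true else false.

(** Parameter types are invariant under subtyping, hence compared by inclusions in both directions;
    the usages of parameters therefore agree only up to mutual [sub], not literally. *)
Fixpoint heq (s t : shape) : Prop :=
  match s, t with
  | HNat X Y, HNat X' Y' => X = X' /\ Y = Y'
  | HCh K Sh Us, HCh K' Sh' Us' =>
      (forall v, K v = K' v) /\
      forall v i, [/\ heq (Sh v i) (Sh' v i), sub (Us v i) (Us' v i) & sub (Us' v i) (Us v i)]
  | _, _ => False
  end.

Definition hsub (s t : shape) : Prop :=
  match s, t with
  | HNat X Y, HNat X' Y' => ele X' X /\ ele Y Y'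
  | _, _ => heq s t
  end.

Arguments hsub : simpl never.

Lemma heq_refl s : heq s s.
Proof. by elim: s => //= K Sh IH Us; split=> // v i; split=> //; apply: sub_refl. Qed.

Lemma heq_sym s t : heq s t -> heq t s.
Proof.
elim: s t => [I J|K Sh IH Us] [I' J'|K' Sh' Us'] //=; first by case=> -> ->.
case=> eK e; split=> // v i; have [/IH e1 s1 s2] := e v i; by split.
Qed.

Lemma heq_trans s t w : heq s t -> heq t w -> heq s w.
Proof.
elim: s t w => [I J|K Sh IH Us] [I' J'|K' Sh' Us'] [I'' J''|K'' Sh'' Us''] //=.
  by case=> -> -> [-> ->].
case=> eK e [eK' e']; split=> [v|v i]; first by rewrite eK.
have [h s1 s2] := e v i; have [h' t1 t2] := e' v i.
split; [exact: IH h'|exact: sub_trans s1 t1|exact: sub_trans t2 s2].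
Qed.

Lemma heq_hsub s t : heq s t -> hsub s t.
Proof. by case: s t => [I J|K Sh Us] [I' J'|K' Sh' Us'] //= [-> ->]; split; apply: ele_refl. Qed.

Lemma hsub_refl s : hsub s s.
Proof. exact/heq_hsub/heq_refl. Qed.

Lemma hsub_trans s t w : hsub s t -> hsub t w -> hsub s w.
Proof.
case: s t w => [I J|K Sh Us] [I' J'|K' Sh' Us'] [I'' J''|K'' Sh'' Us''] //.
  by rewrite /hsub => -[a b] [c d]; split; [apply: ele_trans c a|apply: ele_trans b d].
exact: heq_trans.
Qed.

Lemma hsub_is_ch s t : hsub s t -> is_ch s = is_ch t.
Proof. by case: s t => [I J|K Sh Us] [I' J'|K' Sh' Us']. Qed.

Definition ksub (K K' : enat * enat) : bool := ele K'.1 K.1 && ele K.2 K'.2.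

Definition kadd (K : enat * enat) (m : nat) := (eadd K.1 (Some m), eadd K.2 (Some m)).

Definition kmax (K K' : enat * enat) := (emax K.1 K'.1, emax K.2 K'.2).

(** If [lo A] is infinite, the capacity admits no partner at a finite time, so the continuation is
    never released and costs nothing. *)
Definition kseq (c : vcap) (K : enat * enat) : enat * enat :=
  match c with
  | VLe J => (Some 0, eadd J K.2)
  | VIn A => (Some 0, if lo A is Some _ then eadd (hi A) K.2 else Some 0)
  end.

Lemma ksub_refl K : ksub K K.
Proof. by rewrite /ksub !ele_refl. Qed.

Lemma ksub_trans K K' K'' : ksub K K' -> ksub K' K'' -> ksub K K''.
Proof.
move=> /andP[a b] /andP[c d].
by rewrite /ksub (ele_trans c a) (ele_trans b d).
Qed.

Definition scons (T : Type) (k : nat) (f g : nat -> T) (i : nat) : T :=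
  if i < k then f i else g (i - k).

Fixpoint vetyping (D : nat -> shape) (e : expr) (T : shape) : Prop :=
  match e with
  | EVar x => hsub (D x) T
  | EZero => hsub (HNat (Some 0) (Some 0)) T
  | ESucc e => exists I J, vetyping D e (HNat I J) /\
      hsub (HNat (eadd I (Some 1)) (eadd J (Some 1))) T
  end.

Definition is_var (x : nat) (e : expr) : bool := if e is EVar y then y == x else false.

(* The positions at which x occurs in es, each consuming a share of its usage. *)
Definition occ (x : nat) (es : seq expr) : seq nat :=
  [seq i <- iota 0 (size es) | is_var x (nth EZero es i)].

Definition args (D : nat -> shape) (u : nat -> vusage) (es : seq expr)
    (Sh : nat -> shape) (Us : nat -> vusage) : Prop :=
  (forall i, i < size es -> vetyping D (nth EZero es i) (Sh i)) /\
  (forall x, sub (u x) (upar Us (occ x es))).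

(* Subtyping is built into every clause, which makes inversion immediate. *)
Fixpoint vtyping (P : proc) (D : nat -> shape) (u : nat -> vusage) (K : enat * enat) : Prop :=
  match P with
  | PZero => ksub (Some 0, Some 0) K
  | PPar P Q => exists u1 u2 K1 K2,
      [/\ forall x, sub (u x) (VPar (u1 x) (u2 x)), vtyping P D u1 K1, vtyping Q D u2 K2
        & ksub (kmax K1 K2) K]
  | PTick P => exists u1 K1,
      [/\ forall x, sub (u x) (vdelay (VIn (vpt 1)) (u1 x)), vtyping P D u1 K1
        & ksub (kadd K1 1) K]
  | PAnnot m P => exists u1 K1,
      [/\ forall x, sub (u x) (vdelay (VIn (vpt m)) (u1 x)), vtyping P D u1 K1
        & ksub (kadd K1 m) K]
  | PIn a k P => exists Kf Sh Us c u1 K1,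
      hsub (D a) (HCh Kf Sh Us) /\
      [/\ sub (u a) (VAct DIn (vpt 0) c (u1 a)),
          forall x : nat, x != a -> sub (u x) (vdelay c (u1 x)),
          forall v, vtyping P (scons k (Sh v) D) (scons k (Us v) u1) K1
        & ksub (kseq c K1) K]
  | PServ a k P => exists Kf Sh Us c u1,
      hsub (D a) (HCh Kf Sh Us) /\
      [/\ sub (u a) (VBang (VAct DIn (vpt 0) c (u1 a))),
          forall x : nat, x != a -> sub (u x) (vdelay c (VBang (u1 x))),
          forall v, vtyping P (scons k (Sh v) D) (scons k (Us v) u1) (Kf v)
        & ksub (Some 0, Some 0) K]
  | POut a es P => exists Kf Sh Us c u1 u2 v K1,
      hsub (D a) (HCh Kf Sh Us) /\
      [/\ sub (u a) (VAct DOut (vpt 0) c (VPar (u2 a) (u1 a))),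
          forall x : nat, x != a -> sub (u x) (vdelay c (VPar (u1 x) (u2 x))),
          args D u2 es (Sh v) (Us v), vtyping P D u1 K1
        & ksub (kseq c (kmax K1 (Kf v))) K]
  | PNu P => exists T U K1,
      [/\ is_ch T, reliable U, vtyping P (scons 1 (fun=> T) D) (scons 1 (fun=> U) u) K1
        & ksub K1 K]
  | PMatch e P Q => exists I J K1,
      [/\ vetyping D e (HNat I J), I = Some 0 -> vtyping P D u K1,
          ele (Some 1) J ->
          vtyping Q (scons 1 (fun=> HNat (epred I) (epred J)) D) (scons 1 (fun=> V0) u) K1
        & ksub K1 K]
  end.

Lemma scons_rel (T : Type) (R : T -> T -> Prop) k f f' g g' :
  (forall i, R (f i) (f' i)) -> (forall i, R (g i) (g' i)) ->
  forall i, R (scons k f g i) (scons k f' g' i).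
Proof. by rewrite /scons => a b i; case: ifP. Qed.

Lemma vetyping_mono D D' e T T' :
  (forall x, hsub (D x) (D' x)) -> hsub T' T -> vetyping D' e T' -> vetyping D e T.
Proof.
move=> s; elim: e T T' => /= [x||e IH] T T' sT.
- by move=> h; apply: hsub_trans (s x) (hsub_trans h sT).
- by move=> h; apply: hsub_trans h sT.
- case=> I [J [h hT]]; exists I, J; split; last exact: hsub_trans hT sT.
  exact: IH (hsub_refl _) h.
Qed.

Lemma vtyping_mono P D D' u u' K K' :
  (forall x, hsub (D x) (D' x)) -> (forall x, sub (u x) (u' x)) -> ksub K' K ->
  vtyping P D' u' K' -> vtyping P D u K.
Proof.
elim: P D D' u u' K K' => [|P IHP Q IHQ|a k P IH|a k P IH|a es P IH|P IH|P IH|e P IHP Q IHQ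
  |m P IH] D D' u u' K K' sD su sK /=.
- by move/ksub_trans; apply.
- case=> u1 [u2 [K1 [K2 [s p q k]]]]; exists u1, u2, K1, K2; split.
  + by move=> x; apply: sub_trans (su x) (s x).
  + by apply: IHP p => // [x|]; [apply: sub_refl|apply: ksub_refl].
  + by apply: IHQ q => // [x|]; [apply: sub_refl|apply: ksub_refl].
  + exact: ksub_trans k sK.
- case=> Kf [Sh [Us [c [u1 [h [sa s p kk]]]]]]; exists Kf, Sh, Us, c, u1; split.
    exact: hsub_trans (sD a) h.
  split=> [|x xa|v|]; [exact: sub_trans (su a) sa|exact: sub_trans (su x) (s x xa)|
    |exact: ksub_trans kk sK].
  apply: IH (p v); last exact: ksub_refl.
    by move=> x; apply: (@scons_rel _ hsub) => // i; apply: hsub_refl.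
  by move=> x; apply: sub_refl.
- case=> Kf [Sh [Us [c [u1 [K1 [h [sa s p kk]]]]]]]; exists Kf, Sh, Us, c, u1, K1; split.
    exact: hsub_trans (sD a) h.
  split=> [|x xa|v|]; [exact: sub_trans (su a) sa|exact: sub_trans (su x) (s x xa)|
    |exact: ksub_trans kk sK].
  apply: IH (p v); last exact: ksub_refl.
    by move=> x; apply: (@scons_rel _ hsub) => // i; apply: hsub_refl.
  by move=> x; apply: sub_refl.
- case=> Kf [Sh [Us [c [u1 [u2 [v [K1 [h [sa s [es1 es2] p kk]]]]]]]]].
  exists Kf, Sh, Us, c, u1, u2, v, K1; split; first exact: hsub_trans (sD a) h.
  split=> [|x xa|||]; [exact: sub_trans (su a) sa|exact: sub_trans (su x) (s x xa)| |
    |exact: ksub_trans kk sK].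
    by split=> // i ie; apply: vetyping_mono sD (hsub_refl _) (es1 i ie).
  by apply: IH p => // [x|]; [apply: sub_refl|apply: ksub_refl].
- case=> T [U [K1 [cT rU p kk]]]; exists T, U, K1; split=> //; last exact: ksub_trans kk sK.
  apply: IH p; last exact: ksub_refl.
    by move=> x; apply: (@scons_rel _ hsub) => // i; apply: hsub_refl.
  by move=> x; apply: (@scons_rel _ sub) => // i; apply: sub_refl.
- case=> u1 [K1 [s p kk]]; exists u1, K1; split; last exact: ksub_trans kk sK.
    by move=> x; apply: sub_trans (su x) (s x).
  by apply: IH p => // [x|]; [apply: sub_refl|apply: ksub_refl].
- case=> I [J [K1 [ee p q kk]]]; exists I, J, K1; split; last exact: ksub_trans kk sK.
  + exact: vetyping_mono sD (hsub_refl _) ee.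
  + by move=> /p; apply: IHP => //; apply: ksub_refl.
  + move=> /q; apply: IHQ; last exact: ksub_refl.
      by move=> x; apply: (@scons_rel _ hsub) => // i; apply: hsub_refl.
    by move=> x; apply: (@scons_rel _ sub) => // i; apply: sub_refl.
- case=> u1 [K1 [s p kk]]; exists u1, K1; split; last exact: ksub_trans kk sK.
    by move=> x; apply: sub_trans (su x) (s x).
  by apply: IH p => // [x|]; [apply: sub_refl|apply: ksub_refl].
Qed.

Lemma vtyping_mono_usage P D u u' K :
  (forall x, sub (u x) (u' x)) -> vtyping P D u' K -> vtyping P D u K.
Proof. by move=> s; apply: vtyping_mono => // [x|]; [apply: hsub_refl|apply: ksub_refl]. Qed.

Lemma vtyping_mono_cost P D u K K' : ksub K K' -> vtyping P D u K -> vtyping P D u K'.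
Proof. by move=> s; apply: vtyping_mono => // x; [apply: hsub_refl|apply: sub_refl]. Qed.

(** * Substitution *)

Lemma upar_mono (T : eqType) (f g : T -> vusage) l :
  (forall i, i \in l -> sub (f i) (g i)) -> sub (upar f l) (upar g l).
Proof.
elim: l => [|i l IH] s /=; first exact: sub_refl.
apply: sub_par; first by apply: s; rewrite mem_head.
by apply: IH => j jl; apply: s; rewrite inE jl orbT.
Qed.

Lemma upar_par (T : Type) (f g : T -> vusage) l :
  sub (upar (fun i => VPar (f i) (g i)) l) (VPar (upar f l) (upar g l)).
Proof.
elim: l => [|i l IH] /=; first exact: sub_par0.
apply: sub_trans (sub_par (sub_refl _) IH) _; usub.
Qed.

Lemma upar_umap (T : Type) h (f : T -> vusage) l :
  upar (fun i => umap h (f i)) l = umap h (upar f l).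
Proof. by elim: l => //= i l ->. Qed.

Lemma upar_bang (T : Type) (f : T -> vusage) l :
  sub (upar (fun i => VBang (f i)) l) (VBang (upar f l)).
Proof.
elim: l => [|i l IH] /=; first exact: sub_bang0.
exact: sub_trans (sub_par (sub_refl _) IH) (sub_bangP _ _).
Qed.

Lemma upar_map (T T' : Type) (f : T -> vusage) (g : T' -> T) l :
  upar f (map g l) = upar (f \o g) l.
Proof. by elim: l => //= i l ->. Qed.

Lemma upar_flatten (T : Type) (f : T -> vusage) ls :
  sub (upar (upar f) ls) (upar f (flatten ls)).
Proof.
elim: ls => [|l ls IH] /=; first exact: sub_refl.
exact: sub_trans (sub_par (sub_refl _) IH) (cat_upar _ _ _).
Qed.

(** For the obligation [0,0], the delay A + c of [sub_delay] acts as c, the delay that the prefix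
    clauses of [vtyping] impose on the other names. *)
Lemma sub_delay0 d c U V :
  sub (VPar (VAct d (vpt 0) c U) (vdelay c V)) (VAct d (vpt 0) c (VPar U V)).
Proof.
rewrite (@eq_umap _ (vadd (addc (vpt 0) c)) V); first exact: sub_delay.
by move=> B; apply: vitv_eq; elia.
Qed.

(** For substitutions that identify several names: the one in subject position, [a], provides the
    action, and the usages of the others, already delayed by c, move under it by the delay rule. *)
Lemma upar_act (T : eqType) (f g : T -> vusage) a l d c : uniq l -> a \in l ->
  sub (f a) (VAct d (vpt 0) c (g a)) ->
  (forall i, i != a -> sub (f i) (vdelay c (g i))) ->
  sub (upar f l) (VAct d (vpt 0) c (upar g l)).
Proof.
move=> ul al sa s; apply: sub_trans (upar_rem _ al) _.
have sr : sub (upar f (rem a l)) (vdelay c (upar g (rem a l))).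
  rewrite -upar_umap; apply: upar_mono => i; rewrite mem_rem_uniq // inE => /andP[ia _].
  exact: s.
apply: sub_trans (sub_par sa sr) _; apply: sub_trans (sub_delay0 _ _ _ _) _.
apply: sub_act (vsub_refl _) (csub_refl _) _.
apply: (@upar_uniq _ g _ (a :: rem a l)) => // i il.
by rewrite inE; case: eqVneq => //= ia; apply: rem_mem.
Qed.

(** Every component is replicated, so replication is pulled out of the composition and [upar_act]
    applies below it. *)
Lemma upar_bang_act (T : eqType) (f g : T -> vusage) a l d c : uniq l -> a \in l ->
  sub (f a) (VBang (VAct d (vpt 0) c (g a))) ->
  (forall i, i != a -> sub (f i) (vdelay c (VBang (g i)))) ->
  sub (upar f l) (VBang (VAct d (vpt 0) c (upar g l))).
Proof.
move=> ul al sa s.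
pose h i := if i == a then VAct d (vpt 0) c (g a) else vdelay c (g i).
apply: (@sub_trans _ (upar (fun i => VBang (h i)) l)).
  apply: upar_mono => i _; rewrite /h; case: eqVneq => [->|/s] //.
apply: sub_trans (upar_bang _ _) (sub_bang _).
apply: upar_act al _ _ => // [|i /negPf ia]; rewrite /h ?eqxx ?ia; exact: sub_refl.
Qed.

(** The usages of all names sent to y must coexist on y, which requires finitely many preimages.
    Repetitions are excluded so that no usage is counted twice. *)
Definition preimages (s : nat -> expr) (pre : nat -> seq nat) : Prop :=
  (forall x y, x \in pre y <-> s x = EVar y) /\ forall y, uniq (pre y).

Definition push (pre : nat -> seq nat) (u : nat -> vusage) (y : nat) : vusage :=
  upar u (pre y).

Definition pre_up k (pre : nat -> seq nat) (y : nat) : seq nat :=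
  if y < k then [:: y] else map (addn k) (pre (y - k)).

Lemma preimages_up k s pre :
  preimages s pre -> preimages (upsub k s) (pre_up k pre).
Proof.
case=> h ul; split=> [x y|y]; rewrite /pre_up; last first.
  by case: ifP => // _; rewrite map_inj_uniq //; apply: addnI.
rewrite /upsub; case: (ltnP y k) => yk.
  rewrite inE; split=> [/eqP ->|]; first by rewrite yk.
  case: ltnP => xk; first by case=> ->.
  by case: (s _) => //= z [e]; lia.
split=> [/mapP[z /h e ->]|].
  by rewrite ltnNge leq_addr /= addKn e /eren /= subnKC.
case: ltnP => xk; first by case=> e; lia.
case e: (s _) => [z| |] //= [<-].
rewrite addKn -{1}(subnKC xk) mem_map; [exact/h|exact: addnI].
Qed.

Lemma push_up k pre V u y :
  sub (scons k V (push pre u) y) (push (pre_up k pre) (scons k V u) y).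
Proof.
rewrite /push /pre_up /scons; case: ifP => yk /=; first by rewrite yk; apply: sub_par0.
rewrite upar_map; apply: upar_mono => i _ /=.
by rewrite ltnNge leq_addr addKn; apply: sub_refl.
Qed.

Lemma vetyping_subst s D D' e T :
  (forall x, vetyping D' (s x) (D x)) -> vetyping D e T -> vetyping D' (esubst s e) T.
Proof.
move=> h; elim: e T => [x||e IH] T //=.
  by move=> sT; apply: vetyping_mono sT (h x) => y; apply: hsub_refl.
by case=> X [Y [/IH ee sT]]; exists X, Y.
Qed.

Lemma vetyping_ren f D D' e T : (forall x, D' (f x) = D x) -> vetyping D e T -> vetyping D' (eren f e) T.
Proof. by move=> h; apply: vetyping_subst => x /=; rewrite h; apply: hsub_refl. Qed.

Lemma vetyping_up k s Sh D D' : (forall x, vetyping D' (s x) (D x)) ->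
  forall x, vetyping (scons k Sh D') (upsub k s x) (scons k Sh D x).
Proof.
move=> h x; rewrite /upsub {2}/scons; case: ifP => xk /=.
  by rewrite /scons xk; apply: hsub_refl.
apply: vetyping_ren (h _) => y; by rewrite /scons ltnNge leq_addr addKn.
Qed.

Lemma occ_uniq x es : uniq (occ x es).
Proof. exact/filter_uniq/iota_uniq. Qed.

Lemma mem_occ x es i :
  (i \in occ x es) = (i < size es) && is_var x (nth EZero es i).
Proof. by rewrite mem_filter mem_iota /= andbC. Qed.

Lemma is_varP x e : reflect (e = EVar x) (is_var x e).
Proof.
case: e => [y||e] /=; try by constructor.
by apply: (iffP eqP) => [->|[]].
Qed.

Lemma args_subst s pre D D' u es Sh Us : preimages s pre ->
  (forall x, vetyping D' (s x) (D x)) -> args D u es Sh Us ->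
  args D' (push pre u) (map (esubst s) es) Sh Us.
Proof.
move=> [pr _] h [e1 e2]; split=> [i|y].
  by rewrite size_map => ie; rewrite (nth_map EZero) //; apply: vetyping_subst h (e1 i ie).
apply: (@sub_trans _ (upar (fun x => upar Us (occ x es)) (pre y))).
  by apply: upar_mono => x _; apply: e2.
(* A position of y in the substituted tuple was held by a name of [pre y], so its share is among
   those collected from the preimages. *)
rewrite -[upar _ (pre y)](@upar_map _ _ (upar Us) (occ^~ es)).
apply: sub_trans (upar_flatten _ _) _.
apply: upar_uniq => [|i]; first exact: occ_uniq.
rewrite mem_occ size_map => /andP[ie]; rewrite (nth_map EZero) //.
case e: (nth EZero es i) => [x||e'] //= /is_varP sx.
apply/flatten_mapP; exists x; first exact/pr.
by rewrite mem_occ ie e /=.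
Qed.

(** Only names have channel shapes, so a substitution that respects shapes never puts a non-name in
    subject position. *)
Lemma vetyping_var (s : nat -> expr) D D' a K Sh Us : (forall x, vetyping D' (s x) (D x)) ->
  hsub (D a) (HCh K Sh Us) ->
  exists2 b, s a = EVar b & hsub (D' b) (HCh K Sh Us).
Proof.
move=> h hs; have := h a.
have: is_ch (D a) by rewrite (hsub_is_ch hs).
case: (s a) => [b||e] /=; first by move=> _ e; exists b => //; apply: hsub_trans e hs.
  by case: (D a).
by case: (D a) => // ? ? ? _ [? [? []]].
Qed.

Lemma omap2_Some (X Y Z : Type) (f : X -> Y -> Z) x y z :
  omap2 f x y = Some z -> exists a b, [/\ x = Some a, y = Some b & z = f a b].
Proof. by case: x y => [a|] [b|] //= [<-]; exists a, b. Qed.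

Lemma omap_Some (X Z : Type) (f : X -> Z) x z :
  omap f x = Some z -> exists2 a, x = Some a & z = f a.
Proof. by case: x => [a|] //= [<-]; exists a. Qed.

Lemma vtyping_subst P s pre D D' u K P' :
  preimages s pre -> (forall x, vetyping D' (s x) (D x)) -> psubst s P = Some P' ->
  vtyping P D u K -> vtyping P' D' (push pre u) K.
Proof.
elim: P s pre D D' u K P' => [|P IHP Q IHQ|a k P IH|a k P IH|a es P IH|P IH|P IH
  |e P IHP Q IHQ|m P IH] s pre D D' u K P' pr h /=.
- by case=> <-.
- move=> es'; have [P1 [Q1 [eP eQ ->]]] := omap2_Some es'; move: es' => _ [u1 [u2 [K1 [K2 [ss p q kk]]]]].
  exists (push pre u1), (push pre u2), K1, K2; split=> //.
  + by move=> x; apply: sub_trans _ (upar_par _ _ _); apply: upar_mono => i _; apply: ss.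
  + exact: IHP pr h eP p.
  + exact: IHQ pr h eQ q.
- move=> es'; have [b' [P1 [eb eP ->]]] := omap2_Some es'; move: es' => _ [Kf [Sh [Us [c [u1 [hs [sa ss p kk]]]]]]].
  have [b sb hb] := vetyping_var h hs; move: eb; rewrite sb => -[?]; subst b'.
  exists Kf, Sh, Us, c, (push pre u1); split=> //; split=> // [|x xb|v].
  + by apply: upar_bang_act sa ss; [case: pr|apply/(proj1 pr)].
  + rewrite /push; apply: (@sub_trans _ (upar (fun i => vdelay c (VBang (u1 i))) (pre x))).
      apply: upar_mono => i /(proj1 pr) si; apply: ss.
      by apply: contraNneq xb => ia; move: si; rewrite ia sb => -[->].
    by rewrite upar_umap; apply: sub_vdelay; apply: upar_bang.
  + apply: vtyping_mono_usage (IH _ _ _ _ _ _ _ (preimages_up k pr) (@vetyping_up k _ (Sh v) _ _ h) eP (p v)).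
    by move=> x; apply: push_up.
- move=> es'; have [b' [P1 [eb eP ->]]] := omap2_Some es'; move: es' => _ [Kf [Sh [Us [c [u1 [K1 [hs [sa ss p kk]]]]]]]].
  have [b sb hb] := vetyping_var h hs; move: eb; rewrite sb => -[?]; subst b'.
  exists Kf, Sh, Us, c, (push pre u1), K1; split=> //; split=> // [|x xb|v].
  + by apply: upar_act sa ss; [case: pr|apply/(proj1 pr)].
  + rewrite /push -upar_umap; apply: upar_mono => i /(proj1 pr) si; apply: ss.
    by apply: contraNneq xb => ia; move: si; rewrite ia sb => -[->].
  + apply: vtyping_mono_usage (IH _ _ _ _ _ _ _ (preimages_up k pr) (@vetyping_up k _ (Sh v) _ _ h) eP (p v)).
    by move=> x; apply: push_up.
- move=> es'; have [b' [P1 [eb eP ->]]] := omap2_Some es'; move: es' => _.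
  case=> Kf [Sh [Us [c [u1 [u2 [v [K1 [hs [sa ss es0 p kk]]]]]]]]].
  have [b sb hb] := vetyping_var h hs; move: eb; rewrite sb => -[?]; subst b'.
  exists Kf, Sh, Us, c, (push pre u1), (push pre u2), v, K1; split=> //; split=> // [|x xb||].
  + apply: sub_trans (sub_act _ (vsub_refl _) (csub_refl _) (upar_par u2 u1 (pre b))).
    apply: upar_act sa _; [by case: pr|by apply/(proj1 pr)|].
    by move=> x xa; apply: sub_trans (ss x xa) _; apply: sub_parC.
  + apply: sub_trans _ (sub_vdelay c (upar_par u1 u2 (pre x))).
    rewrite -upar_umap; apply: upar_mono => i /(proj1 pr) si; apply: ss.
    by apply: contraNneq xb => ia; move: si; rewrite ia sb => -[->].
  + exact: args_subst pr h es0.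
  + exact: IH pr h eP p.
- move=> es'; have [P1 eP ->] := omap_Some es'; move: es' => _ [T [U [K1 [cT rU p kk]]]].
  exists T, U, K1; split=> //.
  apply: vtyping_mono_usage (IH _ _ _ _ _ _ _ (preimages_up 1 pr) (@vetyping_up 1 _ (fun=> T) _ _ h) eP p).
  by move=> x; apply: push_up.
- move=> es'; have [P1 eP ->] := omap_Some es'; move: es' => _ [u1 [K1 [ss p kk]]].
  exists (push pre u1), K1; split=> //; last exact: IH pr h eP p.
  by move=> x; rewrite /push -upar_umap; apply: upar_mono => i _; apply: ss.
- move=> es'; have [P1 [Q1 [eP eQ ->]]] := omap2_Some es'; move: es' => _ [X [Y [K1 [ee p q kk]]]].
  exists X, Y, K1; split=> //; first exact: vetyping_subst h ee.
    by move=> /p; apply: IHP pr h eP.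
  move=> /q q1.
  apply: vtyping_mono_usage (IHQ _ _ _ _ _ _ _ (preimages_up 1 pr)
    (@vetyping_up 1 _ (fun=> HNat (epred X) (epred Y)) _ _ h) eQ q1).
  by move=> x; apply: push_up.
- move=> es'; have [P1 eP ->] := omap_Some es'; move: es' => _ [u1 [K1 [ss p kk]]].
  exists (push pre u1), K1; split=> //; last exact: IH pr h eP p.
  by move=> x; rewrite /push -upar_umap; apply: upar_mono => i _; apply: ss.
Qed.

(** This makes pushing usages forward add, to the usage of y in the body, one share for each
    position at which y is passed. *)
Lemma preimages_inst es :
  preimages (fun i => nth (EVar (i - size es)) es i) (fun y => size es + y :: occ y es).
Proof.
split=> [x y|y] /=; last by rewrite occ_uniq mem_occ ltnNge leq_addr.
rewrite inE mem_occ; case: (ltnP x (size es)) => xs /=.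
  rewrite (_ : (x == _) = false) /=; last by apply/negP => /eqP e; lia.
  by rewrite (set_nth_default EZero) //; split=> [/is_varP|e] //; apply/is_varP.
rewrite nth_default // orbF; split=> [/eqP ->|[<-]]; first by rewrite addKn.
by rewrite subnKC.
Qed.

Lemma vtyping_inst P P' D u u' es Sh Us K : args D u' es Sh Us -> pinst es P = Some P' ->
  vtyping P (scons (size es) Sh D) (scons (size es) Us u) K ->
  vtyping P' D (fun x => VPar (u x) (u' x)) K.
Proof.
move=> [h1 h2] e p.
apply: vtyping_mono_usage (vtyping_subst (preimages_inst es) _ e p) => x /=.
  apply: sub_par.
    by rewrite /scons ltnNge leq_addr addKn; apply: sub_refl.
  apply: sub_trans (h2 x) _; apply: upar_mono => i.
  by rewrite mem_occ /scons => /andP[-> _]; apply: sub_refl.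
rewrite /scons; case: ltnP => xs; last by rewrite nth_default //=; apply: hsub_refl.
by rewrite (set_nth_default EZero) //; apply: h1.
Qed.

(** ** Renamings *)

Lemma upsub_ren k f : upsub k (fun v => EVar (f v)) = fun v => EVar (upren k f v).
Proof.
by apply: functional_extensionality => i; rewrite /upsub /upren; case: ifP.
Qed.

Lemma psubst_ren P f : psubst (fun v => EVar (f v)) P = Some (pren f P).
Proof.
elim: P f => [|P IHP Q IHQ|a k P IH|a k P IH|a es P IH|P IH|P IH|e P IHP Q IHQ|m P IH] f //=;
  by rewrite ?upsub_ren ?IHP ?IHQ ?IH.
Qed.

Lemma vtyping_ren f pre P D D' u K :
  preimages (fun v => EVar (f v)) pre -> (forall x, D' (f x) = D x) ->
  vtyping P D u K -> vtyping (pren f P) D' (push pre u) K.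
Proof.
move=> pr h; apply: vtyping_subst pr _ (psubst_ren _ _) => x /=.
by rewrite h; apply: hsub_refl.
Qed.

Lemma vetyping_unren f D e T : vetyping D (eren f e) T -> vetyping (D \o f) e T.
Proof.
by elim: e T => //= e IH T [X [Y [/IH ee s]]]; exists X, Y.
Qed.

Lemma scons_upren (T : Type) k f (g h : nat -> T) :
  scons k g h \o upren k f = scons k g (h \o f).
Proof.
apply: functional_extensionality => i; rewrite /scons /upren /=; case: (ltnP i k) => ik; rewrite ?ik //.
by rewrite ltnNge leq_addr addKn.
Qed.

Lemma upren_inj k f : injective f -> injective (upren k f).
Proof.
move=> fi x y; rewrite /upren; case: (ltnP x k); case: (ltnP y k) => yk xk //; try lia.
by move/addnI/fi; lia.
Qed.

Lemma occ_ren f x es : injective f -> occ (f x) (map (eren f) es) = occ x es.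
Proof.
move=> fi; rewrite /occ size_map; apply: eq_in_filter => i; rewrite mem_iota => /= ie.
by rewrite (nth_map EZero) //; case: (nth _ _ _) => //= y; rewrite (inj_eq fi).
Qed.

(** Needed where a congruence law removes a renaming: the shift in scope extrusion and the exchange
    of two binders. Injectivity ensures that no two names have been merged. *)
Lemma vtyping_unren f P D u K : injective f -> vtyping (pren f P) D u K -> vtyping P (D \o f) (u \o f) K.
Proof.
elim: P f D u K => [|P IHP Q IHQ|a k P IH|a k P IH|a es P IH|P IH|P IH|e P IHP Q IHQ|m P IH]
  f D u K fi //=.
- case=> u1 [u2 [K1 [K2 [s p q kk]]]].
  by exists (u1 \o f), (u2 \o f), K1, K2; split=> //; [exact: IHP p|exact: IHQ q].
- case=> Kf [Sh [Us [c [u1 [h [sa s p kk]]]]]].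
  exists Kf, Sh, Us, c, (u1 \o f); split=> //; split=> // [x xa|v].
    by apply: (s (f x)); rewrite (inj_eq fi).
  by rewrite -(scons_upren _ _ _ D) -(scons_upren _ _ _ u1); apply: IH (p v); apply: upren_inj.
- case=> Kf [Sh [Us [c [u1 [K1 [h [sa s p kk]]]]]]].
  exists Kf, Sh, Us, c, (u1 \o f), K1; split=> //; split=> // [x xa|v].
    by apply: (s (f x)); rewrite (inj_eq fi).
  by rewrite -(scons_upren _ _ _ D) -(scons_upren _ _ _ u1); apply: IH (p v); apply: upren_inj.
- case=> Kf [Sh [Us [c [u1 [u2 [v [K1 [h [sa s [e1 e2] p kk]]]]]]]]].
  exists Kf, Sh, Us, c, (u1 \o f), (u2 \o f), v, K1; split=> //; split=> // [x xa||].
  + by apply: (s (f x)); rewrite (inj_eq fi).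
  + split=> [i ie|x /=]; last by rewrite -(occ_ren _ _ fi).
    by have := e1 i; rewrite size_map (nth_map EZero) // => /(_ ie) /vetyping_unren.
  + exact: IH p.
- case=> T [U [K1 [cT rU p kk]]]; exists T, U, K1; split=> //.
  by rewrite -(scons_upren _ _ _ D) -(scons_upren _ _ _ u); apply: IH p; apply: upren_inj.
- by case=> u1 [K1 [s p kk]]; exists (u1 \o f), K1; split=> //; exact: IH p.
- case=> X [Y [K1 [ee p q kk]]]; exists X, Y, K1; split=> //; first exact: vetyping_unren.
    by move=> /p; apply: IHP.
  move=> /q q1; rewrite -(scons_upren _ _ _ D) -(scons_upren _ _ _ u).
  by apply: IHQ q1; apply: upren_inj.
- by case=> u1 [K1 [s p kk]]; exists (u1 \o f), K1; split=> //; exact: IH p.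
Qed.

(** * Structural congruence *)

Lemma kadd_mono K K' m : ksub K K' -> ksub (kadd K m) (kadd K' m).
Proof. by move=> /andP[a b]; rewrite /ksub !ele_add ?ele_refl. Qed.

Lemma kmax_mono K K' L L' : ksub K K' -> ksub L L' -> ksub (kmax K L) (kmax K' L').
Proof.
by move=> /andP[a b] /andP[c d]; rewrite /ksub !ele_max.
Qed.

Lemma emaxC x y : emax x y = emax y x.
Proof. by case: x y => [x|] [y|] //; rewrite /emax maxnC. Qed.

Lemma emaxA x y z : emax x (emax y z) = emax (emax x y) z.
Proof. by case: x y z => [x|] [y|] [z|] //; rewrite /emax maxnA. Qed.

Lemma eadd_maxl x y m : eadd (emax x y) (Some m) = emax (eadd x (Some m)) (eadd y (Some m)).
Proof. by case: x y => [x|] [y|] //; rewrite /emax /eadd addn_maxl. Qed.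

Lemma emax_ler x y : ele x (emax x y).
Proof. by case: x y => [x|] [y|] //; rewrite /emax /ele leq_maxl. Qed.

Lemma emax0 x y : ele y (Some 0) -> emax x y = x.
Proof. by case: x y => [x|] [[|y]|] // _; rewrite /emax maxn0. Qed.

Lemma kmaxC K L : kmax K L = kmax L K.
Proof. by congr pair; apply: emaxC. Qed.

Lemma kmaxA K L M : kmax K (kmax L M) = kmax (kmax K L) M.
Proof. by congr pair; apply: emaxA. Qed.

Lemma kadd_kmax K L m : kadd (kmax K L) m = kmax (kadd K m) (kadd L m).
Proof. by congr pair; apply: eadd_maxl. Qed.

Lemma kaddA K m n : kadd (kadd K n) m = kadd K (m + n).
Proof.
by case: K => [[x|] [y|]]; rewrite /kadd /eadd //= -?addnA (addnC n).
Qed.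

Lemma kadd0 K : kadd K 0 = K.
Proof. by case: K => [[x|] [y|]]; rewrite /kadd /eadd //= ?addn0. Qed.

Lemma kmax0 K L : ksub (Some 0, Some 0) L -> ksub K (kmax K L).
Proof. by case/andP=> [l _]; rewrite /ksub /= emax_ler emax0 // ele_refl. Qed.

Lemma kmax00 K : kmax K (Some 0, Some 0) = K.
Proof. by case: K => x y; congr pair; apply: emax0. Qed.

Lemma vdelay_vdelay m n U :
  vdelay (VIn (vpt m)) (vdelay (VIn (vpt n)) U) = vdelay (VIn (vpt (m + n))) U.
Proof. by rewrite umap_comp; apply: eq_umap => B /=; apply: caddA. Qed.

Lemma vdelay0 U : vdelay (VIn (vpt 0)) U = U.
Proof. by apply: umap_id => B; apply: cadd0. Qed.

Lemma preimages_swap : preimages (fun v => EVar (swap01 v)) (fun y => [:: swap01 y]).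
Proof.
split=> // x y; rewrite inE; split=> [/eqP ->|[<-]]; last by case: x => [|[|x]].
by case: y => [|[|y]].
Qed.

Lemma preimages_succ :
  preimages (fun v => EVar (1 + v)) (fun y => if y is y'.+1 then [:: y'] else [::]).
Proof.
split=> [x y|[|y] //]; case: y => [|y] /=; first by rewrite in_nil add1n; split.
by rewrite inE add1n; split=> [/eqP ->|[->]].
Qed.

Lemma swap01K : involutive swap01.
Proof. by case=> [|[|x]]. Qed.

Lemma pcong_st P Q : pcong P Q -> forall D u K, vtyping P D u K <-> vtyping Q D u K.
Proof.
elim=> {P Q} [P|P Q _ IH|P Q R _ IH1 _ IH2|P P' Q Q' _ IHP _ IHQ|a k P P' _ IH
  |a k P P' _ IH|a es P P' _ IH|P P' _ IH|P P' _ IH|e P P' Q Q' _ IHP _ IHQ|m P P' _ IH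
  |P|P Q|P Q R|P|P Q|P|m P Q|m P|m n P] D u K //=.
- by rewrite IH.
- by rewrite IH1.
- by split=> -[u1 [u2 [K1 [K2 [s /IHP p /IHQ q kk]]]]]; exists u1, u2, K1, K2.
- by split=> -[Kf [Sh [Us [c [u1 [h [sa s p kk]]]]]]];
    exists Kf, Sh, Us, c, u1; split=> //; split=> // v; apply/IH.
- by split=> -[Kf [Sh [Us [c [u1 [K1 [h [sa s p kk]]]]]]]];
    exists Kf, Sh, Us, c, u1, K1; split=> //; split=> // v; apply/IH.
- by split=> -[Kf [Sh [Us [c [u1 [u2 [v [K1 [h [sa s ee /IH p kk]]]]]]]]]];
    exists Kf, Sh, Us, c, u1, u2, v, K1.
- by split=> -[T [U [K1 [cT rU /IH p kk]]]]; exists T, U, K1.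
- by split=> -[u1 [K1 [s /IH p kk]]]; exists u1, K1.
- by split=> -[X [Y [K1 [ee p q kk]]]]; exists X, Y, K1; split=> //;
    [move=> /p/IHP|move=> /q/IHQ|move=> /p/IHP|move=> /q/IHQ].
- by split=> -[u1 [K1 [s /IH p kk]]]; exists u1, K1.
- split=> [[u1 [u2 [K1 [K2 [s p q kk]]]]]|p].
    apply: vtyping_mono_usage (vtyping_mono_cost (ksub_trans (kmax0 _ q) kk) p) => x.
    exact: sub_trans (s x) (sub_proj _ _).
  exists u, (fun=> V0), K, (Some 0, Some 0); split=> // [x|]; first exact: sub_par0.
  by rewrite kmax00 ksub_refl.
- split=> -[u1 [u2 [K1 [K2 [s p q kk]]]]]; exists u2, u1, K2, K1; split=> //;
    rewrite 1?kmaxC // => x; exact: sub_trans (s x) (sub_parC _ _).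
- split.
    case=> u1 [u23 [K1 [K23 [s p [u2 [u3 [K2 [K3 [s' q r kk']]]]] kk]]]].
    exists (fun x => VPar (u1 x) (u2 x)), u3, (kmax K1 K2), K3; split=> //.
    + move=> x; apply: sub_trans (s x) _.
      apply: sub_trans (sub_par (sub_refl _) (s' x)) _; usub.
    + by exists u1, u2, K1, K2; split=> // [x|]; [apply: sub_refl|apply: ksub_refl].
    + by rewrite -kmaxA; apply: ksub_trans kk; apply: kmax_mono kk'; apply: ksub_refl.
  case=> u12 [u3 [K12 [K3 [s [u1 [u2 [K1 [K2 [s' p q kk']]]]] r kk]]]].
  exists u1, (fun x => VPar (u2 x) (u3 x)), K1, (kmax K2 K3); split=> //.
  + move=> x; apply: sub_trans (s x) _.
    apply: sub_trans (sub_par (s' x) (sub_refl _)) _; usub.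
  + by exists u2, u3, K2, K3; split=> // [x|]; [apply: sub_refl|apply: ksub_refl].
  + by rewrite kmaxA; apply: ksub_trans kk; apply: kmax_mono kk' _; apply: ksub_refl.
- split.
    case=> T [U [K1 [cT rU [T' [U' [K2 [cT' rU' p kk']]]] kk]]].
    exists T', U', K2; split=> //; last exact: ksub_trans kk' kk.
    exists T, U, K2; split=> //; last exact: ksub_refl.
    apply: vtyping_mono_usage (vtyping_ren preimages_swap _ p) => [x|].
      by case: x => [|[|x]]; apply: sub_par0.
    by case=> [|[|x]].
  case=> T [U [K1 [cT rU [T' [U' [K2 [cT' rU' p kk']]]] kk]]].
  exists T', U', K2; split=> //; last exact: ksub_trans kk' kk.
  exists T, U, K2; split=> //; last exact: ksub_refl.
  apply: vtyping_mono (vtyping_unren (inv_inj swap01K) p); last exact: ksub_refl.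
    by case=> [|[|x]]; apply: hsub_refl.
  by case=> [|[|x]]; apply: sub_refl.
(* From left to right, whatever usage Q was given for the bound name is discarded; from right to
   left, Q receives [V0] for it. *)
- split.
    case=> T [U [K1 [cT rU [u1 [u2 [K2 [K3 [s p q kk']]]]] kk]]].
    exists (fun x => u1 x.+1), (fun x => u2 x.+1), K2, K3; split.
    + by move=> x; have := s x.+1; rewrite /scons /= subn1.
    + exists T, (u1 0), K2; split=> //; last exact: ksub_refl.
        exact: reliable_sub (sub_trans (s 0) (sub_proj _ _)) rU.
      apply: vtyping_mono_usage p => -[|x]; rewrite /scons /= ?subn1; exact: sub_refl.
    + apply: vtyping_mono (vtyping_unren (@addnI 1) q); last exact: ksub_refl.
        by move=> x; rewrite /scons /= subn1; apply: hsub_refl.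
      by move=> x; apply: sub_refl.
    + exact: ksub_trans kk' kk.
  case=> u1 [u2 [K1 [K2 [s [T [U [K3 [cT rU p kk']]]] q kk]]]].
  exists T, U, (kmax K3 K2); split=> //; last first.
    by apply: ksub_trans kk; apply: kmax_mono kk' _; apply: ksub_refl.
  exists (scons 1 (fun=> U) u1), (scons 1 (fun=> V0) u2), K3, K2.
  split=> //; last exact: ksub_refl.
    by case=> [|x]; [apply: sub_par0|rewrite /scons /= subn1].
  apply: vtyping_mono_usage (vtyping_ren preimages_succ _ q) => [x|x].
    by case: x => [|x]; rewrite /scons /push /= ?subn1; [apply: sub_refl|apply: sub_par0].
  by rewrite /scons /= subn1.
- split=> [[u1 [K1 [s p kk]]]|p].
    rewrite kadd0 in kk; apply: vtyping_mono_usage (vtyping_mono_cost kk p) => x.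
    by rewrite -[u1 x]vdelay0.
  by exists u, K; split=> // [x|]; rewrite ?vdelay0 ?kadd0; [apply: sub_refl|apply: ksub_refl].
- split.
    case=> u0 [K0 [s0 [u1 [u2 [K1 [K2 [s p q kk']]]]] kk]].
    exists (fun x => vdelay (VIn (vpt m)) (u1 x)), (fun x => vdelay (VIn (vpt m)) (u2 x)).
    exists (kadd K1 m), (kadd K2 m); split.
    + by move=> x; apply: sub_trans (s0 x) (sub_vdelay (VIn (vpt m)) (s x)).
    + by exists u1, K1; split=> // [x|]; [apply: sub_refl|apply: ksub_refl].
    + by exists u2, K2; split=> // [x|]; [apply: sub_refl|apply: ksub_refl].
    + by rewrite -kadd_kmax; apply: ksub_trans (kadd_mono m kk') kk.
  case=> u1 [u2 [K1 [K2 [s [v1 [L1 [s1 p k1]]] [v2 [L2 [s2 q k2]]] kk]]]].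
  exists (fun x => VPar (v1 x) (v2 x)), (kmax L1 L2); split.
  + by move=> x; apply: sub_trans (s x) (sub_par (s1 x) (s2 x)).
  + by exists v1, v2, L1, L2; split=> // [x|]; [apply: sub_refl|apply: ksub_refl].
  + by rewrite kadd_kmax; apply: ksub_trans (kmax_mono k1 k2) kk.
(* Moving the restriction out of the annotation delays the usage of the bound name by m, which both
   preserves and reflects reliability. *)
- split.
    case=> u1 [K1 [s [T [U [K2 [cT rU p kk']]]] kk]].
    exists T, (vdelay (VIn (vpt m)) U), (kadd K2 m); split=> //.
    + exact: reliable_vdelay.
    + exists (scons 1 (fun=> U) u1), K2; split=> //; last exact: ksub_refl.
      by case=> [|x]; rewrite /scons /= ?subn1; [apply: sub_refl|apply: s].
    + exact: ksub_trans (kadd_mono m kk') kk.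
  case=> T [U [K1 [cT rU [u1 [K2 [s p kk']]] kk]]].
  exists (fun x => u1 x.+1), K2; split.
  + by move=> x; have := s x.+1; rewrite /scons /= subn1.
  + exists T, (u1 0), K2; split=> //; last exact: ksub_refl.
      by apply: (@vdelay_rel m); apply: reliable_sub (s 0) rU.
    apply: vtyping_mono_usage p => -[|x]; rewrite /scons /= ?subn1; exact: sub_refl.
  + exact: ksub_trans kk' kk.
- split.
    case=> u1 [K1 [s [u2 [K2 [s' p kk']]] kk]].
    exists u2, K2; split=> // [x|].
      by rewrite -vdelay_vdelay; apply: sub_trans (s x) (sub_vdelay _ (s' x)).
    by rewrite -kaddA; apply: ksub_trans (kadd_mono m kk') kk.
  case=> u2 [K2 [s p kk]].
  exists (fun x => vdelay (VIn (vpt n)) (u2 x)), (kadd K2 n); split=> // [x||].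
  + by rewrite vdelay_vdelay.
  + by exists u2, K2; split=> // [x|]; [apply: sub_refl|apply: ksub_refl].
  + by rewrite kaddA.
Qed.

(** * Subject reduction *)

(** The free names of a continuation are typed with the delay n + c, while the communication takes
    place at time max(m, n); the capacity condition puts this time inside n + c. *)
Lemma okhalf_delay n m c B : okhalf (vpt n) c (vpt m) ->
  vsub (cadd (VIn (vpt (maxn m n))) B) (cadd (VIn (vpt n)) (cadd c B)).
Proof.
by case: c => [[J|]|[[x|] [y|] p]]; case: B => [[z|] [w|] q];
  rewrite /okhalf /vsub /cadd /= /eadd /=; lia.
Qed.

(** The clause of [kseq] that drops K cannot arise, since [okhalf] fails for a capacity with
    infinite lower end. *)
Lemma kseq_hi n m c K : okhalf (vpt n) c (vpt m) ->
  ele (eadd K.2 (Some (maxn m n))) (kadd (kseq c K) n).2.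
Proof.
by case: c => [[J|]|[[x|] [y|] p]]; case: K => [k1 [k2|]];
  rewrite /okhalf /kseq /kadd /= /eadd /=; lia.
Qed.

Lemma kseq_le n m c d K L L' : okc (vpt n) c (vpt m) d -> ele L.2 L'.2 ->
  ksub (kadd (kmax K L) (maxn m n)) (kmax (kadd (kseq c K) n) (kadd (kseq d L') m)).
Proof.
case/andP=> o1 o2 sL; apply/andP; split; last first.
  rewrite [_.2]/= eadd_maxl; apply: ele_max; first exact: kseq_hi.
  by apply: ele_trans (ele_add sL (ele_refl _)) _; rewrite maxnC; apply: kseq_hi.
have z e X : (kseq e X).1 = Some 0 by case: e.
(* Prefixes have lower cost 0, so before the step the lower end is just the larger annotation, which
   the step keeps. *)
rewrite /= !z (_ : emax _ _ = Some (maxn m n)); last by rewrite /emax /= maxnC.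
by case: (emax K.1 L.1) => [x|] //=; rewrite leq_addl.
Qed.

Lemma kseq_ler n m c d L : okc (vpt n) c (vpt m) d ->
  ksub (kmax (kadd (Some 0, Some 0) n) (kadd L (maxn m n)))
       (kmax (kadd (Some 0, Some 0) n) (kadd (kseq d L) m)).
Proof.
case/andP=> _ o2; apply/andP; split; last first.
  by apply: ele_max; [apply: ele_refl|rewrite maxnC; apply: kseq_hi].
have z e X : (kseq e X).1 = Some 0 by case: e.
rewrite /= !z; apply: ele_max; first exact: ele_refl.
case: (L.1) => [x|] //=.
by rewrite /eadd /= add0n; lia.
Qed.

Lemma cadd_vpt0 n : cadd (VIn (vpt n)) (vpt 0) = vpt n.
Proof. by apply: vitv_eq => /=; rewrite /eadd; congr Some; lia. Qed.

Lemma vmax_pt n m : vmax (vpt n) (vpt m) = vpt (maxn m n).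
Proof. by apply: vitv_eq => /=; rewrite /emax maxnC. Qed.

(** A failing communication would be an error of the reliable W; hence the conditions hold at the
    actual times n and m. *)
Lemma comm_usage n m c d U V (W : vusage) :
  reliable W -> sub W (VPar (VAct DIn (vpt n) c U) (VAct DOut (vpt m) d V)) ->
  okc (vpt n) c (vpt m) d /\ redz W (vdelay (VIn (vpt (maxn m n))) (VPar U V)).
Proof.
move=> r s; have x := reliable_sub s r.
have h := CommOf (ext_parl (VAct DOut (vpt m) d V) (ext_act DIn (vpt n) c U))
  (ext_parr V0 (ext_act DOut (vpt m) d V)).
have ok : okc (vpt n) c (vpt m) d.
  by apply/negPn/negP => /negPf e; rewrite e in h; apply: reliable_err x _; eexists; apply: h.
split=> //; rewrite ok vmax_pt in h.
apply: sub_redz r s _; eexists; first by right; apply: h.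
exact: sub_proj.
Qed.

(** One copy is unfolded for the call, and the replicated usage stays beside it. *)
Lemma call_usage n m c d U V (W : vusage) :
  reliable W -> sub W (VPar (VBang (VAct DIn (vpt n) c U)) (VAct DOut (vpt m) d V)) ->
  okc (vpt n) c (vpt m) d /\
  redz W (VPar (VBang (VAct DIn (vpt n) c U)) (vdelay (VIn (vpt (maxn m n))) (VPar U V))).
Proof.
move=> r s; set B := VBang _.
have s' : sub W (VPar (VPar (VAct DIn (vpt n) c U) (VAct DOut (vpt m) d V)) B).
  apply: sub_trans s _; apply: sub_trans (sub_par (sub_bangS _) (sub_refl _)) _; rewrite -/B; usub.
have r' := reliable_sub s' r.
have [ok z] := comm_usage (reliable_sub (sub_proj _ _) r') (sub_refl _).
split=> //; apply: sub_redz r s' _.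
have [X h t] := redz_par B z.
exists X => //; apply: sub_trans t (sub_parC _ _).
Qed.

(** Sender and receiver may present the shape of their common name differently, but channel shapes
    are related by [heq] alone. *)
Lemma hsub_HCh D K Sh Us K' Sh' Us' : hsub D (HCh K Sh Us) -> hsub D (HCh K' Sh' Us') ->
  heq (HCh K Sh Us) (HCh K' Sh' Us').
Proof. by case: D => // K0 Sh0 Us0 /heq_sym h1 h2; apply: heq_trans h1 h2. Qed.

Lemma vtyping_param P D u v k K Sh Us K' Sh' Us' L :
  heq (HCh K Sh Us) (HCh K' Sh' Us') ->
  vtyping P (scons k (Sh v) D) (scons k (Us v) u) L ->
  vtyping P (scons k (Sh' v) D) (scons k (Us' v) u) L.
Proof.
case=> _ h; apply: vtyping_mono; last exact: ksub_refl.
  move=> x; apply: (@scons_rel _ hsub) => i; last exact: hsub_refl.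
  by have [/heq_sym/heq_hsub] := h v i.
move=> x; apply: (@scons_rel _ sub) => i; last exact: sub_refl.
by have [] := h v i.
Qed.

(** Brings the successor branch of a match under [vtyping_inst], with an integer argument that
    carries no usage. *)
Lemma args_pred D e X Y : vetyping D (ESucc e) (HNat X Y) ->
  ele (Some 1) Y /\
  args D (fun=> V0) [:: e] (fun=> HNat (epred X) (epred Y)) (fun=> V0).
Proof.
case=> X' [Y' [ee [e1 e2]]]; split.
  by move: e2; clear; case: Y Y' => [Y|] [Y'|]; rewrite /ele /eadd /=; lia.
split=> [[|i] //= _|x].
  apply: vetyping_mono _ ee => [x|]; first exact: hsub_refl.
  rewrite /hsub; move: e1 e2; clear; case: X Y X' Y' => [X|] [Y|] [X'|] [Y'|];
    rewrite /ele /eadd /epred /=; lia.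
by rewrite /occ /=; case: ifP => _; [apply: sub_par0|apply: sub_refl].
Qed.

Lemma pstep_st P P' : pstep P P' -> forall D u K, vtyping P D u K -> (forall x, reliable (u x)) ->
  exists2 u', forall x, redz (u x) (u' x) & vtyping P' D u' K.
Proof.
elim=> {P P'} [n m a k P es Q P' ek eP|n m a k P es Q P' ek eP|P|P Q|e P Q Q' eQ
  |P P' R _ IH|P P' _ IH|m P P' _ IH|P P1 Q1 Q c1 _ IH c2] D u K.
- case=> w1 [w2 [L1 [L2 [s [w1' [L1' [s1 p k1]]] [w2' [L2' [s2 q k2]]] kk]]]] r.
  case: p => Kf [Sh [Us [c [p [K1 [h [sa sx hP k3]]]]]]].
  case: q => Kf' [Sh' [Us' [d [q1 [q2 [v [K2 [h' [sa' sx' ha hQ k4]]]]]]]]].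
  have eh := hsub_HCh h h'.
  have sa2 : sub (u a) (VPar (VAct DIn (vpt n) c (p a))
                             (VAct DOut (vpt m) d (VPar (q2 a) (q1 a)))).
    apply: sub_trans (s a) (sub_par _ _).
      by rewrite -(cadd_vpt0 n); apply: sub_trans (s1 a) (sub_vdelay (VIn (vpt n)) sa).
    by rewrite -(cadd_vpt0 m); apply: sub_trans (s2 a) (sub_vdelay (VIn (vpt m)) sa').
  have [ok z] := comm_usage (r a) sa2.
  (* The usages of both continuations and of the arguments, delayed by the actual time. At the
     subject this is a reduct of the old usage; elsewhere it is reached by subusage. *)
  exists (fun x => vdelay (VIn (vpt (maxn m n))) (VPar (p x) (VPar (q2 x) (q1 x)))).
    move=> x; case: (eqVneq x a) => [->//|xa]; apply: redz_sub.
    apply: sub_trans (s x) _.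
    apply: (@sub_trans _ (VPar (vdelay (VIn (vpt (maxn m n))) (p x))
       (vdelay (VIn (vpt (maxn m n))) (VPar (q1 x) (q2 x))))); last by rewrite /=; usub.
    apply: sub_par; [apply: sub_trans (s1 x) _|apply: sub_trans (s2 x) _].
      apply: sub_trans (sub_vdelay _ (sx x xa)) _.
      by rewrite umap_comp; apply: sub_umap => B; apply: okhalf_delay; case/andP: ok.
    apply: sub_trans (sub_vdelay _ (sx' x xa)) _.
    rewrite umap_comp; apply: sub_umap => B; rewrite maxnC.
    by apply: okhalf_delay; case/andP: ok.
  exists (fun x => VPar (p x) (VPar (q2 x) (q1 x))), (kmax K1 K2); split.
  + by move=> x; apply: sub_refl.
  + exists (fun x => VPar (p x) (q2 x)), q1, K1, K2; split=> // [x||].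
    * usub.
    * by subst k; apply: vtyping_inst ha eP (vtyping_param eh (hP v)).
    * exact: ksub_refl.
  + apply: ksub_trans kk; apply: ksub_trans (kmax_mono k1 k2).
    apply: ksub_trans (kmax_mono (kadd_mono n k3) (kadd_mono m k4)).
    by apply: kseq_le ok _; apply: emax_ler.
- case=> w1 [w2 [L1 [L2 [s [w1' [L1' [s1 p k1]]] [w2' [L2' [s2 q k2]]] kk]]]] r.
  case: p => Kf [Sh [Us [c [p [h [sa sx hP k3]]]]]].
  case: q => Kf' [Sh' [Us' [d [q1 [q2 [v [K2 [h' [sa' sx' ha hQ k4]]]]]]]]].
  have eh := hsub_HCh h h'.
  pose M := maxn m n.
  have sa2 : sub (u a) (VPar (VBang (VAct DIn (vpt n) c (p a)))
                             (VAct DOut (vpt m) d (VPar (q2 a) (q1 a)))).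
    apply: sub_trans (s a) (sub_par _ _).
      by rewrite -(cadd_vpt0 n); apply: sub_trans (s1 a) (sub_vdelay (VIn (vpt n)) sa).
    by rewrite -(cadd_vpt0 m); apply: sub_trans (s2 a) (sub_vdelay (VIn (vpt m)) sa').
  have [ok z] := call_usage (r a) sa2.
  (* The usage of the remaining server before its delay by n: the replicated action at its own name,
     delayed replicated usages at the others. *)
  pose w x := if x == a then VBang (VAct DIn (vpt 0) c (p a)) else vdelay c (VBang (p x)).
  exists (fun x => VPar (vdelay (VIn (vpt n)) (w x))
                        (vdelay (VIn (vpt M)) (VPar (p x) (VPar (q2 x) (q1 x))))).
    move=> x; rewrite /w; case: (eqVneq x a) => [->|xa].
      by rewrite [vdelay _ (VBang _)]/= -/(cadd (VIn (vpt n)) (vpt 0)) cadd_vpt0.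
    apply: redz_sub; apply: sub_trans (s x) _.
    apply: (@sub_trans _ (VPar (VPar (vdelay (VIn (vpt n)) (vdelay c (VBang (p x))))
       (vdelay (VIn (vpt M)) (p x)))
       (vdelay (VIn (vpt M)) (VPar (q1 x) (q2 x))))); last by rewrite /=; usub.
    apply: sub_par; [apply: sub_trans (s1 x) _|apply: sub_trans (s2 x) _].
      apply: sub_trans (sub_vdelay _ (sx x xa)) _.
      (* One copy of the replicated usage is split off for the new instance of the body. *)
      apply: sub_trans (sub_vdelay _ (sub_vdelay c (sub_bangS (p x)))) _.
      rewrite [X in sub X _]/=; apply: sub_par; first exact: sub_refl.
      by rewrite umap_comp; apply: sub_umap => B; apply: okhalf_delay; case/andP: ok.
    apply: sub_trans (sub_vdelay _ (sx' x xa)) _.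
    rewrite umap_comp; apply: sub_umap => B; rewrite /M maxnC.
    by apply: okhalf_delay; case/andP: ok.
  exists (fun x => vdelay (VIn (vpt n)) (w x)),
    (fun x => vdelay (VIn (vpt M)) (VPar (p x) (VPar (q2 x) (q1 x)))),
    (kadd (Some 0, Some 0) n), (kadd (kmax (Kf v) K2) M); split.
  + by move=> x; apply: sub_refl.
  + exists w, (Some 0, Some 0); split=> [x||]; [exact: sub_refl| |exact: ksub_refl].
    exists Kf, Sh, Us, c, p; split=> //; split=> // [|x xa].
      by rewrite /w eqxx; apply: sub_refl.
    by rewrite /w (negPf xa); apply: sub_refl.
  + exists (fun x => VPar (p x) (VPar (q2 x) (q1 x))), (kmax (Kf v) K2); split.
    * by move=> x; apply: sub_refl.
    * exists (fun x => VPar (p x) (q2 x)), q1, (Kf v), K2; split=> // [x||].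
      - usub.
      - by subst k; apply: vtyping_inst ha eP (vtyping_param eh (hP v)).
      - exact: ksub_refl.
    * exact: ksub_refl.
  + apply: ksub_trans kk; apply: ksub_trans (kmax_mono k1 k2).
    apply: ksub_trans (kmax_mono (kadd_mono n k3) (kadd_mono m k4)).
    by rewrite (proj1 eh) kmaxC [X in ksub (kmax (kadd X _) _)]kmaxC kmaxC; apply: kseq_ler ok.
(* The clause for a tick is the clause for the annotation 1, so nothing changes. *)
- case=> u1 [K1 [s p kk]] _; exists u; first by move=> x; apply/redz_sub/sub_refl.
  by exists u1, K1.
- case=> X [Y [K1 [[e1 e2] p _ kk]]] _; exists u; first by move=> x; apply/redz_sub/sub_refl.
  by apply: vtyping_mono_cost kk _; apply: p; move: e1; clear; elia.
- case=> X [Y [K1 [/args_pred[Y1 ha] _ q kk]]] _.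
  exists u; first by move=> x; apply/redz_sub/sub_refl.
  apply: vtyping_mono_cost kk _.
  by apply: vtyping_mono_usage (vtyping_inst ha eQ (q Y1)) => x; apply: sub_par0.
- case=> u1 [u2 [K1 [K2 [s p q kk]]]] r.
  have r1 x : reliable (u1 x) by apply: reliable_sub (sub_trans (s x) (sub_proj _ _)) (r x).
  have [u1' z p'] := IH _ _ _ p r1.
  exists (fun x => VPar (u1' x) (u2 x)).
    by move=> x; apply: sub_redz (r x) (s x) (redz_par _ (z x)).
  by exists u1', u2, K1, K2; split=> // x; apply: sub_refl.
- case=> T [U [K1 [cT rU p kk]]] r.
  have [|u1 z p'] := IH _ _ _ p; first by case=> [|x]; rewrite /scons /=.
  exists (fun x => u1 x.+1); first by move=> x; have := z x.+1; rewrite /scons /= subn1.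
  (* The bound name may itself have communicated; its reduct stays reliable. *)
  exists T, (u1 0), K1; split=> //; first exact: reliable_redz rU (z 0).
  by apply: vtyping_mono_usage p' => -[|x]; rewrite /scons /= ?subn1; apply: sub_refl.
- case=> u1 [K1 [s p kk]] r.
  have r1 x : reliable (u1 x) by apply: (@vdelay_rel m); apply: reliable_sub (s x) (r x).
  have [u1' z p'] := IH _ _ _ p r1.
  exists (fun x => vdelay (VIn (vpt m)) (u1' x)).
    by move=> x; apply: sub_redz (r x) (s x) (redz_vdelay _ (z x)).
  by exists u1', K1; split=> // x; apply: sub_refl.
- move=> /(pcong_st c1) p r; have [u' z q] := IH _ _ _ p r.
  by exists u' => //; apply/(pcong_st c2).
Qed.

Lemma vtyping_reachable P Q : reachable P Q -> forall D u K, vtyping P D u K -> (forall x, reliable (u x)) ->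
  exists2 u', forall x, reliable (u' x) & vtyping Q D u' K.
Proof.
elim=> {P Q} [P Q h|P|P R Q _ IH1 _ IH2] D u K p r.
- have [u' z q] := pstep_st h p r.
  by exists u' => // x; apply: reliable_redz (r x) (z x).
- by exists u.
- by have [u1 r1 p1] := IH1 _ _ _ p r; apply: IH2 p1 r1.
Qed.

Lemma vtyping_local_complexity P D u K : vtyping P D u K -> ele (Some (local_complexity P)) K.2.
Proof.
elim: P D u K => [|P IHP Q IHQ|a k P _|a k P _|a es P _|P IH|P _|e P _ Q _|m P IH] D u [K0 K];
  try by case: K.
- case=> u1 [u2 [K1 [K2 [_ /IHP p /IHQ q /andP[_ kk]]]]].
  exact: ele_trans (ele_max p q) kk.
- by case=> T [U [K1 [_ _ /IH p /andP[_ kk]]]]; apply: ele_trans p kk.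
- case=> u1 [K1 [_ /IH p /andP[_ kk]]].
  apply: ele_trans kk; rewrite [local_complexity _]/= addnC.
  exact: ele_add p (ele_refl (Some m)).
Qed.

(** * The lower bound *)

(* [kinded P k]: only names x with [k x] are subjects of communications. This is
   not a consequence of [vtyping], which ignores the dead branches of matches. *)
Fixpoint kinded (P : proc) (k : nat -> bool) : bool :=
  match P with
  | PZero => true
  | PPar P Q => kinded P k && kinded Q k
  | PServ a n P | PIn a n P => k a && kinded P (scons n xpredT k)
  | POut a _ P => k a && kinded P k
  | PNu P => kinded P (scons 1 xpredT k)
  | PMatch _ P Q => kinded P k && kinded Q (scons 1 xpred0 k)
  | PTick P | PAnnot _ P => kinded P k
  end.

Lemma scons_impl n (f f' g g' : nat -> bool) :
  (forall x, f x -> f' x) -> (forall x, g x -> g' x) ->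
  forall x, scons n f g x -> scons n f' g' x.
Proof. exact: (@scons_rel _ (fun b c : bool => b -> c)). Qed.

Lemma kinded_mono P (k k' : nat -> bool) : (forall x, k x -> k' x) -> kinded P k -> kinded P k'.
Proof.
elim: P k k' => [|P IHP Q IHQ|a n P IH|a n P IH|a es P IH|P IH|P IH|e P IHP Q IHQ|m P IH]
  k k' h //=.
- by case/andP=> /(IHP _ _ h) -> /(IHQ _ _ h).
- by case/andP=> /h -> /=; apply: IH; apply: scons_impl.
- by case/andP=> /h -> /=; apply: IH; apply: scons_impl.
- by case/andP=> /h -> /=; apply: IH.
- by apply: IH; apply: scons_impl.
- exact: IH.
- by case/andP=> /(IHP _ _ h) -> /=; apply: IHQ; apply: scons_impl.
- exact: IH.
Qed.

Lemma kinded_up n f s (k k' : nat -> bool) :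
  (forall x, k x -> exists2 y, s x = EVar y & k' y) ->
  forall x, scons n f k x -> exists2 y, upsub n s x = EVar y & scons n f k' y.
Proof.
move=> h x; rewrite /upsub {1}/scons; case: (ltnP x n) => xn.
  by exists x => //; rewrite /scons xn.
case/h=> y -> ky; exists (n + y) => //.
by rewrite /scons ltnNge leq_addr addKn.
Qed.

Fixpoint psize (P : proc) : nat :=
  match P with
  | PZero => 1
  | PPar P Q | PMatch _ P Q => (psize P + psize Q).+1
  | PServ _ _ P | PIn _ _ P | POut _ _ P | PNu P | PTick P | PAnnot _ P => (psize P).+1
  end.

(** Kinds guarantee that the substitution is defined even in dead branches. Preservation of size
    serves the induction in [vtyping_lower_bound]. *)
Lemma kinded_subst P s (k k' : nat -> bool) :
  (forall x, k x -> exists2 y, s x = EVar y & k' y) -> kinded P k ->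
  exists P', [/\ psubst s P = Some P', kinded P' k' & psize P' = psize P].
Proof.
elim: P s k k' => [|P IHP Q IHQ|a n P IH|a n P IH|a es P IH|P IH|P IH|e P IHP Q IHQ|m P IH]
  s k k' h /=.
- by exists PZero.
- case/andP=> /(IHP _ _ _ h)[P' [-> p ep]] /(IHQ _ _ _ h)[Q' [-> q eq]].
  by eexists; split; [reflexivity|rewrite /= p q|rewrite /= ep eq].
- case/andP=> /h[b -> kb] /(IH _ _ _ (kinded_up h))[P' [-> p ep]].
  by eexists; split; [reflexivity|rewrite /= kb p|rewrite /= ep].
- case/andP=> /h[b -> kb] /(IH _ _ _ (kinded_up h))[P' [-> p ep]].
  by eexists; split; [reflexivity|rewrite /= kb p|rewrite /= ep].
- case/andP=> /h[b -> kb] /(IH _ _ _ h)[P' [-> p ep]].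
  by eexists; split; [reflexivity|rewrite /= kb p|rewrite /= ep].
- case/(IH _ _ _ (kinded_up h))=> P' [-> p ep].
  by eexists; split; [reflexivity|rewrite /= p|rewrite /= ep].
- case/(IH _ _ _ h)=> P' [-> p ep].
  by eexists; split; [reflexivity|rewrite /= p|rewrite /= ep].
- case/andP=> /(IHP _ _ _ h)[P' [-> p ep]] /(IHQ _ _ _ (kinded_up h))[Q' [-> q eq]].
  by eexists; split; [reflexivity|rewrite /= p q|rewrite /= ep eq].
- case/(IH _ _ _ h)=> P' [-> p ep].
  by eexists; split; [reflexivity|rewrite /= p|rewrite /= ep].
Qed.

Lemma reachable_ctx (f : proc -> proc) P Q :
  (forall P Q, pstep P Q -> pstep (f P) (f Q)) -> reachable P Q -> reachable (f P) (f Q).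
Proof.
move=> h; elim=> {P Q} [P Q s|P|P R Q _ IH1 _ IH2].
- by constructor; apply: h.
- exact: Relation_Operators.rt_refl.
- exact: Relation_Operators.rt_trans IH1 IH2.
Qed.

Lemma pstep_parr R P P' : pstep P P' -> pstep (PPar R P) (PPar R P').
Proof.
by move=> s; apply: pstep_cong (pcong_parC _ _) (pstep_par R s) (pcong_parC _ _).
Qed.

Lemma reachable_step P P' Q : pstep P P' -> reachable P' Q -> reachable P Q.
Proof. by move=> s; apply: Relation_Operators.rt_trans; constructor. Qed.

(* Ticks and matches alone, a terminating part of the reduction, already
   realise the lower bound. *)
Lemma vtyping_lower_bound P D u K : (forall x, is_ch (D x)) -> kinded P xpredT -> vtyping P D u K ->
  exists2 Q, reachable P Q & ele K.1 (Some (local_complexity Q)).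
Proof.
(* Induction on size, since the successor branch is instantiated before the hypothesis is applied to
   it. *)
move: {2}(psize P) (leqnn (psize P)) => N.
elim: N P D u K => [|N IH] [|P Q|a n P|a n P|a es P|P|P|e P Q|m P] D u K //=; rewrite ltnS => sz cD.
- by move=> _ /andP[h _]; exists PZero => //; apply: Relation_Operators.rt_refl.
- case/andP=> kP kQ [u1 [u2 [K1 [K2 [_ p q /andP[kk _]]]]]].
  have szP : psize P <= N by lia.
  have szQ : psize Q <= N by lia.
  have [P' rP hP] := IH _ _ _ _ szP cD kP p; have [Q' rQ hQ] := IH _ _ _ _ szQ cD kQ q.
  exists (PPar P' Q'); last exact: ele_trans kk (ele_max hP hQ).
  apply: (@Relation_Operators.rt_trans _ _ _ (PPar P' Q)).
    by apply: (@reachable_ctx (PPar^~ Q)) rP => *; apply: pstep_par.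
  by apply: reachable_ctx rQ => *; apply: pstep_parr.
- move=> _ [? [? [? [? [? [_ [_ _ _ /andP[kk _]]]]]]]].
  by eexists; [apply: Relation_Operators.rt_refl|].
(* Prefixes are left as they are: the lower end of [kseq] is 0. *)
- move=> _ [? [? [? [c [? [? [_ [_ _ _ /andP[kk _]]]]]]]]].
  eexists; first exact: Relation_Operators.rt_refl.
  by apply: ele_trans kk _; case: c.
- move=> _ [? [? [? [c [? [? [? [? [_ [_ _ _ _ /andP[kk _]]]]]]]]]]].
  eexists; first exact: Relation_Operators.rt_refl.
  by apply: ele_trans kk _; case: c.
- move=> kP [T [U [K1 [cT _ p /andP[kk _]]]]].
  have [||P' rP hP] := IH _ _ _ _ sz _ _ p.
  + by move=> x; rewrite /scons; case: ifP.
  + by apply: kinded_mono kP => x.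
  exists (PNu P'); last exact: ele_trans kk hP.
  by apply: reachable_ctx rP => *; apply: pstep_nu.
- move=> kP [u1 [K1 [_ p /andP[kk _]]]].
  have [P' rP hP] := IH _ _ _ _ sz cD kP p.
  exists (PAnnot 1 P').
    apply: reachable_step (pstep_tick P) _.
    by apply: reachable_ctx rP => *; apply: pstep_annot.
  by apply: ele_trans kk _; rewrite [local_complexity _]/= addnC;
    apply: ele_add hP (ele_refl (Some 1)).
- case/andP=> kP kQ [X [Y [K1 [ee p q /andP[kk _]]]]].
  have szP : psize P <= N by lia.
  have szQ : psize Q <= N by lia.
  case: e ee => [x||e] /=.
  (* A free variable has a channel shape, so it cannot be matched on. *)
  + by have := cD x; case: (D x).
  + case=> e1 _; have X0 : X = Some 0 by case: X {p q} e1 => [[|X]|].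
    have [P' rP hP] := IH _ _ _ _ szP cD kP (p X0).
    exists P'; last exact: ele_trans kk hP.
    exact: reachable_step (pstep_match0 P Q) rP.
  move=> /args_pred[Y1 ha].
  (* Index 0, the predecessor, is never a subject, so it may be replaced by a non-name. *)
  have h x : scons 1 xpred0 xpredT x ->
      exists2 y, nth (EVar (x - size [:: e])) [:: e] x = EVar y & xpredT y.
    by case: x => [|x] //= _; exists x; rewrite // nth_nil subn1.
  have [Q' [eQ kQ' szQ']] := kinded_subst h kQ.
  have [||Q'' rQ hQ] := IH _ _ _ _ _ cD _ (vtyping_inst ha eQ (q Y1)) => //.
    by rewrite szQ'.
  exists Q''; last exact: ele_trans kk hQ.
  exact: reachable_step (pstep_matchS P eQ) rQ.
- move=> kP [u1 [K1 [_ p /andP[kk _]]]].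
  have [P' rP hP] := IH _ _ _ _ sz cD kP p.
  exists (PAnnot m P').
    by apply: reachable_ctx rP => *; apply: pstep_annot.
  by apply: ele_trans kk _; rewrite [local_complexity _]/= addnC;
    apply: ele_add hP (ele_refl (Some m)).
Qed.

(** * Interpretation of indices and usages *)

Definition iwf S (r : valuation) (A : itv S) : bool := ele (ieval r A.1) (ieval r A.2).

Definition cwf S (r : valuation) (c : cap S) : bool :=
  if c is CapItv A then iwf r A else true.

Lemma ele_norm x y :
  ele (if ele x y then x else Some 0) (if ele x y then y else Some 0).
Proof. by case: ifP. Qed.

(* The value of an interval that is empty under r is junk. *)
Definition itval S (r : valuation) (A : itv S) : vitv :=
  locked (VItv (ele_norm (ieval r A.1) (ieval r A.2))).

Definition capval S (r : valuation) (c : cap S) : vcap :=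
  match c with
  | CapLe J => VLe (ieval r J)
  | CapItv A => VIn (itval r A)
  end.

Definition kval S (r : valuation) (K : itv S) : enat * enat := (ieval r K.1, ieval r K.2).

Fixpoint uval S (r : valuation) (U : usage S) : vusage :=
  match U with
  | U0 => V0
  | UPar U V => VPar (uval r U) (uval r V)
  | UAct d A c U => VAct d (itval r A) (capval r c) (uval r U)
  | UBang U => VBang (uval r U)
  | UPlus U V => VPlus (uval r U) (uval r V)
  end.

Fixpoint uwf S (r : valuation) (U : usage S) : bool :=
  match U with
  | U0 => true
  | UPar U V | UPlus U V => uwf r U && uwf r V
  | UAct _ A c U => [&& iwf r A, cwf r c & uwf r U]
  | UBang U => uwf r U
  end.

Lemma lo_itval S r (A : itv S) : iwf r A -> lo (itval r A) = ieval r A.1.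
Proof. by rewrite /iwf /itval -lock /= => ->. Qed.

Lemma hi_itval S r (A : itv S) : iwf r A -> hi (itval r A) = ieval r A.2.
Proof. by rewrite /iwf /itval -lock /= => ->. Qed.

Lemma ieval_add S r (I J : idx S) : ieval r (iadd I J) = eadd (ieval r I) (ieval r J).
Proof. by case: I J => [t|] [u|]. Qed.

Lemma ieval_max S r (I J : idx S) : ieval r (imax I J) = emax (ieval r I) (ieval r J).
Proof. by case: I J => [t|] [u|] //=; rewrite /emax maxnE. Qed.

Lemma ieval_pred S r (I : idx S) : ieval r (ipred I) = epred (ieval r I).
Proof. by case: I => //= t; rewrite subn1. Qed.

Lemma iwf_pt S r n : iwf r (@pt S n).
Proof. exact: leqnn. Qed.

Lemma itval_pt S r n : itval r (@pt S n) = vpt n.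
Proof. by apply: vitv_eq; rewrite ?lo_itval ?hi_itval ?iwf_pt. Qed.

Lemma iwf_add S r (A B : itv S) : iwf r A -> iwf r B -> iwf r (itv_add A B).
Proof. by rewrite /iwf /= !ieval_add; apply: ele_add. Qed.

Lemma iwf_max S r (A B : itv S) : iwf r A -> iwf r B -> iwf r (itv_max A B).
Proof. by rewrite /iwf /= !ieval_max; apply: ele_max. Qed.

Lemma iwf_cap_add S r (c : cap S) B : cwf r c -> iwf r B -> iwf r (cap_add c B).
Proof.
case: c => [J|A] /=; last exact: iwf_add.
by move=> _ wB; rewrite /iwf /= ieval_add; apply: ele_addl.
Qed.

Lemma iwf_addc S r (c : cap S) B : cwf r c -> iwf r B -> iwf r (itv_addc B c).
Proof.
case: c => [J|A] /= wc wB; last exact: iwf_add.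
rewrite /iwf /= ieval_add; apply: ele_trans wB _.
by case: (ieval r B.2) (ieval r J) => [x|] [y|] //; apply: leq_addr.
Qed.

Lemma itval_add S r (A B : itv S) : iwf r A -> iwf r B ->
  itval r (itv_add A B) = vadd (itval r A) (itval r B).
Proof.
move=> wA wB; have w := iwf_add wA wB.
by apply: vitv_eq; rewrite /= 3?lo_itval 3?hi_itval //= ieval_add.
Qed.

Lemma itval_max S r (A B : itv S) : iwf r A -> iwf r B ->
  itval r (itv_max A B) = vmax (itval r A) (itval r B).
Proof.
move=> wA wB; have w := iwf_max wA wB.
by apply: vitv_eq; rewrite /= 3?lo_itval 3?hi_itval //= ieval_max.
Qed.

Lemma eaddC x y : eadd x y = eadd y x.
Proof. by case: x y => [x|] [y|] //; rewrite /eadd addnC. Qed.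

Lemma itval_cap_add S r (c : cap S) B : cwf r c -> iwf r B ->
  itval r (cap_add c B) = cadd (capval r c) (itval r B).
Proof.
move=> wc wB; have := iwf_cap_add wc wB.
case: c wc => [J|A] /= wc w; last by rewrite itval_add.
by apply: vitv_eq; rewrite /= 3?lo_itval 3?hi_itval //= ieval_add.
Qed.

Lemma itval_addc S r (c : cap S) A : cwf r c -> iwf r A ->
  itval r (itv_addc A c) = addc (itval r A) (capval r c).
Proof.
move=> wc wB; have := iwf_addc wc wB.
case: c wc => [J|C] /= wc w; last by rewrite itval_add.
by apply: vitv_eq; rewrite /= 3?lo_itval 3?hi_itval //= ieval_add eaddC.
Qed.

Lemma uwf_delay S r (c : cap S) U : cwf r c -> uwf r U -> uwf r (udelay c U).
Proof.
move=> wc; elim: U => //= [U IHU V IHV|d A e U _|U IHU V IHV].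
- by case/andP=> /IHU -> /IHV ->.
- by case/and3P=> wA -> ->; rewrite iwf_cap_add.
- by case/andP=> /IHU -> /IHV ->.
Qed.

Lemma uval_delay S r (c : cap S) U : cwf r c -> uwf r U ->
  uval r (udelay c U) = vdelay (capval r c) (uval r U).
Proof.
move=> wc; elim: U => //= [U IHU V IHV|d A e U _|U IHU|U IHU V IHV].
- by case/andP=> /IHU -> /IHV ->.
- by case/and3P=> wA _ _; rewrite itval_cap_add.
- by move/IHU ->.
- by case/andP=> /IHU -> /IHV ->.
Qed.

Lemma wf_itv_val S r phi Phi (A : itv S) : all (csat r) Phi -> wf_itv phi Phi A -> iwf r A.
Proof. by move=> s [_ _ /(_ r s)]. Qed.

Lemma wf_cap_val S r phi Phi (c : cap S) : all (csat r) Phi -> wf_cap phi Phi c -> cwf r c.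
Proof. by case: c => [J|A] //= s; apply: wf_itv_val. Qed.

Lemma wf_usage_val S r phi Phi (U : usage S) :
  all (csat r) Phi -> wf_usage phi Phi U -> uwf r U.
Proof.
move=> s; elim: U => //= [U IHU V IHV|d A c U IHU|U IHU V IHV].
- by case=> /IHU -> /IHV ->.
- by case=> /(wf_itv_val s) -> /(wf_cap_val s) -> /IHU ->.
- by case=> /IHU -> /IHV ->.
Qed.

Lemma ucong_uwf S r (U V : usage S) : ucong U V -> uwf r U = uwf r V.
Proof.
elim=> {U V} //= *; try congruence.
- by rewrite andbT.
- exact: andbC.
- exact: andbA.
- by rewrite andbb.
Qed.

Lemma ucong_sub S r (U V : usage S) : ucong U V ->
  sub (uval r U) (uval r V) /\ sub (uval r V) (uval r U).
Proof.
elim=> {U V} /= [U|U V _ []|U V W _ [a b] _ [c d]|U U' V V' _ [a b] _ [c d]|d A c U U' _ [a b]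
  |U U' _ [a b]|U U' V V' _ [a b] _ [c d]|U|U V|U V W||U|U V|U]; try by [].
- by split; apply: sub_refl.
- by split; [apply: sub_trans a c|apply: sub_trans d b].
- by split; apply: sub_par.
- by split; apply: sub_act => //; rewrite ?vsub_refl ?csub_refl.
- by split; apply: sub_bang.
- by split; apply: sub_plus.
- by split; [apply: sub_proj|apply: sub_par0].
- by split; apply: sub_parC.
- by split; [apply: sub_parA|apply: sub_parAr].
- by split; [apply: sub_zero|apply: sub_bang0].
- by split; [apply: sub_bangS|apply: sub_proj].
- split; last exact: sub_bangP.
  (* Replication can be duplicated: !W becomes !!W, which unfolds to !!W | !W, and !!W yields !W
     again. *)
  have h W : sub (VBang W) (VPar (VBang W) (VBang W)).
    apply: sub_trans (sub_bangB _) _; apply: sub_trans (sub_bangS _) _.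
    apply: sub_par (sub_refl _); apply: sub_trans (sub_bangS _) _; exact: sub_projr.
  by apply: sub_trans (h _) (sub_par (sub_bang _) (sub_bang _));
    [apply: sub_proj|apply: sub_projr].
- by split; [apply: sub_trans (sub_bangS _) (sub_projr _ _)|apply: sub_bangB].
Qed.

(** Values of empty intervals are junk, so both usages must be well formed at r; the side condition
    of [subu_trans] supplies this for the middle one. *)
Lemma subu_sub S r phi Phi (U V : usage S) : all (csat r) Phi -> subu phi Phi U V ->
  uwf r U -> uwf r V -> sub (uval r U) (uval r V).
Proof.
move=> s; elim=> {U V} /= [U|U V|U V|U U' V _ IH|U U' V _ IH|U U' V _ IH|U U' _ IH|d A c U U' _ IH
  |U U1 V1 V c1 _ IH c2|U V W _ IH1 wV _ IH2|d A B X Y U sBA sXY|d A c U V].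
- by move=> *; apply: sub_zero.
- by move=> *; apply: sub_plusl.
- by move=> *; apply: sub_plusr.
- by case/andP=> wU _ /andP[wU' _]; apply: sub_plus (IH wU wU') (sub_refl _).
- by case/andP=> _ wU /andP[_ wU']; apply: sub_plus (sub_refl _) (IH wU wU').
- by case/andP=> wU _ /andP[wU' _]; apply: sub_par (IH wU wU') (sub_refl _).
- by move=> wU wU'; apply: sub_bang (IH wU wU').
- case/and3P=> _ _ wU /and3P[_ _ wU'].
  exact: sub_act (vsub_refl _) (csub_refl _) (IH wU wU').
- rewrite (ucong_uwf r c1) -(ucong_uwf r c2) => w w'.
  exact: sub_trans (proj1 (ucong_sub r c1)) (sub_trans (IH w w') (proj1 (ucong_sub r c2))).
- by move=> wU wW; have w := wf_usage_val s wV; apply: sub_trans (IH1 wU w) (IH2 w wW).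
- case/and3P=> wA wX _ /and3P[wB wY _]; apply: sub_act (sub_refl _).
    rewrite /vsub !lo_itval ?hi_itval //; have [h1 h2] := sBA.
    by apply/andP; split; [apply: (h1 r s)|apply: (h2 r s)].
  case: X Y sXY wX wY => [X|X] [Y|Y] /= h wX wY.
  + exact: (h r s).
  (* For this pair of capacities [cap_sub] holds only if [Phi] is unsatisfiable. *)
  + by have := h r; rewrite s.
  + by rewrite hi_itval //; apply: (h r s).
  + rewrite /vsub !lo_itval ?hi_itval //; have [h1 h2] := h.
    by apply/andP; split; [apply: (h1 r s)|apply: (h2 r s)].
- case/andP=> _ _ /and3P[wA wc /andP[_ wV]].
  rewrite uval_delay //=; last exact: iwf_addc.
  rewrite itval_addc //; exact: sub_delay.
Qed.

(** ** Reliability *)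

Section Reliability.
Variables (S : fsig) (Phi : seq (constr S)) (r : valuation).
Hypothesis s : all (csat r) Phi.

(** The final congruence makes the relation contain congruence even when no reduction takes place;
    it does not affect errors, by [ured_cong_err]. *)
Definition usteps (U V : usage S) : Prop := exists2 V',
  Relation_Operators.clos_refl_trans (usage S) (fun U1 U2 => ured Phi U1 (Some U2)) U V' &
  ucong V' V.

Lemma usteps_cong U V : ucong U V -> usteps U V.
Proof. by exists U; first exact: Relation_Operators.rt_refl. Qed.

Lemma usteps_step U V : ured Phi U (Some V) -> usteps U V.
Proof. by exists V; [apply: Relation_Operators.rt_step|apply: ucong_refl]. Qed.

Lemma ucong_usteps U V W : ucong U V ->
  Relation_Operators.clos_refl_trans (usage S) (fun U1 U2 => ured Phi U1 (Some U2)) V W ->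
  usteps U W.
Proof.
move=> c /Operators_Properties.clos_rt_rt1n_iff; case.
  exact: usteps_cong.
move=> Y Z h /Operators_Properties.clos_rt_rt1n_iff t; exists Z; last exact: ucong_refl.
apply: Relation_Operators.rt_trans t; apply: Relation_Operators.rt_step.
exact: ured_cong c h (ucong_refl _).
Qed.

Lemma usteps_trans U V W : usteps U V -> usteps V W -> usteps U W.
Proof.
case=> V' t c [W' t' c']; have [W'' t'' c''] := ucong_usteps c t'.
exists W''; last exact: ucong_trans c'' c'.
exact: Relation_Operators.rt_trans t t''.
Qed.

Lemma usteps_par U U' V : usteps U U' -> usteps (UPar U V) (UPar U' V).
Proof.
case=> X t c; exists (UPar X V); last exact: ucong_par c (ucong_refl _).
elim: t {c} => [Y Z h|Y|Y Z W _ IH1 _ IH2].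
- by apply: Relation_Operators.rt_step; apply: ured_par.
- exact: Relation_Operators.rt_refl.
- exact: Relation_Operators.rt_trans IH1 IH2.
Qed.

Lemma ureliable_usteps U V : ureliable Phi U -> usteps U V -> ureliable Phi V.
Proof.
move=> rU [V' t c] W /(ucong_usteps c)[W' t' c'] e.
apply: (rU W'); first exact: Relation_Operators.rt_trans t t'.
exact: ured_cong_err c' e.
Qed.

(** The syntactic usage can follow an extraction: unfolding is congruence, and resolving a choice is
    a reduction. Reliability is thus kept along the way. *)
Lemma ext_uval U d A c U1 W : uwf r U -> ext (uval r U) d A c U1 W ->
  exists A' c' U1' W',
    [/\ usteps U (UPar (UAct d A' c' U1') W'), uwf r (UPar (UAct d A' c' U1') W'),
        A = itval r A', c = capval r c' & U1 = uval r U1' /\ W = uval r W'].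
Proof.
elim: U d A c U1 W => /= [|U IHU V IHV|d A c U _|U IH|U IHU V IHV] d' A' c' U1 W.
- by move=> _ x; inversion x.
- case/andP=> wU wV /ext_parE[] [X -> x].
    have [B [e [U2 [Y [t w -> -> [-> ->]]]]]] := IHU _ _ _ _ _ wU x.
    exists B, e, U2, (UPar Y V); split=> //=.
      by apply: usteps_trans (usteps_par V t) (usteps_cong (ucong_sym (ucong_parA _ _ _))).
    by rewrite /= andbA w.
  have [B [e [U2 [Y [t w -> -> [-> ->]]]]]] := IHV _ _ _ _ _ wV x.
  exists B, e, U2, (UPar U Y); split=> //=.
    apply: usteps_trans (usteps_cong (ucong_parC _ _)) _.
    apply: usteps_trans (usteps_par U t) (usteps_cong _).
    apply: ucong_trans (ucong_sym (ucong_parA _ _ _)) _.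
    exact: ucong_par (ucong_refl _) (ucong_parC _ _).
  by move: w; rewrite /= wU; case: (uwf r Y); rewrite ?andbT ?andbF.
- move=> w x; inversion x; subst; exists A, c, U, U0; split=> //=; last by rewrite w.
  exact/usteps_cong/ucong_sym/ucong_par0.
- move=> w /ext_bangE[X -> x].
  have [B [e [U2 [Y [t w' -> -> [-> ->]]]]]] := IH _ _ _ _ _ w x.
  exists B, e, U2, (UPar (UBang U) Y); split=> //=; last first.
    by move: w'; rewrite /= w; case: (uwf r Y); rewrite ?andbT ?andbF.
  apply: usteps_trans (usteps_cong (ucong_trans (ucong_bangS _) (ucong_parC _ _))) _.
  apply: usteps_trans (usteps_par _ t) (usteps_cong _).
  apply: ucong_trans (ucong_sym (ucong_parA _ _ _)) _.
  exact: ucong_par (ucong_refl _) (ucong_parC _ _).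
- case/andP=> wU wV /ext_plusE[] x.
    have [B [e [U2 [Y [t w -> -> [-> ->]]]]]] := IHU _ _ _ _ _ wU x.
    exists B, e, U2, Y; split=> //.
    exact: usteps_trans (usteps_step (ured_plusl _ _ _)) t.
  have [B [e [U2 [Y [t w -> -> [-> ->]]]]]] := IHV _ _ _ _ _ wV x.
  exists B, e, U2, Y; split=> //.
  exact: usteps_trans (usteps_step (ured_plusr _ _ _)) t.
Qed.

Lemma itv_sub_okhalf A c B : iwf r A -> cwf r c -> iwf r B -> itv_sub Phi B (oplus A c) ->
  okhalf (itval r A) (capval r c) (itval r B).
Proof.
case: c => [J|C] /= wA wc wB [/(_ r s) h1 /(_ r s) h2];
  rewrite ?lo_itval ?hi_itval //; move: h1 h2; rewrite /csat /= !ieval_add //.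
by move=> h1 h2; apply/andP.
Qed.

Lemma comm_of_uval U b V : ureliable Phi U -> uwf r U -> comm_of (uval r U) b V ->
  b /\ exists U', [/\ ureliable Phi U', uwf r U' & V = uval r U'].
Proof.
move=> rU wU h; move: {1 2}(uval r U) h (erefl (uval r U)) => X h.
case: h => A c U1 B e V1 W Y x y eX; rewrite eX in x.
have [A' [c' [U2 [W' [t w ? ? [? ?]]]]]] := ext_uval wU x; subst.
case/andP: w => /and3P[wA wc wU2] wW.
have [B' [e' [V2 [Y' [t' w' ? ? [? ?]]]]]] := ext_uval wW y; subst.
case/andP: w' => /and3P[wB we wV2] wY.
have {}wY : uwf r Y' := wY.
have t2 : usteps U (UPar (UPar (UAct DIn A' c' U2) (UAct DOut B' e' V2)) Y').
  apply: usteps_trans t _.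
  apply: usteps_trans (usteps_cong (ucong_parC _ _)) _.
  apply: usteps_trans (usteps_par _ t') (usteps_cong _).
  apply: ucong_trans (ucong_parC _ _) _; exact: ucong_parA.
have r2 := ureliable_usteps rU t2.
have ok : comm_ok Phi A' c' B' e'.
  (* [comm_ok] quantifies over all valuations, so it is not decided at r; classically, its failure
     would be a reachable error. *)
  apply: NNPP => no; apply: (r2 _ (Relation_Operators.rt_refl _ _ _)).
  by apply: ured_par_err; apply: ured_err.
split.
  by case: ok => o1 o2; apply/andP; split; apply: itv_sub_okhalf.
exists (UPar (udelay (CapItv (itv_max A' B')) (UPar U2 V2)) Y'); split.
- apply: ureliable_usteps r2 (usteps_step _); apply: ured_par; exact: ured_comm.
- by rewrite /= wY andbT !uwf_delay //=; apply: iwf_max.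
- by rewrite [RHS]/= !uval_delay ?itval_max //=; try exact: iwf_max; rewrite itval_max.
Qed.

Lemma ureliable_rel U : ureliable Phi U -> uwf r U -> reliable (uval r U).
Proof.
move=> rU wU V t; move: {1 2}(uval r U) t (erefl (uval r U)) => X t.
elim: t U rU wU => {X V} [X|X Y Z h _ IH] U rU wU e; subst.
  by case=> V v; case: (comm_of_uval rU wU v).
have [_ [U' [rU' wU' eY]]] := comm_of_uval rU wU h.
exact: IH rU' wU' eY.
Qed.

End Reliability.

(** * Interpretation of types *)

(** A channel shape, so that [shapes_chan] also holds at indices beyond the context. *)
Definition dshape : shape :=
  HCh (fun=> (Some 0, Some 0)) (fun _ _ => HNat (Some 0) (Some 0)) (fun _ _ => V0).

Definition usage_of S (r : valuation) (T : ty S) : vusage :=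
  match T with
  | TNat _ _ => V0
  | TCh _ U | TServ _ _ _ U => uval r U
  end.

(** The cost (0, 0) given to a channel is neutral for [kmax], so that one output clause of [vtyping]
    serves channels and servers. *)
Fixpoint shape_of S (r : valuation) (T : ty S) : shape :=
  match T with
  | TNat X Y => HNat (ieval r X) (ieval r Y)
  | TCh Ts _ => HCh (fun=> (Some 0, Some 0)) (fun=> nth dshape (map (shape_of r) Ts))
      (fun=> nth V0 (map (usage_of r) Ts))
  | TServ k K Ts _ => HCh (fun v => kval (scons k v r) K)
      (fun v => nth dshape (map (shape_of (scons k v r)) Ts))
      (fun v => nth V0 (map (usage_of (scons k v r)) Ts))
  end.

(* Variables that are not declared are read as channels without usage. *)
Definition shapes S (r : valuation) (G : ctx S) : nat -> shape :=
  nth dshape (map (shape_of r) G).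

Definition usages S (r : valuation) (G : ctx S) : nat -> vusage :=
  nth V0 (map (usage_of r) G).

Inductive twf S : valuation -> ty S -> Prop :=
| twf_nat r X Y : twf r (TNat X Y)
| twf_ch r Ts U : (forall T, List.In T Ts -> twf r T) -> uwf r U -> twf r (TCh Ts U)
| twf_serv r k K Ts U : (forall v T, List.In T Ts -> twf (scons k v r) T) -> uwf r U ->
    twf r (TServ k K Ts U).

Definition gwf S (r : valuation) (G : ctx S) : Prop := forall T, List.In T G -> twf r T.

(** * Index substitution as change of valuation *)

Lemma teval_subst S r s (t : tidx S) :
  teval r (tsubst s t) = teval (fun i => teval r (s i)) t.
Proof.
elim: t => //= [t -> u ->|t -> u ->|t -> u ->|f args IH] //.
by congr finterp; apply/ffunP => i; rewrite !ffunE.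
Qed.

Lemma ieval_subst S r s (I : idx S) :
  ieval r (isubst s I) = ieval (fun i => teval r (s i)) I.
Proof. by case: I => //= t; rewrite teval_subst. Qed.

Lemma scons_shift k v (r : valuation) : (fun i => scons k v r (k + i)) = r.
Proof.
by apply: functional_extensionality => i; rewrite /scons ltnNge leq_addr addKn.
Qed.

Lemma csat_shift S k v r (c : constr S) :
  csat (scons k v r) (csubst (ishift k) c) = csat r c.
Proof. by case: c => I R J; rewrite /csat /= !ieval_subst /= scons_shift. Qed.

Lemma all_csat_shift S k v r (Phi : seq (constr S)) :
  all (csat r) Phi -> all (csat (scons k v r)) (map (csubst (ishift k)) Phi).
Proof. by rewrite all_map => h; apply: sub_all h => c /=; rewrite csat_shift. Qed.

Lemma teval_iup S k v (r : valuation) (s : nat -> tidx S) :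
  (fun i => teval (scons k v r) (iup k s i)) = scons k v (fun i => teval r (s i)).
Proof.
apply: functional_extensionality => i; rewrite /iup {2}/scons; case: ifP => ik /=.
  by rewrite /scons ik.
by rewrite teval_subst /= scons_shift.
Qed.

Lemma iwf_subst S r s (A : itv S) : iwf r (itv_subst s A) = iwf (fun i => teval r (s i)) A.
Proof. by rewrite /iwf /= !ieval_subst. Qed.

Lemma itval_subst S r s (A : itv S) :
  itval r (itv_subst s A) = itval (fun i => teval r (s i)) A.
Proof. by apply: vitv_eq; rewrite /itval -!lock /= !ieval_subst. Qed.

Lemma capval_subst S r s (c : cap S) :
  capval r (cap_subst s c) = capval (fun i => teval r (s i)) c.
Proof. by case: c => [J|A] /=; rewrite ?ieval_subst ?itval_subst. Qed.

Lemma cwf_subst S r s (c : cap S) : cwf r (cap_subst s c) = cwf (fun i => teval r (s i)) c.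
Proof. by case: c => [J|A] //=; rewrite iwf_subst. Qed.

Lemma uval_subst S r s (U : usage S) :
  uval r (usubst s U) = uval (fun i => teval r (s i)) U.
Proof.
by elim: U => //= [U -> V ->|d A c U ->|U ->|U -> V ->] //; rewrite itval_subst capval_subst.
Qed.

Lemma uwf_subst S r s (U : usage S) : uwf r (usubst s U) = uwf (fun i => teval r (s i)) U.
Proof.
by elim: U => //= [U -> V ->|d A c U ->|U -> V ->] //; rewrite iwf_subst cwf_subst.
Qed.

Lemma kval_subst S r s (K : itv S) : kval r (itv_subst s K) = kval (fun i => teval r (s i)) K.
Proof. by rewrite /kval /= !ieval_subst. Qed.

Section TyInd.
Variables (S : fsig) (P : ty S -> Prop).
Hypothesis Pnat : forall X Y, P (TNat X Y).
Hypothesis Pch : forall Ts U, (forall T, List.In T Ts -> P T) -> P (TCh Ts U).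
Hypothesis Pserv : forall k K Ts U, (forall T, List.In T Ts -> P T) -> P (TServ k K Ts U).

Fixpoint ty_all_ind (T : ty S) : P T :=
  let all_in := fix all_in (Ts : seq (ty S)) : forall T, List.In T Ts -> P T :=
    match Ts with
    | [::] => fun T h => False_ind _ h
    | U :: Us => fun T h =>
      match h with
      | or_introl e => eq_ind U P (ty_all_ind U) T e
      | or_intror h => all_in Us T h
      end
    end in
  match T with
  | TNat X Y => Pnat X Y
  | TCh Ts U => Pch U (all_in Ts)
  | TServ k K Ts U => Pserv k K U (all_in Ts)
  end.
End TyInd.

Lemma eq_map_In (X Y : Type) (f g : X -> Y) l :
  (forall x, List.In x l -> f x = g x) -> map f l = map g l.
Proof.
elim: l => //= x l IH h; rewrite h; last by left.
by rewrite IH // => y yl; apply: h; right.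
Qed.

Lemma usage_of_subst S r s (T : ty S) :
  usage_of r (ty_subst s T) = usage_of (fun i => teval r (s i)) T.
Proof. by case: T => //= [Ts U|k K Ts U]; apply: uval_subst. Qed.

Lemma shape_of_subst S s (T : ty S) : forall r,
  shape_of r (ty_subst s T) = shape_of (fun i => teval r (s i)) T.
Proof.
elim/ty_all_ind: T s => [X Y|Ts U IH|k K Ts U IH] s r /=.
- by rewrite !ieval_subst.
- congr HCh; apply: functional_extensionality => _; congr nth; rewrite -map_comp.
    by apply: eq_map_In => T /IH /=.
  by apply: eq_map => T /=; apply: usage_of_subst.
- congr HCh; apply: functional_extensionality => v; first by rewrite kval_subst teval_iup.
    by congr nth; rewrite -map_comp; apply: eq_map_In => T /IH /= ->; rewrite teval_iup.
  congr nth; rewrite -map_comp; apply: eq_map => T /=.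
  by rewrite usage_of_subst teval_iup.
Qed.

Lemma In_map (X Y : Type) (f : X -> Y) x l : List.In x l -> List.In (f x) (map f l).
Proof. by elim: l => //= y l IH [->|/IH]; [left|right]. Qed.

Lemma map_In (X Y : Type) (f : X -> Y) y l : List.In y (map f l) ->
  exists2 x, List.In x l & y = f x.
Proof.
by elim: l => //= z l IH [<-|/IH[x xl ->]]; [exists z; first left|exists x; first right].
Qed.

Lemma twf_subst S s (T : ty S) : forall r,
  twf r (ty_subst s T) -> twf (fun i => teval r (s i)) T.
Proof.
elim/ty_all_ind: T s => [X Y|Ts U IH|k K Ts U IH] s r /= h; first exact: twf_nat.
  inversion h as [|? ? ? hT hU|]; subst; constructor; last by rewrite -uwf_subst.
  by move=> T inT; apply: IH => //; apply/hT/In_map.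
inversion h as [| |? ? ? ? ? hT hU]; subst; constructor; last by rewrite -uwf_subst.
move=> v T inT; rewrite -teval_iup; apply: IH => //; exact/hT/In_map.
Qed.

Lemma wf_ty_val S phi Phi (T : ty S) : wf_ty phi Phi T ->
  forall r, all (csat r) Phi -> twf r T.
Proof.
elim=> {phi Phi T} [phi Phi X Y hX hY|phi Phi Ts U _ IH wU|phi Phi k K Ts U _ IH _ wU] r s.
- exact: twf_nat.
- constructor; last exact: wf_usage_val s wU.
  by move=> T inT; apply: IH.
- constructor; last exact: wf_usage_val s wU.
  by move=> v T inT; apply: IH => //; apply: all_csat_shift.
Qed.

Lemma wf_ctx_val S r phi Phi (G : ctx S) : all (csat r) Phi -> wf_ctx phi Phi G -> gwf r G.
Proof. by move=> s w T inT; apply: wf_ty_val (w T inT) r s. Qed.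

Lemma twf_usage S r (T : ty S) : twf r T ->
  if T is TCh _ U then uwf r U else if T is TServ _ _ _ U then uwf r U else true.
Proof. by case. Qed.

Lemma gwf_cons S r (T : ty S) G : gwf r (T :: G) <-> twf r T /\ gwf r G.
Proof.
split=> [h|[hT h] U [<-|/h]//].
by split=> [|U inU]; apply: h; [left|right].
Qed.

Lemma gwf_cat S r (G D : ctx S) : gwf r (G ++ D) <-> gwf r G /\ gwf r D.
Proof.
elim: G => [|T G IH] /=; first by split=> [|[]] // h; split=> // T.
by rewrite !gwf_cons IH; tauto.
Qed.

Lemma gwf_ins S r a (T : ty S) G : gwf r (ins a T G) <-> twf r T /\ gwf r G.
Proof.
rewrite -{2}(cat_take_drop a G) /ins !gwf_cat gwf_cons; tauto.
Qed.

Lemma gwf_map S r (f : ty S -> ty S) G :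
  (forall T, twf r T -> twf r (f T)) -> gwf r G -> gwf r (map f G).
Proof. by move=> h w U inU; have [T inT ->] := map_In inU; apply/h/w. Qed.

Lemma twf_delay S r c (T : ty S) : cwf r c -> twf r T -> twf r (ty_delay c T).
Proof.
move=> wc h; case: h wc => {r T} [r X Y|r Ts U hT hU|r k K Ts U hT hU] wc;
  by constructor => //; apply: uwf_delay.
Qed.

Lemma twf_bang S r (T : ty S) : twf r T -> twf r (ty_bang T).
Proof. by case=> *; constructor. Qed.

(** Turns the two inclusions that subtyping gives between parameter types into the invariance
    demanded by [heq]. *)
Lemma hsub_antisym s t : hsub s t -> hsub t s -> heq s t.
Proof.
case: s t => [X Y|K Sh Us] [X' Y'|K' Sh' Us'] //.
rewrite /hsub /= => -[a b] [c d]; split; move: a b c d; clear.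
  by case: X X' => [m|] [m'|] //= a _ c _; congr Some; lia.
by case: Y Y' => [m|] [m'|] //= _ a _ c; congr Some; lia.
Qed.

Scheme subty_mut := Minimality for subty Sort Prop
with subtys_mut := Minimality for subtys Sort Prop.

Definition subty_at S r (T T' : ty S) : Prop :=
  hsub (shape_of r T) (shape_of r T') /\ sub (usage_of r T) (usage_of r T').

Definition subtys_at S r (G D : ctx S) : Prop :=
  forall x, hsub (shapes r G x) (shapes r D x) /\ sub (usages r G x) (usages r D x).

Lemma subty_val S phi Phi (T T' : ty S) : subty phi Phi T T' ->
  forall r, all (csat r) Phi -> twf r T -> twf r T' -> subty_at r T T'.
Proof.
move: phi Phi T T'.
apply: (@subty_mut S
  (fun phi Phi T T' => forall r, all (csat r) Phi -> twf r T -> twf r T' -> subty_at r T T')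
  (fun phi Phi Ts Ts' => forall r, all (csat r) Phi -> gwf r Ts -> gwf r Ts' ->
     subtys_at r Ts Ts')).
- move=> phi Phi X Y X' Y' h1 h2 r s _ _; split; last exact: sub_refl.
  by split; [apply: (h1 r s)|apply: (h2 r s)].
- move=> phi Phi Ts Ts' U V _ IH _ IH' sU r s w w'.
  inversion w as [|? ? ? hT hU|]; inversion w' as [|? ? ? hT' hU'|]; subst.
  split; last exact: subu_sub s sU hU hU'.
  split=> // v i; have [a b] := IH r s hT hT' i; have [c d] := IH' r s hT' hT i.
  by split=> //; apply: hsub_antisym.
- move=> phi Phi k K K' Ts Ts' U V _ IH _ IH' [eK1 eK2] sU r s w w'.
  inversion w as [| |? ? ? ? ? hT hU]; inversion w' as [| |? ? ? ? ? hT' hU']; subst.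
  split; last exact: subu_sub s sU hU hU'.
  have sv v := all_csat_shift k v s.
  split=> [v|v i].
    by rewrite /kval; congr pair; apply/eqP; [apply: (eK1 _ (sv v))|apply: (eK2 _ (sv v))].
  have [a b] := IH _ (sv v) (hT v) (hT' v) i; have [c d] := IH' _ (sv v) (hT' v) (hT v) i.
  by split=> //; apply: hsub_antisym.
- move=> phi Phi r _ _ _ x; split; [exact: hsub_refl|exact: sub_refl].
- move=> phi Phi T T' Ts Ts' _ IH _ IHs r s /gwf_cons[w ws] /gwf_cons[w' ws'] [|x].
    exact: IH.
  exact: IHs.
Qed.

Lemma subtys_val S phi Phi (G D : ctx S) : subtys phi Phi G D ->
  forall r, all (csat r) Phi -> gwf r G -> gwf r D -> subtys_at r G D.
Proof.
elim=> {phi Phi G D} [phi Phi|phi Phi T T' Ts Ts' sT _ IH] r s.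
  by move=> _ _ x; split; [apply: hsub_refl|apply: sub_refl].
move=> /gwf_cons[w ws] /gwf_cons[w' ws'] [|x]; first exact: subty_val sT r s w w'.
exact: IH.
Qed.

(** * Interpretation of typings *)

Lemma nth_ins (X : Type) (d : X) a x l i : a <= size l ->
  nth d (take a l ++ x :: drop a l) i =
  if i == a then x else nth d l (if i < a then i else i.-1).
Proof.
move=> al; rewrite nth_cat size_takel //.
case: (ltngtP i a) => ia; last by rewrite ia subnn.
  by rewrite nth_take.
have -> : i - a = (i.-1 - a).+1 by lia.
by rewrite /= nth_drop; congr nth; lia.
Qed.

Lemma map_ins S (X : Type) (f : ty S -> X) a T G :
  map f (ins a T G) = take a (map f G) ++ f T :: drop a (map f G).
Proof. by rewrite /ins map_cat map_take /= map_drop. Qed.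

Lemma usages_ins S r a (T : ty S) G x : a <= size G ->
  usages r (ins a T G) x =
  if x == a then usage_of r T else usages r G (if x < a then x else x.-1).
Proof. by move=> al; rewrite /usages map_ins nth_ins ?size_map. Qed.

Lemma shapes_ins S r a (T : ty S) G x : a <= size G ->
  shapes r (ins a T G) x =
  if x == a then shape_of r T else shapes r G (if x < a then x else x.-1).
Proof. by move=> al; rewrite /shapes map_ins nth_ins ?size_map. Qed.

Lemma shapes_ins_eq S r a (T T' : ty S) G G' :
  shape_of r T = shape_of r T' -> map (shape_of r) G = map (shape_of r) G' ->
  shapes r (ins a T G) = shapes r (ins a T' G').
Proof. by move=> eT eG; rewrite /shapes !map_ins eT eG. Qed.

Lemma shapes_cat S r (G D : ctx S) :
  shapes r (G ++ D) = scons (size G) (shapes r G) (shapes r D).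
Proof.
apply: functional_extensionality => x.
by rewrite /shapes map_cat nth_cat size_map.
Qed.

Lemma usages_cat S r (G D : ctx S) :
  usages r (G ++ D) = scons (size G) (usages r G) (usages r D).
Proof.
apply: functional_extensionality => x.
by rewrite /usages map_cat nth_cat size_map.
Qed.

Lemma shapes_subst S r s (G : ctx S) :
  shapes r (map (ty_subst s) G) = shapes (fun i => teval r (s i)) G.
Proof.
rewrite /shapes -map_comp; congr nth.
by apply: eq_map => T; apply: shape_of_subst.
Qed.

Lemma usages_subst S r s (G : ctx S) :
  usages r (map (ty_subst s) G) = usages (fun i => teval r (s i)) G.
Proof.
rewrite /usages -map_comp; congr nth.
by apply: eq_map => T; apply: usage_of_subst.
Qed.

Lemma shape_of_delay S r c (T : ty S) : shape_of r (ty_delay c T) = shape_of r T.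
Proof. by case: T. Qed.

Lemma shape_of_bang S r (T : ty S) : shape_of r (ty_bang T) = shape_of r T.
Proof. by case: T. Qed.

Lemma map_shape_delay S r c (G : ctx S) :
  map (shape_of r) (map (ty_delay c) G) = map (shape_of r) G.
Proof. by rewrite -map_comp; apply: eq_map => T; apply: shape_of_delay. Qed.

Lemma map_shape_bang S r (G : ctx S) :
  map (shape_of r) (map (@ty_bang S) G) = map (shape_of r) G.
Proof. by rewrite -map_comp; apply: eq_map => T; apply: shape_of_bang. Qed.

Lemma usages_delay S r c (G : ctx S) x : cwf r c -> gwf r G ->
  usages r (map (ty_delay c) G) x = vdelay (capval r c) (usages r G x).
Proof.
move=> wc; rewrite /usages; elim: G x => [|T G IH] x; first by rewrite /= nth_nil.
case/gwf_cons=> w ws; case: x => [|x] /=; last exact: IH.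
by case: T w => [X Y|Ts U|k K Ts U] //= /twf_usage; apply: uval_delay.
Qed.

Lemma usages_bang S r (G : ctx S) x :
  sub (usages r (map (@ty_bang S) G) x) (VBang (usages r G x)).
Proof.
rewrite /usages; elim: G x => [|T G IH] [|x] /=; try exact: sub_bang0; last exact: IH.
by case: T => [X Y|Ts U|k K Ts U] /=; [apply: sub_bang0|apply: sub_refl|apply: sub_refl].
Qed.

Lemma ctx_par_val S r (G D H : ctx S) : ctx_par G D H -> gwf r G -> gwf r D ->
  [/\ gwf r H, map (shape_of r) G = map (shape_of r) H,
      map (shape_of r) D = map (shape_of r) H, size G = size H /\ size D = size H &
      forall x, sub (usages r H x) (VPar (usages r G x) (usages r D x))].
Proof.
elim=> {G D H} [|T T' T'' G D H p _ IH].
  by move=> _ _; split=> // x; rewrite /usages nth_nil; apply: sub_par0.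
move=> /gwf_cons[w ws] /gwf_cons[w' ws']; have [wH e1 e2 [z1 z2] h] := IH ws ws'.
have [wT eT eT' hT] : [/\ twf r T'', shape_of r T = shape_of r T'',
    shape_of r T' = shape_of r T'' &
    sub (usage_of r T'') (VPar (usage_of r T) (usage_of r T'))].
  case: p w w' => {T T' T''} [X Y|Ts U V|k K Ts U V] w w'.
  - by split=> //; apply: sub_par0.
  - inversion w as [|? ? ? hT hU|]; inversion w' as [|? ? ? hT' hU'|]; subst.
    split=> //; last exact: sub_refl.
    by constructor; rewrite //= hU hU'.
  - inversion w as [| |? ? ? ? ? hT hU]; inversion w' as [| |? ? ? ? ? hT' hU']; subst.
    split=> //; last exact: sub_refl.
    by constructor; rewrite //= hU hU'.
split=> //=; first by apply/gwf_cons.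
- by rewrite eT e1.
- by rewrite eT' e2.
- by rewrite z1 z2.
- by case=> [|x]; [apply: hT|apply: h].
Qed.

Lemma onth_nthP (X : Type) (d : X) l i x : onth l i = Some x ->
  nth d l i = x /\ List.In x l.
Proof.
elim: l i => [|y l IH] [|i] //=; first by case=> ->; split=> //; left.
by move/IH=> [e h]; split=> //; right.
Qed.

Lemma onth_val S r (G : ctx S) x T : onth G x = Some T ->
  shapes r G x = shape_of r T /\ usages r G x = usage_of r T.
Proof.
rewrite /shapes /usages; elim: G x => [|U G IH] [|x] //=; first by case=> ->.
exact: IH.
Qed.

Lemma etyping_val S phi Phi (G : ctx S) e T : etyping phi Phi G e T ->
  forall r, all (csat r) Phi ->
  [/\ gwf r G, twf r T, vetyping (shapes r G) e (shape_of r T) &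
      forall x, is_var x e -> sub (usages r G x) (usage_of r T)].
Proof.
elim=> {G e T} [G v T wG eT|G wG|G e X Y _ IH|G D e T T' _ IH sG sT wG wT] r s.
- have w := wf_ctx_val s wG; have [e1 e2] := onth_val r eT.
  split=> //; first exact: w (proj2 (onth_nthP T eT)).
    by rewrite /= e1; apply: hsub_refl.
  by move=> x /= /eqP <-; rewrite e2; apply: sub_refl.
- by split; [apply: wf_ctx_val s wG|apply: twf_nat|apply: hsub_refl|].
- have [w _ h _] := IH r s; split=> //; first exact: twf_nat.
  exists (ieval r X), (ieval r Y); split=> //.
  by rewrite /= !ieval_add; apply: hsub_refl.
- have [wD wT' h hu] := IH r s.
  have w := wf_ctx_val s wG; have wT1 := wf_ty_val wT s.
  have sD := subtys_val sG s w wD; have [s1 s2] := subty_val sT s wT' wT1.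
  split=> //; first by apply: vetyping_mono h => // x; have [] := sD x.
  move=> x /hu hx; have [_ t] := sD x.
  exact: sub_trans t (sub_trans hx s2).
Qed.

Lemma occ_cons x e es :
  occ x (e :: es) = (if is_var x e then [:: 0] else [::]) ++ map succn (occ x es).
Proof.
rewrite /occ /= -[1]addn0 iotaDl filter_map /=; case: ifP => _ //=.
Qed.

Lemma etypings_val S phi Phi (G : ctx S) es Ts : etypings phi Phi G es Ts ->
  forall r, all (csat r) Phi ->
  [/\ gwf r G, size es = size Ts &
      args (shapes r G) (usages r G) es (shapes r Ts) (usages r Ts)].
Proof.
elim=> {G es Ts} [G wG|G e T h|G D H e T es Ts h _ IH p] r s.
- split=> //; first exact: wf_ctx_val s wG.
  by split=> // x; apply: sub_zero.
- have [wG wT he hu] := etyping_val h s; split=> //; split=> [[|i]|x] //.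
  rewrite occ_cons /=; case: ifP => ex /=; last exact: sub_zero.
  exact: sub_trans (hu x ex) (sub_par0 _).
- have [wG wT he hu] := etyping_val h s; have [wD ez [h1 h2]] := IH r s.
  have [wH e1 e2 _ hp] := ctx_par_val p wG wD.
  split=> //; first by rewrite /= ez.
  split=> [[|i] /= ie|x].
  + by rewrite /shapes -e1.
  + by rewrite {1}/shapes -e2; apply: h1.
  rewrite occ_cons; apply: sub_trans _ (cat_upar _ _ _).
  apply: sub_trans (hp x) (sub_par _ _).
    by case: ifP => [/hu ex|_]; [apply: sub_trans ex (sub_par0 _)|apply: sub_zero].
  by rewrite upar_map; apply: h2.
Qed.

Lemma kval_add S r (K : itv S) m : kval r (itv_add K (pt m)) = kadd (kval r K) m.
Proof. by rewrite /kval /= !ieval_add. Qed.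

Lemma kval_max S r (K K' : itv S) : kval r (itv_max K K') = kmax (kval r K) (kval r K').
Proof. by rewrite /kval /= !ieval_max. Qed.

Lemma kseq_val S r c (K K' : itv S) : cwf r c -> cap_seq c K = Some K' ->
  kseq (capval r c) (kval r K) = kval r K'.
Proof.
case: c => [J|[[t|] J]] /=.
- by move=> _ [<-]; rewrite /kval ieval_add.
- by move=> w [<-]; rewrite /kval /kseq lo_itval // hi_itval //= ieval_add.
- by case: J => [//|] w [<-]; rewrite /kseq lo_itval.
Qed.

Lemma itv_sub_val S r Phi (K K' : itv S) : all (csat r) Phi -> itv_sub Phi K K' ->
  ksub (kval r K) (kval r K').
Proof. by move=> s [h1 h2]; apply/andP; split; [apply: (h1 r s)|apply: (h2 r s)]. Qed.

(** Because of this, invoking a server with indices [Is] selects the member of its family at the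
    values of [Is]. *)
Lemma iinst_val S r (Is : seq (tidx S)) :
  (fun i => teval r (iinst Is i))
  = scons (size Is) (fun i => nth 0 (map (teval r) Is) i) r.
Proof.
apply: functional_extensionality => i; rewrite /iinst /scons.
case: ltnP => iz; last by rewrite nth_default.
by rewrite (nth_map (IVar (i - size Is))).
Qed.

Lemma shapes_cons S r (T : ty S) G : shapes r (T :: G) = scons 1 (fun=> shape_of r T) (shapes r G).
Proof.
by apply: functional_extensionality => -[|i] //; rewrite /scons /= subn1.
Qed.

Lemma usages_cons S r (T : ty S) G : usages r (T :: G) = scons 1 (fun=> usage_of r T) (usages r G).
Proof.
by apply: functional_extensionality => -[|i] //; rewrite /scons /= subn1.
Qed.

Lemma cwf_pt S r n : cwf r (CapItv (@pt S n)).
Proof. exact: iwf_pt. Qed.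

(** Well-formedness of the context at r is proved along the way, since the rules check it only at
    leaves and at subsumption. *)
Lemma typing_val S phi Phi (G : ctx S) P K : typing phi Phi G P K ->
  forall r, all (csat r) Phi ->
  gwf r G /\ vtyping P (shapes r G) (usages r G) (kval r K).
Proof.
elim=> {phi Phi G P K} [phi Phi G wG|phi Phi G D H P Q K1 K2 _ IHP _ IHQ p|phi Phi G P K _ IH
  |phi Phi G m P K _ IH|phi Phi G a Ts U c P K K' al wc _ IH eK|phi Phi G a k K Ts U c P al wc _ IH
  |phi Phi G G' H a Ts U V c es P K K' al wc he _ IH p eK
  |phi Phi G G' H a k K Ts U V c Is es P K' K'' al wc ez _ he _ IH p eK
  |phi Phi G e X Y P Q K _ he _ IHP _ IHQ|phi Phi G T P K cT rT _ IH
  |phi Phi G D P K K' _ IH sG sK wG _] r s.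
- by split; [apply: wf_ctx_val s wG|apply: ksub_refl].
- have [wG hP] := IHP r s; have [wD hQ] := IHQ r s.
  have [wH e1 e2 _ h] := ctx_par_val p wG wD; split=> //.
  exists (usages r G), (usages r D), (kval r K1), (kval r K2); split=> //.
  + by rewrite /shapes -e1.
  + by rewrite /shapes -e2.
  + by rewrite kval_max; apply: ksub_refl.
- have [wG hP] := IH r s; split.
    by apply: gwf_map wG => T; exact/twf_delay/cwf_pt.
  exists (usages r G), (kval r K); split.
  + move=> x; rewrite usages_delay ?cwf_pt //.
    by rewrite /= itval_pt; apply: sub_refl.
  + by rewrite /shapes map_shape_delay.
  + by rewrite kval_add; apply: ksub_refl.
- have [wG hP] := IH r s; split.
    by apply: gwf_map wG => T; exact/twf_delay/cwf_pt.
  exists (usages r G), (kval r K); split.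
  + move=> x; rewrite usages_delay ?cwf_pt //.
    by rewrite /= itval_pt; apply: sub_refl.
  + by rewrite /shapes map_shape_delay.
  + by rewrite kval_add; apply: ksub_refl.
- have [/gwf_cat[wTs /gwf_ins[wT wG]] hP] := IH r s.
  have wcv := wf_cap_val s wc.
  inversion wT as [|? ? ? hT hU|]; subst.
  have eD : shapes r (ins a (TCh Ts (UAct DIn (pt 0) c U)) (map (ty_delay c) G))
      = shapes r (ins a (TCh Ts U) G).
    by apply: shapes_ins_eq; rewrite // map_shape_delay.
  split.
    apply/gwf_ins; split; first by apply: twf_ch => //; apply/and3P.
    by apply: gwf_map wG => T; apply: twf_delay.
  rewrite eD; exists (fun=> (Some 0, Some 0)), (fun=> shapes r Ts), (fun=> usages r Ts),
    (capval r c), (usages r (ins a (TCh Ts U) G)), (kval r K).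
  split; first by rewrite shapes_ins // eqxx; apply: hsub_refl.
  split=> [|x /negPf xa|v|].
  + by rewrite !usages_ins ?size_map // eqxx /= itval_pt; apply: sub_refl.
  + by rewrite !usages_ins ?size_map // xa usages_delay //; apply: sub_refl.
  + by rewrite -shapes_cat -usages_cat.
  + by rewrite (kseq_val wcv eK); apply: ksub_refl.
- have wcv := wf_cap_val s wc.
  have sv v := all_csat_shift k v s.
  have eD : shapes r (ins a (TServ k K Ts (UBang (UAct DIn (pt 0) c U)))
        (map (ty_delay c) (map (@ty_bang S) G)))
      = shapes r (ins a (TServ k K Ts U) G).
    by apply: shapes_ins_eq; rewrite // map_shape_delay map_shape_bang.
  have w v : gwf (scons k v r) Ts /\ gwf r (ins a (TServ k K Ts U) G).
    have [/gwf_cat[wTs w] _] := IH _ (sv v); split=> //.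
    move=> T /(In_map (ty_subst (ishift k)))/w/twf_subst /=.
    by rewrite scons_shift.
  (* The second half of [w] does not depend on the values of the bound index variables, so any
     values will do. *)
  have [_ /gwf_ins[wT wG]] := w id.
  inversion wT as [| |? ? ? ? ? hT hU]; subst.
  split.
    apply/gwf_ins; split; first by apply: twf_serv => //; apply/and3P.
    by apply: gwf_map => [T|]; [apply: twf_delay|apply: gwf_map wG => T; apply: twf_bang].
  rewrite eD; exists (fun v => kval (scons k v r) K), (fun v => shapes (scons k v r) Ts),
    (fun v => usages (scons k v r) Ts), (capval r c), (usages r (ins a (TServ k K Ts U) G)).
  split; first by rewrite shapes_ins // eqxx; apply: hsub_refl.
  split=> [|x /negPf xa|v|].
  + by rewrite !usages_ins ?size_map // eqxx /= itval_pt; apply: sub_refl.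
  + rewrite !usages_ins ?size_map // xa usages_delay //; last first.
      by apply: gwf_map wG => T; apply: twf_bang.
    exact/sub_vdelay/usages_bang.
  + have [_] := IH _ (sv v).
    by rewrite shapes_cat usages_cat shapes_subst usages_subst /= scons_shift.
  + exact: ksub_refl.
- have [/gwf_ins[wT wG] hP] := IH r s.
  have wcv := wf_cap_val s wc.
  have [/gwf_ins[wT' wG'] ee ha] := etypings_val he s.
  have [wH e1 e2 [z1 z2] h] := ctx_par_val p wG wG'.
  inversion wT as [|? ? ? hT hU|]; inversion wT' as [|? ? ? _ hV|]; subst.
  have eD (T : ty S) : shape_of r T = shape_of r (TCh Ts (UAct DOut (pt 0) c (UPar V U))) ->
      forall G0, map (shape_of r) G0 = map (shape_of r) H ->
      shapes r (ins a (TCh Ts (UAct DOut (pt 0) c (UPar V U))) (map (ty_delay c) H))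
      = shapes r (ins a T G0).
    by move=> eT G0 eG; apply: shapes_ins_eq; rewrite ?eT // map_shape_delay eG.
  split.
    apply/gwf_ins; split; first by apply: twf_ch => //; apply/and3P; split=> //; apply/andP.
    by apply: gwf_map wH => T; apply: twf_delay.
  (* The families of a channel are constant, so [id] is an arbitrary choice of index values. *)
  exists (fun=> (Some 0, Some 0)), (fun=> shapes r Ts), (fun=> usages r Ts),
    (capval r c), (usages r (ins a (TCh Ts U) G)), (usages r (ins a (TCh Ts V) G')), id, (kval r K).
  split; first by rewrite shapes_ins ?size_map // eqxx; apply: hsub_refl.
  split=> [|x /negPf xa|||].
  + by rewrite !usages_ins ?size_map ?z1 ?z2 // eqxx /= itval_pt; apply: sub_refl.
  + rewrite !usages_ins ?size_map ?z1 ?z2 // xa usages_delay //.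
    exact/sub_vdelay/h.
  + by rewrite (eD (TCh Ts V) _ G').
  + by rewrite (eD (TCh Ts U) _ G).
  + by rewrite kmax00 (kseq_val wcv eK); apply: ksub_refl.
- have [/gwf_ins[wT wG] hP] := IH r s.
  have wcv := wf_cap_val s wc.
  have [/gwf_ins[wT' wG'] ee ha] := etypings_val he s.
  have [wH e1 e2 [z1 z2] h] := ctx_par_val p wG wG'.
  inversion wT as [| |? ? ? ? ? hT hU]; inversion wT' as [| |? ? ? ? ? _ hV]; subst.
  have eD (T : ty S) : shape_of r T = shape_of r (TServ (size Is) K Ts (UAct DOut (pt 0) c (UPar V U))) ->
      forall G0, map (shape_of r) G0 = map (shape_of r) H ->
      shapes r (ins a (TServ (size Is) K Ts (UAct DOut (pt 0) c (UPar V U))) (map (ty_delay c) H))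
      = shapes r (ins a T G0).
    by move=> eT G0 eG; apply: shapes_ins_eq; rewrite ?eT // map_shape_delay eG.
  split.
    apply/gwf_ins; split; first by apply: twf_serv => //; apply/and3P; split=> //; apply/andP.
    by apply: gwf_map wH => T; apply: twf_delay.
  pose v i := nth 0 (map (teval r) Is) i.
  exists (fun v => kval (scons (size Is) v r) K), (fun v => shapes (scons (size Is) v r) Ts),
    (fun v => usages (scons (size Is) v r) Ts), (capval r c),
    (usages r (ins a (TServ (size Is) K Ts U) G)),
    (usages r (ins a (TServ (size Is) K Ts V) G')), v, (kval r K').
  split; first by rewrite shapes_ins ?size_map // eqxx; apply: hsub_refl.
  split=> [|x /negPf xa|||].
  + by rewrite !usages_ins ?size_map ?z1 ?z2 // eqxx /= itval_pt; apply: sub_refl.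
  + rewrite !usages_ins ?size_map ?z1 ?z2 // xa usages_delay //.
    exact/sub_vdelay/h.
  + rewrite (eD (TServ (size Is) K Ts V) _ G') //.
    by move: ha; rewrite shapes_subst usages_subst iinst_val.
  + by rewrite (eD (TServ (size Is) K Ts U) _ G).
  + have := kseq_val wcv eK; rewrite kval_max kval_subst iinst_val => ->.
    exact: ksub_refl.
- have [wG _ ee _] := etyping_val he s; split=> //.
  exists (ieval r X), (ieval r Y), (kval r K); split=> //; last exact: ksub_refl.
  (* The constraint added for this branch holds at r by [X0], so the induction hypothesis applies at
     the same valuation. *)
  + by move=> X0; have [|] := IHP r; first by rewrite /= s /csat /= X0.
  + move=> Y1; have [|_] := IHQ r; first exact/andP.
    by rewrite shapes_cons usages_cons /= !ieval_pred.
- have [/gwf_cons[wT wG] hP] := IH r s; split=> //.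
  exists (shape_of r T), (usage_of r T), (kval r K); split=> //; last exact: ksub_refl.
  + by case: T cT {rT IH wT hP}.
  + case: T cT rT wT {IH hP} => [//|Ts U|k K0 Ts U] /= _ rU /twf_usage wU.
    * exact: ureliable_rel s _ rU wU.
    * exact: ureliable_rel s _ rU wU.
  + by rewrite -shapes_cons -usages_cons.
- have [wD hP] := IH r s; have w := wf_ctx_val s wG; split=> //.
  have sD := subtys_val sG s w wD.
  by apply: vtyping_mono hP => [x|x|]; [have [] := sD x|have [] := sD x|apply: itv_sub_val s sK].
Qed.

(** * Kinds of the variables in a derivation *)

Definition kinds S (G : ctx S) : nat -> bool := nth true (map (@is_chan S) G).

Lemma kinds_ins S a (T T' : ty S) G G' :
  is_chan T = is_chan T' -> map (@is_chan S) G = map (@is_chan S) G' ->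
  kinds (ins a T G) = kinds (ins a T' G').
Proof. by move=> eT eG; rewrite /kinds !map_ins eT eG. Qed.

Lemma kinds_ins_at S a (T : ty S) G : a <= size G -> kinds (ins a T G) a = is_chan T.
Proof. by move=> al; rewrite /kinds map_ins nth_ins ?size_map ?eqxx. Qed.

Lemma kinds_cat S (G D : ctx S) x : kinds (G ++ D) x -> scons (size G) xpredT (kinds D) x.
Proof.
by rewrite /kinds map_cat nth_cat size_map /scons; case: ifP.
Qed.

Lemma eq_map_kind S (f : ty S -> ty S) G :
  (forall T, is_chan (f T) = is_chan T) -> map (@is_chan S) (map f G) = map (@is_chan S) G.
Proof. by move=> h; rewrite -map_comp; apply: eq_map => T; apply: h. Qed.

Lemma ctx_par_kinds S (G D H : ctx S) : ctx_par G D H ->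
  [/\ map (@is_chan S) G = map (@is_chan S) H, map (@is_chan S) D = map (@is_chan S) H
    & size G = size H].
Proof.
elim=> {G D H} [//|T T' T'' G D H p _ [e1 e2 e3]] /=.
by rewrite e1 e2 e3; case: p.
Qed.

Lemma subtys_kinds S phi Phi (G D : ctx S) : subtys phi Phi G D ->
  map (@is_chan S) G = map (@is_chan S) D.
Proof. by elim=> {phi Phi G D} //= phi Phi T T' Ts Ts' [] *; congr cons. Qed.

Lemma is_chan_delay S c (T : ty S) : is_chan (ty_delay c T) = is_chan T.
Proof. by case: T. Qed.

Lemma is_chan_bang S (T : ty S) : is_chan (ty_bang T) = is_chan T.
Proof. by case: T. Qed.

Lemma is_chan_subst S s (T : ty S) : is_chan (ty_subst s T) = is_chan T.
Proof. by case: T. Qed.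

(** Proved on the original derivation, in which both branches of a match are typed. *)
Lemma typing_kinded S phi Phi (G : ctx S) P K : typing phi Phi G P K -> kinded P (kinds G).
Proof.
elim=> {phi Phi G P K} [//|phi Phi G D H P Q K1 K2 _ IHP _ IHQ p|phi Phi G P K _ IH
  |phi Phi G m P K _ IH|phi Phi G a Ts U c P K K' al wc _ IH eK|phi Phi G a k K Ts U c P al wc _ IH
  |phi Phi G G' H a Ts U V c es P K K' al wc he _ IH p eK
  |phi Phi G G' H a k K Ts U V c Is es P K' K'' al wc ez _ he _ IH p eK
  |phi Phi G e X Y P Q K _ he _ IHP _ IHQ|phi Phi G T P K cT rT _ IH
  |phi Phi G D P K K' _ IH sG sK wG _] /=.
- by have [e1 e2 _] := ctx_par_kinds p; move: IHP IHQ; rewrite /kinds e1 e2 => -> ->.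
- by rewrite /kinds eq_map_kind // => T; apply: is_chan_delay.
- by rewrite /kinds eq_map_kind // => T; apply: is_chan_delay.
- rewrite kinds_ins_at ?size_map //=; apply: kinded_mono IH => x /kinds_cat.
  apply: scons_impl => // y; rewrite -(@kinds_ins _ a (TCh Ts U) _ G) //.
  by rewrite eq_map_kind // => T; apply: is_chan_delay.
- rewrite kinds_ins_at ?size_map //=; apply: kinded_mono IH => x /kinds_cat.
  apply: scons_impl => // y.
  rewrite {1}/kinds eq_map_kind -/(kinds _); last by move=> T; apply: is_chan_subst.
  rewrite (@kinds_ins _ a _ (TServ k K Ts (UBang (UAct DIn (pt 0) c U))) _
    (map (ty_delay c) (map (@ty_bang S) G))) //.
  rewrite !eq_map_kind // => T; [exact: is_chan_bang|exact: is_chan_delay].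
- have [e1 _ z1] := ctx_par_kinds p; rewrite kinds_ins_at ?size_map //=.
  rewrite (@kinds_ins _ a _ (TCh Ts U) _ G) // eq_map_kind ?e1 // => T.
  exact: is_chan_delay.
- have [e1 _ z1] := ctx_par_kinds p; rewrite kinds_ins_at ?size_map //=.
  rewrite (@kinds_ins _ a _ (TServ k K Ts U) _ G) // eq_map_kind ?e1 // => T.
  exact: is_chan_delay.
- rewrite IHP /=; apply: kinded_mono IHQ => -[|x] //.
  by rewrite /scons /= subn1.
- by apply: kinded_mono IH => -[|x] //; rewrite /scons /= subn1.
- by rewrite /kinds (subtys_kinds sG).
Qed.

Lemma shapes_chan S r (G : ctx S) x : all (@is_chan S) G -> is_ch (shapes r G x).
Proof.
rewrite /shapes; elim: G x => [|T G IH] [|x] //= /andP[h hG]; last exact: IH.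
by case: T h.
Qed.

(** * Reliable contexts and the two bounds *)

Lemma reliable_V0 : reliable V0.
Proof.
have no b W : ~ comm_of V0 b W.
  by move=> h; inversion h as [A c U1 B e V1 X Y x]; inversion x.
move=> V t; inversion t as [|U V' W x]; first by case=> W /no.
by case: (no _ _ x).
Qed.

Lemma usages_rel S r Phi (G : ctx S) : all (csat r) Phi -> gwf r G ->
  ctx_reliable Phi G -> forall x, reliable (usages r G x).
Proof.
move=> s; rewrite /usages; elim: G => [|T G IH] w rG x.
  by rewrite nth_nil; apply: reliable_V0.
case/gwf_cons: w => wT wG; case: x => [|x] /=; last first.
  by apply: IH => // U inU; apply: rG; right.
have rT := rG T (or_introl (erefl T)).
case: T rT wT {rG} => [X Y|Ts U|k K Ts U] /= rU /twf_usage wU; first exact: reliable_V0.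
  exact: ureliable_rel s _ rU wU.
exact: ureliable_rel s _ rU wU.
Qed.

Theorem mainTheorem1 (S : fsig) (phi : nat) (Phi : seq (constr S)) (G : ctx S)
    (P : proc) (I J : idx S) (n : enat)
    (hPhi : forall c, List.In c Phi -> wf_constr phi c)
    (hn : global_complexity P n)
    (hP : typing phi Phi G P (I, J))
    (hG : ctx_reliable Phi G) :
  entails Phi (Constr (idx_of_enat n) Cle J) /\
  (all (@is_chan S) G -> entails Phi (Constr I Cle (idx_of_enat n))).
Proof.
have en r : ieval r (@idx_of_enat S n) = n by case: (n).
have [hb hmin] := hn.
split=> [r s|cG r s]; have [w st0] := typing_val hP s; rewrite /csat /= en.
  (* As n is the least bound, it suffices that J bounds the local complexity of every reduct. *)
  apply: hmin => Q PQ.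
  have [u' _ st1] := vtyping_reachable PQ st0 (usages_rel s w hG).
  exact: vtyping_local_complexity st1.
(* One reduct whose local complexity reaches I is enough, as n bounds all reducts. *)
have [||Q PQ] := vtyping_lower_bound _ _ st0.
- by move=> x; apply: shapes_chan.
- by apply: kinded_mono (typing_kinded hP).
by move=> hQ; apply: ele_trans hQ (hb Q PQ).
Qed.
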